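(* Let $n\ge1$. For all $\mathbf{a}=(a_0,a_1,a_2)$, $$\prod_{i=1}^n \bigl(a_0+a_1(x_i+\overline{x}_i)+a_2(x_i^2+\overline{x}_i^2)\bigr)=\sum_{p=0}^n\sum_{q=0}^{n-p}\ a_2^p\ \psi_{q,r}(\mathbf{a})\ \mathrm{ch}^{O(2n)}_{(2^p,1^q,0^r)}(\mathbf{x},\overline{\mathbf{x}}),\qquad r=n-p-q,$$ where $$\psi_{q,r}(\mathbf{a})=\sum_{t=0}^r\chi_{q,r-t}(\mathbf{a})\,S_t+\chi_{q-1,0}(\mathbf{a})\,(1-\delta_{r,0})\,a_1(-a_2)^r+\chi_{q-2,0}(\mathbf{a})\,(-\delta_{r,0}\,a_2^2+\delta_{r,1}\,a_2^3),$$ with $$S_0=1,\quad S_1=0,\quad S_2=a_0a_2-a_1^2,\quad S_3=-a_0a_2^2+2a_1^2a_2-2a_2^3,\quad S_4=-2a_1^2a_2^2+a_2^4,$$ $$S_t=-2a_1^2(-a_2)^{t-2}\ \text{ for } t\ge5,$$ and $$\chi_{q,r}(\mathbf{a})=Q_qR_r+a_2^3\,Q_{q-2}R_{r-1}+a_1Q_{q-1}\sum_{s=1}^r(-a_2)^sR_{r-s},$$ where $Q_q=0$ if $q<0$, $Q_0=1$ and $$Q_q=a_1Q_{q-1}-a_0a_2Q_{q-2}+a_1a_2^2Q_{q-3}-a_2^4Q_{q-4}\quad\text{if } q\ge1,$$ while $R_r=0$ if $r<0$, $R_0=1$ and $$R_r=a_0R_{r-1}-a_1^2R_{r-2}-a_0a_2^2R_{r-3}+a_2^4R_{r-4}-2a_1^2\sum_{s=1}^{r-2}(-a_2)^sR_{r-s-2}\quad\text{if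 } r\ge1 .$$
   Context: $\mathbf{x}=(x_1,\dots,x_n)$ are indeterminates, $\overline{x}_i=x_i^{-1}$, $\overline{\mathbf{x}}=(\overline{x}_1,\dots,\overline{x}_n)$; the $a_k$ are arbitrary scalar parameters; empty sums are $0$; $\delta$ is the Kronecker delta. For a partition $\lambda$ of length $\ell(\lambda)\le n$, $\mathrm{ch}^{O(2n)}_\lambda(\mathbf{x},\overline{\mathbf{x}})$ is the character of the irreducible representation of $O(2n)$ of highest weight $\lambda$ evaluated on an element of $SO(2n)$ with eigenvalues $(\mathbf{x},\overline{\mathbf{x}})$. In terms of irreducible characters of $SO(2n)$: $\mathrm{ch}^{O(2n)}_\lambda=\mathrm{ch}^{SO(2n)}_\lambda$ if $\ell(\lambda)<n$, and $\mathrm{ch}^{O(2n)}_\lambda=\mathrm{ch}^{SO(2n)}_{\lambda_+}+\mathrm{ch}^{SO(2n)}_{\lambda_-}$ if $\ell(\lambda)=n$, with $\lambda_\pm=(\lambda_1,\dots,\lambda_{n-1},\pm\lambda_n)$. The partition $(2^p,1^q,0^r)$ has $p$ parts $2$, $q$ parts $1$ and $r$ parts $0$. *)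

(* Defs.v *)
From HB Require Import structures.
From mathcomp Require Import all_boot all_order all_algebra.
From mathcomp Require Import mpoly.

Set Implicit Arguments.
Unset Strict Implicit.
Unset Printing Implicit Defensive.

Import Order.TTheory GRing.Theory Num.Theory.

Local Open Scope ring_scope.

(* The complex group O(2n) is taken in its split form, i.e. as the isometry
   group of the quadratic form v_1 v_{n+1} + ... + v_n v_{2n}, so that its
   maximal torus consists of diagonal matrices. *)
Section OrthogonalGroup.
Variables (C : numClosedFieldType) (n : nat).

Definition formJ : 'M[C]_(n + n) := block_mx 0 1%:M 1%:M 0.

Definition O2n : {pred 'M[C]_(n + n)} :=
  [pred g | g^T *m formJ *m g == formJ].

(* An element of SO(2n) with eigenvalues x_1, ..., x_n, x_1^-1, ..., x_n^-1. *)
Definition torus (x : 'rV[C]_n) : 'M[C]_(n + n) :=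
  diag_mx (row_mx x (map_mx GRing.inv x)).

(* Root subgroups of the positive roots e_i - e_j and e_i + e_j (for i < j). *)
Definition root_sub (i j : 'I_n) (s : C) : 'M[C]_(n + n) :=
  block_mx (1%:M + s *: delta_mx i j) 0 0 (1%:M - s *: delta_mx j i).

Definition root_add (i j : 'I_n) (s : C) : 'M[C]_(n + n) :=
  block_mx 1%:M (s *: (delta_mx i j - delta_mx j i)) 0 1%:M.

(* Finite-dimensional rational representations of O(2n), as matrix
   representations acting on column vectors. Since g^-1 = J g^T J on O(2n), the
   regular functions are the polynomials in the entries of g. The values of
   rho outside O2n are irrelevant. *)
Definition rational_rep (m : nat) (rho : 'M[C]_(n + n) -> 'M[C]_m) : Prop :=
  [/\ rho 1%:M = 1%:M,
      {in O2n &, forall g h, rho (g *m h) = rho g *m rho h}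
    & forall i j, exists P : {mpoly C[(n + n) * (n + n)]},
        {in O2n, forall g, rho g i j = P.@[fun k => mxvec g 0 k]}].

Definition irreducible_rep (m : nat) (rho : 'M[C]_(n + n) -> 'M[C]_m) : Prop :=
  (0 < m)%N /\
  forall U : {vspace 'cV[C]_m},
    {in O2n, forall g v, v \in U -> rho g *m v \in U} ->
    U = 0%VS \/ U = fullv.

(* There is a nonzero vector of weight lam that is fixed by all the positive
   root subgroups, i.e. annihilated by all the positive root vectors. *)
Definition has_highest_weight (m : nat) (rho : 'M[C]_(n + n) -> 'M[C]_m)
    (lam : n.-tuple nat) : Prop :=
  exists v : 'cV[C]_m,
    [/\ v != 0,
        forall x : 'rV[C]_n, (forall i, x 0 i != 0) ->
          rho (torus x) *m v = (\prod_(i < n) x 0 i ^+ tnth lam i) *: v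
      & forall (i j : 'I_n) (s : C), (i < j)%N ->
          rho (root_sub i j s) *m v = v /\ rho (root_add i j s) *m v = v].

(* When lam has fewer than n nonzero parts there are two irreducible
   representations of O(2n) of highest weight lam; they differ by the factor
   det, so their characters agree on SO(2n), hence at torus x. *)
Definition is_chO2n (lam : n.-tuple nat) (ch : 'rV[C]_n -> C) : Prop :=
  exists (m : nat) (rho : 'M[C]_(n + n) -> 'M[C]_m),
    [/\ rational_rep rho, irreducible_rep rho, has_highest_weight rho lam
      & forall x : 'rV[C]_n, (forall i, x 0 i != 0) ->
          ch x = \tr (rho (torus x))].

End OrthogonalGroup.

(* The partition (2^p, 1^q, 0^(n-p-q)). *)
Definition part21 (n p q : nat) : n.-tuple nat :=
  [tuple (if (i < p)%N then 2%N else if (i < p + q)%N then 1%N else 0%N)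
  | i < n].

(* The sequence u with u_k = 0 for k < 0, u_0 = 1 and
   u_k = step [:: u_(k-1); u_(k-2); ...; u_0] for k >= 1. *)
Section Recurrence.
Variables (C : pzRingType) (step : seq C -> C).

Definition history (k : nat) : seq C :=
  iter k (fun l => step l :: l) [:: 1].

Definition rec_seq (k : int) : C :=
  if k is Posz k' then (history k')`_0 else 0.

Lemma history_nth (k i : nat) :
  (history k)`_i = rec_seq (k%:Z - i%:Z).
Proof.
elim: i k => [|i IH] k; first by rewrite subr0.
case: k => [|k]; first by rewrite /= nth_nil.
by rewrite /= -/(history k) IH !intS opprD addrACA subrr add0r.
Qed.

Lemma rec_seq_neg (k : int) : k < 0 -> rec_seq k = 0.
Proof. by case: k. Qed.

Lemma rec_seq0 : rec_seq 0 = 1. Proof. by []. Qed.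

Lemma rec_seqS (k : nat) : rec_seq k.+1 = step (history k).
Proof. by []. Qed.

End Recurrence.

Section Coefficients.
Variables (C : comPzRingType) (a0 a1 a2 : C).

Definition Qstep (l : seq C) : C :=
  a1 * l`_0 - a0 * a2 * l`_1 + a1 * a2 ^+ 2 * l`_2 - a2 ^+ 4 * l`_3.

Definition Qseq : int -> C := rec_seq Qstep.

(* Here size l = r, so that l`_s.+1 = R_(r-s-2). *)
Definition Rstep (l : seq C) : C :=
  a0 * l`_0 - a1 ^+ 2 * l`_1 - a0 * a2 ^+ 2 * l`_2 + a2 ^+ 4 * l`_3
  - 2 * a1 ^+ 2 * \sum_(1 <= s < (size l).-1) (- a2) ^+ s * l`_s.+1.

Definition Rseq : int -> C := rec_seq Rstep.

Lemma Q_rec (q : int) : 1 <= q ->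
  Qseq q = a1 * Qseq (q - 1) - a0 * a2 * Qseq (q - 2)
           + a1 * a2 ^+ 2 * Qseq (q - 3) - a2 ^+ 4 * Qseq (q - 4).
Proof.
case: q => [[|q]|q] // _; rewrite /Qseq rec_seqS /Qstep !history_nth.
by congr (_ * rec_seq _ _ - _ * rec_seq _ _ + _ * rec_seq _ _
          - _ * rec_seq _ _);
   rewrite intS [1 + _]addrC -addrA.
Qed.

Lemma R_rec (r : nat) : (1 <= r)%N ->
  Rseq r = a0 * Rseq (r%:Z - 1) - a1 ^+ 2 * Rseq (r%:Z - 2)
        - a0 * a2 ^+ 2 * Rseq (r%:Z - 3) + a2 ^+ 4 * Rseq (r%:Z - 4)
        - 2 * a1 ^+ 2
          * \sum_(1 <= s < r.-1) (- a2) ^+ s * Rseq (r%:Z - s%:Z - 2).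
Proof.
case: r => // r _; rewrite /Rseq rec_seqS /Rstep !history_nth.
have -> : size (history Rstep r) = r.+1 by elim: r => //= r ->.
congr (_ * rec_seq _ _ - _ * rec_seq _ _ - _ * rec_seq _ _ + _ * rec_seq _ _
        - _ * _); try by rewrite intS [1 + _]addrC -addrA.
apply: eq_bigr => s _; rewrite history_nth; congr (_ * rec_seq _ _).
by rewrite !intS -[2]/(1 + 1) [1 + r%:Z]addrC !opprD !addrA addrAC
           [r%:Z + 1 - _]addrAC addrK addrAC.
Qed.

Definition Sseq (t : nat) : C :=
  match t with
  | 0 => 1
  | 1 => 0
  | 2 => a0 * a2 - a1 ^+ 2
  | 3 => - a0 * a2 ^+ 2 + 2 * a1 ^+ 2 * a2 - 2 * a2 ^+ 3
  | 4 => - 2 * a1 ^+ 2 * a2 ^+ 2 + a2 ^+ 4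
  | _ => - 2 * a1 ^+ 2 * (- a2) ^+ (t - 2)
  end.

Definition chi (q : int) (r : nat) : C :=
  Qseq q * Rseq r + a2 ^+ 3 * Qseq (q - 2) * Rseq (r%:Z - 1)
  + a1 * Qseq (q - 1) * \sum_(1 <= s < r.+1) (- a2) ^+ s * Rseq (r%:Z - s%:Z).

Definition psi (q r : nat) : C :=
  \sum_(0 <= t < r.+1) chi q (r - t) * Sseq t
  + chi (q%:Z - 1) 0%N * (1 - (r == 0%N)%:R) * a1 * (- a2) ^+ r
  + chi (q%:Z - 2) 0%N * (- (r == 0%N)%:R * a2 ^+ 2 + (r == 1%N)%:R * a2 ^+ 3).

End Coefficients.

(* Main.v *)
Require Import Defs.
From HB Require Import structures.
From mathcomp Require Import all_boot all_order all_fingroup all_algebra.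
From mathcomp Require Import spectral mpoly ring zify.
Set Implicit Arguments.
Unset Strict Implicit.
Unset Printing Implicit Defensive.
Import Order.TTheory GRing.Theory Num.Theory.
Local Open Scope ring_scope.

(** Put y_i = x_i + 1/x_i. The left-hand side is the product of the quadratics
    a_0 + a_1 y_i + a_2 (y_i^2 - 2), and if Y_1, Y_2 are the roots of this
    quadratic it equals a_2^n \prod_i (y_i - Y_1)(y_i - Y_2). Multiplied by the
    Vandermonde products of the y_i and of (Y_1, Y_2), it becomes, up to sign and
    the factor a_2^n, the Vandermonde determinant of the n + 2 points
    y_1, ..., y_n, Y_1, Y_2. Written in the basis
    of the monic polynomials [cheb k], where [cheb k] maps x + 1/x to
    x^k + x^-k for k > 0, and expanded along the last two columns, it is a sum
    over the two exponents l > k that the remaining n x n minor [gapdet] omits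
    ([dual_cauchy]). By Weyl's character formula the minor with the exponents
    l = n + 1 - p and k = n - p - q omitted is the Vandermonde product of the y_i
    times the character of highest weight (2^p, 1^q, 0^r)
    ([part21_character]). The 2 x 2 minors in Y_1, Y_2 are, up to signs and powers
    of a_2, the products of Y_1 - Y_2 and the coefficients [psi]; this is
    [psi_closed], a comparison of linear recurrences. This gives the identity when
    a_2 and the discriminant of the quadratic are nonzero and the y_i are distinct;
    both sides are Laurent polynomials in x and polynomials in a_2, so it holds in
    general.

    The bulk of the work is Weyl's formula for the characters, which are given
    only as traces of irreducible rational representations of O(2n) with a
    highest weight vector. The differential of the representation rho is
    obtained from curves of group elements whose entries are Laurent polynomials
    ([differential_exists]); no analysis is involved. The group is generated by
    unipotent elements, the torus and one reflection (a form of the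
    Cartan-Dieudonne theorem, [O2n_generated]), so that the span of the vectors
    reached by lowering operators from a highest weight vector and its image under
    this reflection is stable under the group. Hence lambda occurs once and
    dominates every other weight ([highest_weight_unique]). The Casimir element is
    a scalar by Schur's lemma, and its trace against a torus element is a second-order differential
    operator applied to the character ([radial_equation]). After multiplication
    by the Weyl denominator the character becomes an eigenvector of the
    Laplacian: only exponents of norm |lambda + delta| occur, and among the
    exponents dominated by lambda + delta these are its images under the group
    of signed permutations. Antisymmetry leaves a single alternant
    ([weyl_character]). Signed permutations, rather than those with an even
    number of sign changes, act because the group is O(2n); this is why the
    alternants are determinants in the x_j^k + x_j^-k, that is, in the y_j. *)

(** * First-order jets of Laurent polynomials *)

Section Jets.
Variable C : numClosedFieldType.
Implicit Types (f g : C -> C) (p q : {poly C}) (a b : C).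

(** The product [p * q] vanishes everywhere, and the field is infinite. *)
Lemma poly_vanish_nz q p :
  p != 0 -> (forall z : C, p.[z] != 0 -> q.[z] = 0) -> q = 0.
Proof.
move=> p0 qz; apply/eqP; apply: contraT => q0.
have pq0 : p * q != 0 by rewrite mulf_neq0.
pose s : seq C := [seq i%:R | i <- iota 0 (size (p * q))].
have us : uniq s.
  by rewrite map_inj_uniq ?iota_uniq // => i j /eqP; rewrite eqr_nat => /eqP.
have rs : all (root (p * q)) s.
  apply/allP=> z _; rewrite /root hornerM.
  by case: (eqVneq p.[z] 0) => [->|/qz->]; rewrite ?mul0r ?mulr0.
by have := max_poly_roots pq0 rs us; rewrite size_map size_iota ltnn.
Qed.

Lemma polyX_vanish q : (forall z : C, z != 0 -> q.[z] = 0) -> q = 0.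
Proof.
by move=> qz; apply: (@poly_vanish_nz q 'X); rewrite ?polyX_eq0 // => z;
  rewrite hornerX; apply: qz.
Qed.

(** [f] is a Laurent polynomial off 0, with value [a] and derivative [b] at 1. Clearing
    the pole with [z ^+ d] makes this a statement about one polynomial. *)
Definition jet f a b := exists d q,
  [/\ forall z : C, z != 0 -> z ^+ d * f z = q.[z], q.[1] = a
    & q^`().[1] = b + a *+ d].

Lemma jet_ext f g a b : (forall z : C, z != 0 -> f z = g z) -> jet f a b -> jet g a b.
Proof.
by move=> fg [d [q [fq qa qb]]]; exists d, q; split=> // z z0; rewrite -fg // fq.
Qed.

Lemma jet_uniq f a b a' b' : jet f a b -> jet f a' b' -> a = a' /\ b = b'.
Proof.
move=> [d [q [fq <- qb]]] [d' [q' [fq' <- qb']]].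
have E : q * 'X^d' = q' * 'X^d.
  apply/eqP; rewrite -subr_eq0; apply/eqP/polyX_vanish => z z0.
  by rewrite !hornerE -fq // -fq' //; ring.
have E1 : q.[1] = q'.[1] by have := congr1 (horner^~ 1) E; rewrite !hornerE !expr1n !mulr1.
split=> //; have := congr1 (fun p => p^`().[1]) E.
rewrite !derivM !derivXn !hornerE !hornerMn !hornerXn !expr1n !mulr1 qb qb' E1.
rewrite !mulr_natr; move/eqP; rewrite -!addrA [_ *+ d' + _]addrC.
by rewrite (inj_eq (addIr _)) => /eqP.
Qed.

Lemma jet_cst c : jet (fun=> c) c 0.
Proof. by exists 0%N, c%:P; split=> [z _||]; rewrite ?derivC !hornerE ?mulr0n ?addr0. Qed.

Lemma jet_id : jet id 1 1.
Proof. by exists 0%N, 'X; split=> [z _||]; rewrite ?derivX !hornerE ?mulr0n ?addr0. Qed.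

Lemma jet_inv : jet (fun z => z^-1) 1 (-1).
Proof.
exists 1%N, 1; split=> [z z0||]; rewrite ?derivC !hornerE ?mulfV ?mulr1n ?addNr //.
Qed.

Lemma jetD f g a b a' b' : jet f a b -> jet g a' b' ->
  jet (fun z => f z + g z) (a + a') (b + b').
Proof.
move=> [d [q [fq <- qb]]] [d' [q' [fq' <- qb']]].
have aux (u v s t : C) : u * v * (s + t) = u * s * v + v * t * u by ring.
exists (d + d')%N, (q * 'X^d' + q' * 'X^d); split=> [z z0||].
- by rewrite !hornerE -fq // -fq' // exprD aux.
- by rewrite !hornerE !expr1n !mulr1.
rewrite derivD !derivM !derivXn !hornerE !hornerMn !hornerXn !expr1n !mulr1 qb qb'.
rewrite !mulr_natr mulrnDl !mulrnDr.
have aux2 (u v s t x y : C) : u + s + t + (v + x) + y = u + v + (s + t + (y + x)) by ring.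
exact: aux2.
Qed.

Lemma jetM f g a b a' b' : jet f a b -> jet g a' b' ->
  jet (fun z => f z * g z) (a * a') (b * a' + a * b').
Proof.
move=> [d [q [fq <- qb]]] [d' [q' [fq' <- qb']]].
exists (d + d')%N, (q * q'); split=> [z z0||].
- by rewrite hornerM -fq // -fq' // exprD; apply: mulrACA.
- by rewrite hornerM.
have aux (u v s t x y : C) : (b + x) * t + u * (b' + y) =
  b * t + u * b' + (x * t + u * y) by ring.
by rewrite derivM hornerD !hornerM qb qb' mulrnDr -mulrnAl -mulrnAr; apply: aux.
Qed.

Lemma jetZ c f a b : jet f a b -> jet (fun z => c * f z) (c * a) (c * b).
Proof. by move=> /(jetM (jet_cst c)); rewrite mul0r add0r. Qed.

Lemma jetN f a b : jet f a b -> jet (fun z => - f z) (- a) (- b).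
Proof.
move/(jetZ (-1)); rewrite !mulN1r; apply: jet_ext => z _; exact: mulN1r.
Qed.

Lemma jet_sum (I : Type) (r : seq I) (P : pred I) (f : I -> C -> C) (a b : I -> C) :
  (forall i, P i -> jet (f i) (a i) (b i)) ->
  jet (fun z => \sum_(i <- r | P i) f i z) (\sum_(i <- r | P i) a i)
      (\sum_(i <- r | P i) b i).
Proof.
move=> H; elim: r => [|i r IH].
  by rewrite !big_nil; apply: jet_ext (jet_cst 0) => z _; rewrite big_nil.
rewrite !big_cons; case: ifP => Pi.
  by apply: jet_ext (jetD (H _ Pi) IH) => z _; rewrite big_cons Pi.
by apply: jet_ext IH => z _; rewrite big_cons Pi.
Qed.

(** The logarithmic form of the Leibniz rule suits the products to which it is applied,
    Vandermonde products and monomials, whose factors do not vanish at 1. *)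
Lemma jet_prod (I : Type) (r : seq I) (P : pred I) (f : I -> C -> C) (a b : I -> C) :
  (forall i, P i -> a i != 0) ->
  (forall i, P i -> jet (f i) (a i) (b i)) ->
  jet (fun z => \prod_(i <- r | P i) f i z) (\prod_(i <- r | P i) a i)
      (\prod_(i <- r | P i) a i * \sum_(i <- r | P i) b i / a i).
Proof.
move=> a0 H; elim: r => [|i r IH].
  rewrite !big_nil mulr0; apply: jet_ext (jet_cst 1) => z _; rewrite big_nil//.
rewrite !big_cons; case: ifP => Pi.
  have -> : a i * \prod_(j <- r | P j) a j * (b i / a i + \sum_(j <- r | P j) b j / a j)
     = b i * \prod_(j <- r | P j) a j +
       a i * (\prod_(j <- r | P j) a j * \sum_(j <- r | P j) b j / a j).
    rewrite mulrDr; congr (_ + _); last by rewrite mulrA.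
    by rewrite mulrA mulrC !mulrA mulVf ?a0 // mul1r mulrC.
  by apply: jet_ext (jetM (H _ Pi) IH) => z _; rewrite big_cons Pi.
by apply: jet_ext IH => z _; rewrite big_cons Pi.
Qed.

Lemma jetX f a b k : jet f a b -> jet (fun z => f z ^+ k) (a ^+ k) (b * a ^+ k.-1 *+ k).
Proof.
move=> H; elim: k => [|k IH].
  by rewrite mulr0n; apply: jet_cst.
have := jetM H IH; rewrite -exprS.
have -> : b * a ^+ k + a * (b * a ^+ k.-1 *+ k) = b * a ^+ k.+1.-1 *+ k.+1.
  case: k {IH} => [|k] /=; first by rewrite mulr0n mulr0 addr0 mulr1n.
  by rewrite -[RHS]mulr_natr -mulrnAr -mulr_natr -!natr1 exprS; ring.
by apply: jet_ext => z _; rewrite -exprS.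
Qed.

Lemma jet_expz (e : int) : jet (fun z => z ^ e) 1 e%:~R.
Proof.
case: e => k.
  by have := jetX k jet_id; rewrite !expr1n mul1r.
have := jetX k.+1 jet_inv; rewrite !expr1n mulr1 NegzE.
rewrite mulrNz mulNrn pmulrn; apply: jet_ext => z _; exact: exprVn.
Qed.

Lemma mpoly_closed k (Q : {mpoly C[k]} -> Prop) :
  (forall c, Q c%:MP) -> (forall i, Q 'X_i) ->
  (forall p q : {mpoly C[k]}, Q p -> Q q -> Q (p + q)) ->
  (forall p q : {mpoly C[k]}, Q p -> Q q -> Q (p * q)) -> forall p : {mpoly C[k]}, Q p.
Proof.
move=> QC QX QD QM p; rewrite [p]mpolyE.
apply: (big_ind Q) => [|//|m _]; first by rewrite -mpolyC0.
rewrite -mul_mpolyC; apply: (QM) => //; rewrite mpolyXE_id.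
apply: (big_ind Q) => [|p1 q1|i _]; [by rewrite -mpolyC1 | exact: QM |].
elim: (m i) => [|l IH]; first by rewrite expr0 -mpolyC1.
by rewrite exprS; apply: QM.
Qed.

(** The chain rule. It gives the differential of a rational representation its formula. *)
Lemma jet_mpoly k (P : {mpoly C[k]}) (g : C -> 'I_k -> C) (a b : 'I_k -> C) :
  (forall i, jet (fun z => g z i) (a i) (b i)) ->
  jet (fun z => P.@[g z]) P.@[a] (\sum_i (mderiv i P).@[a] * b i).
Proof.
move=> H; elim/mpoly_closed: P => [c|i|p q IHp IHq|p q IHp IHq].
- rewrite mevalC big1 => [|i _]; last by rewrite mderivC meval0 mul0r.
  by apply: jet_ext (jet_cst c) => z _; rewrite mevalC.
- rewrite mevalXU (bigD1 i) //= big1 => [|j ji].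
    rewrite mderivX mnmE eqxx.
    have -> : (U_(i) - U_(i) = 0 :> 'X_{1..k})%MM.
      by apply/mnmP=> j; rewrite !mnmE subnn.
    rewrite mpolyX0 mevalZ meval1 mulr1 mul1r addr0.
    by apply: jet_ext (H i) => z _; rewrite mevalXU.
  by rewrite mderivX mnmE eq_sym (negPf ji) scale0r meval0 mul0r.
- have -> : \sum_i (p + q)^`M(i).@[a] * b i =
     \sum_i p^`M(i).@[a] * b i + \sum_i q^`M(i).@[a] * b i.
    by rewrite -big_split; apply: eq_bigr => i _ /=; rewrite mderivD mevalD mulrDl.
  by rewrite mevalD; apply: jet_ext (jetD IHp IHq) => z _; rewrite mevalD.
- have -> : \sum_i (p * q)^`M(i).@[a] * b i =
     (\sum_i p^`M(i).@[a] * b i) * q.@[a] + p.@[a] * \sum_i q^`M(i).@[a] * b i.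
    rewrite mulr_suml mulr_sumr -big_split; apply: eq_bigr => i _ /=.
    by rewrite mderivM mevalD !mevalM; ring.
  by rewrite mevalM; apply: jet_ext (jetM IHp IHq) => z _; rewrite mevalM.
Qed.

Lemma mpoly_on_line k (P : {mpoly C[k]}) (u v : 'I_k -> C) :
  exists q : {poly C}, forall t, P.@[fun i => u i + t * v i] = q.[t].
Proof.
elim/mpoly_closed: P => [c|i|p q [r Hr] [s Hs]|p q [r Hr] [s Hs]].
- by exists c%:P => t; rewrite mevalC hornerC.
- by exists ((u i)%:P + (v i)%:P * 'X) => t; rewrite mevalXU !hornerE mulrC.
- by exists (r + s) => t; rewrite mevalD hornerD Hr Hs.
- by exists (r * s) => t; rewrite mevalM hornerM Hr Hs.
Qed.

Definition mjet m k (g : C -> 'M[C]_(m, k)) (A B : 'M[C]_(m, k)) :=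
  forall i j, jet (fun z => g z i j) (A i j) (B i j).

Lemma mjet_ext m k (f g : C -> 'M[C]_(m, k)) A B :
  (forall z : C, z != 0 -> f z = g z) -> mjet f A B -> mjet g A B.
Proof. by move=> fg H i j; apply: jet_ext (H i j) => z /fg->. Qed.

Lemma mjet_uniq m k (f : C -> 'M[C]_(m, k)) A B A' B' :
  mjet f A B -> mjet f A' B' -> A = A' /\ B = B'.
Proof.
by move=> H H'; split; apply/matrixP=> i j; case: (jet_uniq (H i j) (H' i j)).
Qed.

Lemma mjet_cst m k (A : 'M[C]_(m, k)) : mjet (fun=> A) A 0.
Proof. by move=> i j; rewrite mxE; apply: jet_cst. Qed.

Lemma mjetD m k (f g : C -> 'M[C]_(m, k)) A B A' B' : mjet f A B -> mjet g A' B' ->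
  mjet (fun z => f z + g z) (A + A') (B + B').
Proof.
move=> H H' i j; rewrite !mxE; apply: jet_ext (jetD (H i j) (H' i j)) => z _.
by rewrite mxE.
Qed.

Lemma mjetM m k l (f : C -> 'M[C]_(m, k)) (g : C -> 'M[C]_(k, l)) A B A' B' :
  mjet f A B -> mjet g A' B' ->
  mjet (fun z => f z *m g z) (A *m A') (B *m A' + A *m B').
Proof.
move=> H H' i j; rewrite !mxE -big_split /=.
have := @jet_sum _ (index_enum 'I_k) xpredT _ _ _ (fun s _ => jetM (H i s) (H' s j)).
by apply: jet_ext => z _; rewrite mxE.
Qed.

Lemma mjetZ m k (f : C -> C) a b (A : 'M[C]_(m, k)) : jet f a b ->
  mjet (fun z => f z *: A) (a *: A) (b *: A).
Proof.
move=> H i j; rewrite !mxE mulrC [b * _]mulrC; apply: jet_ext (jetZ (A i j) H) => z _.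
by rewrite mxE mulrC.
Qed.

Lemma mjet_line m (X : 'M[C]_m) : mjet (fun z => 1%:M + (z - 1) *: X) 1%:M X.
Proof.
have := mjetD (mjet_cst 1%:M) (mjetZ X (jetD jet_id (jet_cst (-1)))).
by rewrite subrr scale0r addr0 add0r addr0 scale1r.
Qed.

End Jets.

(** * The orthogonal group and its Lie algebra *)

Section Orthogonal.
Variables (C : numClosedFieldType) (n : nat).
Notation N := (n + n)%N.
Notation J := (formJ C n).
Notation G := (@O2n C n).
Implicit Types (g h X Y M : 'M[C]_N) (a b c d : 'I_N).

(** The index paired with [a] by the quadratic form. *)
Definition star a : 'I_N :=
  match split a with inl i => rshift n i | inr i => lshift n i end.

Lemma star_l i : star (lshift n i) = rshift n i.
Proof. by rewrite /star; case: splitP => [j /= /ord_inj->|j /= E] //; have := ltn_ord i; rewrite E ltnNge leq_addr. Qed.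

Lemma star_r i : star (rshift n i) = lshift n i.
Proof.
rewrite /star; case: splitP => [j /= E|j /= /addnI/ord_inj->] //.
by have := ltn_ord j; rewrite -E ltnNge leq_addr.
Qed.

Lemma index_ind (Q : 'I_N -> Prop) :
  (forall i, Q (lshift n i)) -> (forall i, Q (rshift n i)) -> forall a, Q a.
Proof. by move=> Ql Qr a; rewrite -[a]splitK; case: (split a). Qed.

Lemma starK : involutive star.
Proof. by apply: index_ind => i; rewrite ?(star_l, star_r). Qed.

Lemma star_neq a : star a != a.
Proof.
by elim/index_ind: a => i; rewrite ?(star_l, star_r) -val_eqE /=; have := ltn_ord i; lia.
Qed.

Lemma eq_star a b : (star a == star b) = (a == b).
Proof. exact: (inj_eq (inv_inj starK)). Qed.

Lemma star_eq a b : (star a == b) = (a == star b).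
Proof. by rewrite -[b in LHS]starK eq_star. Qed.

Lemma formJE a b : J a b = (b == star a)%:R.
Proof.
have lr (i j : 'I_n) : (lshift n i == rshift n j) = false.
  by rewrite -val_eqE /=; have := ltn_ord i; lia.
rewrite /formJ; elim/index_ind: a => i; elim/index_ind: b => j;
rewrite ?(star_l, star_r) ?(block_mxEul, block_mxEur, block_mxEdl, block_mxEdr) mxE.
- by rewrite lr.
- by rewrite -[in RHS]val_eqE /= eqn_add2l eq_sym.
- by rewrite -[in RHS]val_eqE /= eq_sym.
- by rewrite eq_sym lr.
Qed.

Lemma formJ_mulE k (M : 'M[C]_(N, k)) a j : (J *m M) a j = M (star a) j.
Proof.
rewrite mxE (bigD1 (star a)) //= formJE eqxx mul1r big1 ?addr0 // => b /negPf E.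
by rewrite formJE E mul0r.
Qed.

Lemma formJT : J^T = J.
Proof. by apply/matrixP=> a b; rewrite mxE !formJE eq_sym star_eq. Qed.

Lemma formJK k (M : 'M[C]_(N, k)) : J *m (J *m M) = M.
Proof. by apply/matrixP=> a j; rewrite !formJ_mulE starK. Qed.

Lemma formJJ : J *m J = 1%:M.
Proof. by rewrite -[J in X in _ *m X]mulmx1 formJK. Qed.

Lemma formJ_delta k a (j : 'I_k) : J *m delta_mx a j = delta_mx (star a) j.
Proof. by apply/matrixP=> b l; rewrite formJ_mulE !mxE star_eq. Qed.

Lemma delta_formJ k (j : 'I_k) a : delta_mx j a *m J = delta_mx j (star a).
Proof. by rewrite -[LHS]trmxK trmx_mul formJT trmx_delta formJ_delta trmx_delta. Qed.

Lemma O2nP g : reflect (g^T *m J *m g = J) (g \in G).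
Proof. exact: eqP. Qed.

(** The inverse of an element of the group. *)
Definition oinv g := J *m g^T *m J.

Lemma oinvK g : g \in G -> oinv g *m g = 1%:M.
Proof. by move/O2nP=> E; rewrite /oinv -!mulmxA [g^T *m _]mulmxA E formJJ. Qed.

Lemma oinvKr g : g \in G -> g *m oinv g = 1%:M.
Proof. by move/oinvK/mulmx1C. Qed.

Lemma O2n1 : 1%:M \in G.
Proof. by apply/O2nP; rewrite trmx1 mul1mx mulmx1. Qed.

Lemma O2nM g h : g \in G -> h \in G -> g *m h \in G.
Proof.
move=> /O2nP Eg /O2nP Eh; apply/O2nP.
have -> : (g *m h)^T *m J *m (g *m h) = h^T *m (g^T *m J *m g) *m h.
  by rewrite trmx_mul !mulmxA.
by rewrite Eg.
Qed.

Lemma O2n_inv g h : g \in G -> g *m h = 1%:M -> h \in G.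
Proof.
move=> /O2nP Eg Egh; apply/O2nP; rewrite -[in LHS]Eg.
have E : h^T *m g^T = 1%:M by rewrite -trmx_mul Egh trmx1.
have -> : h^T *m (g^T *m J *m g) *m h = h^T *m g^T *m J *m (g *m h).
  by rewrite !mulmxA.
by rewrite E Egh mul1mx mulmx1.
Qed.

Lemma O2n_oinv g : g \in G -> oinv g \in G.
Proof. by move=> Gg; apply: O2n_inv Gg (oinvKr Gg). Qed.

Definition so X := X^T *m J + J *m X = 0.

(** Twice the projection of the matrix algebra onto its Lie subalgebra [so]. *)
Definition proj_so M := M - J *m M^T *m J.

Lemma proj_so_is_linear : linear proj_so.
Proof.
move=> k M M'; rewrite /proj_so linearP /= mulmxDr mulmxDl -scalemxAr -scalemxAl.
by rewrite opprD scalerBr addrACA.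
Qed.
HB.instance Definition _ := GRing.isLinear.Build C 'M[C]_N 'M[C]_N _ proj_so
  proj_so_is_linear.

Lemma so_trJ X : so X -> X^T *m J = - (J *m X).
Proof. by move/eqP; rewrite addr_eq0 => /eqP. Qed.

Lemma proj_soP M : so (proj_so M).
Proof.
rewrite /so /proj_so linearB /= !trmx_mul trmxK formJT mulmxBl mulmxBr !mulmxA formJJ.
by rewrite -!mulmxA formJJ mulmx1 mul1mx addrC addrA subrK subrr.
Qed.

Lemma proj_so_id X : so X -> proj_so X = 2 *: X.
Proof.
by move=> sX; rewrite /proj_so -mulmxA so_trJ // mulmxN formJK opprK scaler_nat.
Qed.

(** The [F a b] span [so]: root vectors or zero for [a != b], elements of the Cartan subalgebra
    for [a = b]. *)
Definition F a b := proj_so (delta_mx a b).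

Lemma FE a b : F a b = delta_mx a b - delta_mx (star b) (star a).
Proof. by rewrite /F /proj_so trmx_delta formJ_delta delta_formJ. Qed.

Lemma F_so a b : so (F a b).
Proof. exact: proj_soP. Qed.

Lemma so_span X : so X -> X = 2^-1 *: \sum_a \sum_b X a b *: F a b.
Proof.
move=> sX; have -> : \sum_a \sum_b X a b *: F a b = proj_so X.
  rewrite [X in RHS]matrix_sum_delta linear_sum; apply: eq_bigr => a _.
  by rewrite linear_sum; apply: eq_bigr => b _; rewrite linearZ.
by rewrite proj_so_id // scalerA mulVf ?scale1r // pnatr_eq0.
Qed.

Lemma proj_so_conj h M : h \in G -> proj_so (h *m M *m oinv h) = h *m proj_so M *m oinv h.
Proof.
move=> Gh; rewrite /proj_so mulmxBr mulmxBl; congr (_ - _).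
by rewrite /oinv !trmx_mul !trmxK formJT -!mulmxA !formJK.
Qed.

Lemma so_comm X Y : so X -> so Y -> so (X *m Y - Y *m X).
Proof.
move=> sX sY; rewrite /so linearB /= !trmx_mul mulmxBl -!mulmxA !so_trJ //.
rewrite !mulmxN ![_ *m (J *m _)]mulmxA !so_trJ // !mulNmx !opprK mulmxBr !mulmxA.
by rewrite addrA subrK subrr.
Qed.

Lemma soZD k X Y : so X -> so Y -> so (k *: X + Y).
Proof.
move=> sX sY; rewrite /so linearP /= mulmxDl mulmxDr -scalemxAl -scalemxAr.
by rewrite !so_trJ // addrACA scalerN !addNr addr0.
Qed.

Lemma so0 : so 0.
Proof. by rewrite /so mulmx0 addr0 linear0 mul0mx. Qed.

(** The side conditions [so X], [so Y] in the linear step are kept so that [Q] may be a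
    property that only makes sense on the Lie algebra. *)
Lemma so_ind (Q : 'M[C]_N -> Prop) :
  Q 0 -> (forall a b, Q (F a b)) ->
  (forall k X Y, so X -> so Y -> Q X -> Q Y -> Q (k *: X + Y)) ->
  forall X, so X -> Q X.
Proof.
move=> Q0 QF QD X sX.
suff [] : so (\sum_a \sum_b X a b *: F a b) /\ Q (\sum_a \sum_b X a b *: F a b).
  move=> s1 q1; rewrite (so_span sX).
  by have := QD 2^-1 _ 0 s1 so0 q1 Q0; rewrite addr0.
apply: (big_rec (fun Z => so Z /\ Q Z)) => [|a Z _ [sZ qZ]]; first by split; [apply: so0|].
elim: (index_enum _) => [|b r [sW qW]]; first by rewrite big_nil add0r.
rewrite big_cons -addrA; split; first by apply: soZD => //; apply: F_so.
by apply: QD => //; apply: F_so.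
Qed.

Lemma so_unipotent X t : so X -> X *m X = 0 -> 1%:M + t *: X \in G.
Proof.
move=> sX XX; apply/O2nP.
have -> : (1%:M + t *: X)^T = 1%:M + t *: X^T by rewrite linearD linearZ /= trmx1.
rewrite mulmxDl mul1mx mulmxDr mulmx1 -scalemxAl so_trJ //.
rewrite mulmxDl -!scalemxAr -!scalemxAl mulNmx -!mulmxA XX mulmx0 oppr0 !scaler0 addr0.
by rewrite scalerN addrNK.
Qed.

(** The inverse curve [g'] is part of the data: the derivative of conjugation by [g]
    involves both. *)
Definition tangent Y := exists g g' : C -> 'M[C]_N,
  [/\ forall z : C, z != 0 -> [/\ g z \in G, g' z \in G & g z *m g' z = 1%:M],
      mjet g 1%:M Y & mjet g' 1%:M (- Y)].

Lemma tangent_unipotent X : so X -> X *m X = 0 -> tangent X.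
Proof.
move=> sX XX; exists (fun z => 1%:M + (z - 1) *: X), (fun z => 1%:M + (z - 1) *: - X).
split; [|exact: mjet_line|exact: mjet_line] => z _; split; first exact: so_unipotent.
  by rewrite scalerN -scaleNr; apply: so_unipotent.
rewrite mulmxDl mul1mx mulmxDr mulmx1 scalerN -scalemxAl mulmxN -scalemxAr XX.
by rewrite !scaler0 oppr0 scaler0 addr0 subrK.
Qed.

Definition diagcurve a (z : C) : 'M[C]_N :=
  1%:M + (z - 1) *: delta_mx a a + (z^-1 - 1) *: delta_mx (star a) (star a).

Lemma diagcurveM a z : z != 0 -> diagcurve a z *m diagcurve (star a) z = 1%:M.
Proof.
move=> z0; rewrite /diagcurve starK.
have E u v : (1%:M + u *: delta_mx a a + v *: delta_mx (star a) (star a) : 'M[C]_N) *m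
   (1%:M + u *: delta_mx (star a) (star a) + v *: delta_mx a a) =
   1%:M + (u + v + u * v) *: (delta_mx a a + delta_mx (star a) (star a)).
  rewrite !mulmxDl !mulmxDr !mul1mx !mulmx1 -!scalemxAr -!scalemxAl !mul_delta_mx_cond.
  rewrite !eqxx (negPf (star_neq a)) eq_sym (negPf (star_neq a)) !mulr0n !mulr1n.
  by rewrite !scaler0; apply/matrixP=> i j; rewrite !mxE; ring.
rewrite E; have -> : z - 1 + (z^-1 - 1) + (z - 1) * (z^-1 - 1) = 0.
  by rewrite mulrBr mulrBl mulfV // mul1r mulr1; ring.
by rewrite scale0r addr0.
Qed.

Lemma diagcurve_O a z : z != 0 -> diagcurve a z \in G.
Proof.
move=> z0; apply/O2nP.
have -> : (diagcurve a z)^T *m J = J *m diagcurve (star a) z.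
  have -> : (diagcurve a z)^T = diagcurve a z.
    have trD (A B : 'M[C]_N) : (A + B)^T = A^T + B^T by rewrite linearD.
    have trZ u (A : 'M[C]_N) : (u *: A)^T = u *: A^T by rewrite linearZ.
    by rewrite /diagcurve !trD !trZ trmx1 !trmx_delta.
  rewrite /diagcurve !mulmxDl !mulmxDr mul1mx.
  rewrite mulmx1 -!scalemxAl -!scalemxAr !delta_formJ !formJ_delta !starK.
  by rewrite addrAC.
have E := diagcurveM (star a) z0; rewrite starK in E.
by rewrite -mulmxA E mulmx1.
Qed.

Lemma mjet_diagcurve a : mjet (diagcurve a) 1%:M (F a a).
Proof.
have := mjetD (mjetD (mjet_cst 1%:M) (mjetZ (delta_mx a a) (jetD (jet_id C) (jet_cst (-1)))))
  (mjetZ (delta_mx (star a) (star a)) (jetD (jet_inv C) (jet_cst (-1)))).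
by rewrite subrr !scale0r !addr0 add0r scale1r scaleN1r -FE.
Qed.

Lemma F_star a b : F (star b) (star a) = - F a b.
Proof. by rewrite !FE !starK opprB. Qed.

Lemma F_square0 a b : a != b -> F a b *m F a b = 0.
Proof.
move=> ab; rewrite FE mulmxBl !mulmxBr !mul_delta_mx_cond [b == a]eq_sym eq_star (negPf ab).
rewrite [b == star b]eq_sym (negPf (star_neq b)) (negPf (star_neq a)).
by rewrite !mulr0n !subr0.
Qed.

(** For [a != b] the matrix [F a b] has square zero and the line through it is a
    one-parameter subgroup; for [a = b] the curve runs in the torus. *)
Lemma tangent_F a b : tangent (F a b).
Proof.
case: (eqVneq a b) => [<-|ab].
  exists (diagcurve a), (diagcurve (star a)); split.
  - by move=> z z0; rewrite !diagcurve_O // diagcurveM.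
  - exact: mjet_diagcurve.
  - by rewrite -F_star; apply: mjet_diagcurve.
exact: tangent_unipotent (F_so a b) (F_square0 ab).
Qed.

End Orthogonal.

(** * The differential of a rational representation *)

Section Derivative.
Variables (C : numClosedFieldType) (n m : nat).
Notation N := (n + n)%N.
Notation G := (@O2n C n).
Variable rho : 'M[C]_N -> 'M[C]_m.
Hypothesis rho1 : rho 1%:M = 1%:M.
Hypothesis rhoM : {in G &, forall g h, rho (g *m h) = rho g *m rho h}.

(** Linearity on all matrices instead of [so] makes [drho] a bundled linear map; [rho]
    determines it on the tangent vectors of curves of group elements. *)
Definition differential (drho : 'M[C]_N -> 'M[C]_m) :=
  linear drho /\
  forall g Y, (forall z : C, z != 0 -> g z \in G) -> mjet g 1%:M Y ->
     mjet (fun z => rho (g z)) 1%:M (drho Y).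

Lemma mjet_linear k l k' l' (L : {linear 'M[C]_(k, l) -> 'M[C]_(k', l')}) f A B :
  mjet f A B -> mjet (fun z => L (f z)) (L A) (L B).
Proof.
move=> H i j.
have E Z : L Z i j = \sum_a \sum_b L (delta_mx a b) i j * Z a b.
  rewrite [Z in LHS]matrix_sum_delta linear_sum summxE; apply: eq_bigr => a _.
  by rewrite linear_sum summxE; apply: eq_bigr => b _; rewrite linearZ mxE mulrC.
have := @jet_sum _ _ (index_enum _) xpredT _ _ _ (fun a _ => @jet_sum _ _ (index_enum _) xpredT _ _ _
  (fun b _ => jetZ (L (delta_mx a b) i j) (H a b))).
by rewrite -!E; apply: jet_ext => z _; rewrite E.
Qed.

Lemma rational_choice :
  (forall i j, exists P : {mpoly C[N * N]},
        {in G, forall g, rho g i j = P.@[fun k => mxvec g 0 k]}) ->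
  exists P : 'I_m -> 'I_m -> {mpoly C[N * N]},
     forall i j, {in G, forall g, rho g i j = (P i j).@[fun k => mxvec g 0 k]}.
Proof.
by move=> H; have [P HP] := fin_all_exists (fun i => fin_all_exists (H i)); exists P.
Qed.

Lemma differential_exists :
  (forall i j, exists P : {mpoly C[N * N]},
        {in G, forall g, rho g i j = P.@[fun k => mxvec g 0 k]}) ->
  exists drho, differential drho.
Proof.
move=> /rational_choice [P HP].
exists (fun Y => \matrix_(i, j) \sum_k (mderiv k (P i j)).@[fun l => mxvec 1%:M 0 l] * mxvec Y 0 k).
split=> [k Y Y'|g Y Gg jg i j].
  apply/matrixP=> i j; rewrite !mxE mulr_sumr -big_split; apply: eq_bigr => l _ /=.
  by rewrite linearP /= !mxE; ring.
rewrite !mxE.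
have H l : jet (fun z => mxvec (g z) 0 l) (mxvec 1%:M 0 l) (mxvec Y 0 l).
  by case/mxvec_indexP: l => a b; rewrite !mxvecE; apply: jet_ext (jg a b) => z _; rewrite mxvecE.
have := jet_mpoly (P i j) H; rewrite -HP ?O2n1 // rho1 mxE.
by apply: jet_ext => z z0; rewrite HP ?Gg.
Qed.

Lemma rational_on_line X :
  (forall i j, exists P : {mpoly C[N * N]},
        {in G, forall g, rho g i j = P.@[fun k => mxvec g 0 k]}) ->
  (forall t, 1%:M + t *: X \in G) ->
  forall i j, exists q : {poly C}, forall t, rho (1%:M + t *: X) i j = q.[t].
Proof.
move=> H HX i j; have [P HP] := H i j.
have [q Hq] := mpoly_on_line P (fun k => mxvec 1%:M 0 k) (fun k => mxvec X 0 k).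
exists q => t; rewrite HP // -Hq; apply: meval_eq => k.
by rewrite linearD linearZ /= !mxE.
Qed.

Lemma laurent_curve (g : C -> 'M[C]_N) A B :
  (forall i j, exists P : {mpoly C[N * N]},
        {in G, forall g, rho g i j = P.@[fun k => mxvec g 0 k]}) ->
  (forall z : C, z != 0 -> g z \in G) -> mjet g A B ->
  forall i j, exists a b, jet (fun z => rho (g z) i j) a b.
Proof.
move=> H Gg jg i j; have [P HP] := H i j.
have Hl l : jet (fun z => mxvec (g z) 0 l) (mxvec A 0 l) (mxvec B 0 l).
  by case/mxvec_indexP: l => a b; rewrite !mxvecE; apply: jet_ext (jg a b) => z _; rewrite mxvecE.
by do 2!eexists; apply: jet_ext (jet_mpoly P Hl) => z z0; rewrite HP ?Gg.
Qed.

Variable drho : 'M[C]_N -> 'M[C]_m.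
Hypothesis drhoP : differential drho.

HB.instance Definition _ := GRing.isLinear.Build C 'M[C]_N 'M[C]_m _ drho (proj1 drhoP).

(** Both sides are the derivatives at 1 of one curve, [rho] of the conjugate of [g z]. *)
Lemma drho_adj_tangent h Y : h \in G -> tangent Y ->
  rho h *m drho Y *m rho (oinv h) = drho (h *m Y *m oinv h).
Proof.
move=> Gh [g [g' [Gg jg _]]].
have Gi := O2n_oinv Gh.
have Gc z : z != 0 -> h *m g z *m oinv h \in G.
  by move=> z0; have [Gz _ _] := Gg z z0; apply: O2nM Gi; apply: O2nM.
have jc : mjet (fun z => h *m g z *m oinv h) 1%:M (h *m Y *m oinv h).
  have := mjetM (mjetM (mjet_cst h) jg) (mjet_cst (oinv h)).
  by rewrite mul0mx add0r mulmx1 mulmx0 addr0 oinvKr.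
have Gg' z : z != 0 -> g z \in G by move=> z0; case: (Gg z z0).
have j1 := proj2 drhoP _ _ Gc jc.
have j2 := mjetM (mjetM (mjet_cst (rho h)) (proj2 drhoP _ _ Gg' jg)) (mjet_cst (rho (oinv h))).
have E z : z != 0 -> rho h *m rho (g z) *m rho (oinv h) = rho (h *m g z *m oinv h).
  by move=> z0; have Gz := Gg' z z0; rewrite -rhoM // -rhoM // O2nM.
case: (mjet_uniq (mjet_ext E j2) j1) => _ <-.
by rewrite mul0mx add0r mulmx0 addr0.
Qed.

Lemma drho_adj h X : h \in G -> so X ->
  rho h *m drho X *m rho (oinv h) = drho (h *m X *m oinv h).
Proof.
move=> Gh; move: X; apply: so_ind => [|a b|k Y Z _ _ EY EZ].
- by rewrite linear0 mulmx0 !mul0mx mulmx0 mul0mx linear0.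
- by apply: drho_adj_tangent => //; apply: tangent_F.
by rewrite linearP /= !mulmxDr !mulmxDl -!scalemxAr -!scalemxAl EY EZ linearP.
Qed.

Lemma drho_comm h X : h \in G -> so X ->
  rho h *m drho X = drho (h *m X *m oinv h) *m rho h.
Proof.
move=> Gh sX; rewrite -drho_adj // -!mulmxA -rhoM ?O2n_oinv // oinvK // rho1.
by rewrite mulmx1.
Qed.

(** Differentiate [drho (g Y g^-1) rho g = rho g drho Y] along a curve [g] tangent
    to [X]. *)
Lemma drho_bracket_tangent X Y : tangent X -> so Y ->
  drho X *m drho Y - drho Y *m drho X = drho (X *m Y - Y *m X).
Proof.
move=> [g [g' [Gg jg jg']]] sY.
have Gg' z : z != 0 -> g z \in G by move=> z0; case: (Gg z z0).
have ji z : z != 0 -> oinv (g z) = g' z.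
  move=> z0; have [G1 _ E] := Gg z z0.
  by rewrite -[LHS]mulmx1 -E mulmxA oinvK // mul1mx.
have jr := proj2 drhoP _ _ Gg' jg.
have jd : mjet (fun z => drho (g z *m Y *m g' z)) (drho Y) (drho (X *m Y - Y *m X)).
  have jY : mjet (fun z => g z *m Y *m g' z) Y (X *m Y - Y *m X).
    have := mjetM (mjetM jg (mjet_cst Y)) jg'.
    by rewrite mulmx0 addr0 mulmxN !mul1mx !mulmx1.
  exact: mjet_linear.
have j1 := mjetM jr (mjet_cst (drho Y)).
have E z : z != 0 -> drho (g z *m Y *m g' z) *m rho (g z) = rho (g z) *m drho Y.
  by move=> z0; rewrite -ji // drho_comm ?Gg'.
case: (mjet_uniq j1 (mjet_ext E (mjetM jd jr))) => _.
by rewrite mulmx0 addr0 mulmx1 => ->; rewrite addrK.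
Qed.

Lemma drho_bracket X Y : so X -> so Y ->
  drho X *m drho Y - drho Y *m drho X = drho (X *m Y - Y *m X).
Proof.
move=> sX sY; move: X sX; apply: so_ind => [|a b|k X X' _ _ EX EX'].
- by rewrite linear0 !mul0mx !mulmx0 !subr0 linear0.
- by apply: drho_bracket_tangent => //; apply: tangent_F.
rewrite linearP /= !mulmxDr !mulmxDl -!scalemxAr -!scalemxAl !opprD addrACA.
by rewrite -scalerBr EX EX' addrACA -scalerBr linearP.
Qed.

End Derivative.

(** * Generation of the orthogonal group by reflections *)

Section Generation.
Variables (C : numClosedFieldType) (n : nat).
Notation N := (n + n)%N.
Notation J := (formJ C n).
Notation G := (@O2n C n).
Implicit Types (u v w d : 'cV[C]_N) (a b c : 'I_N) (g h : 'M[C]_N).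

(** The bilinear form with matrix [formJ]. *)
Definition bf u w : C := \sum_a u a 0 * w (star a) 0.

Lemma bf_mx u w : u^T *m J *m w = (bf u w)%:M.
Proof.
rewrite -mulmxA; apply/matrixP=> i j; rewrite !ord1 !mxE mulr1n; apply: eq_bigr => a _.
by rewrite mxE formJ_mulE.
Qed.

Lemma bf_inj (x y : C) : x%:M = y%:M :> 'M_1 -> x = y.
Proof. by move/matrixP/(_ 0 0); rewrite !mxE !mulr1n. Qed.

Lemma bfC u w : bf u w = bf w u.
Proof.
rewrite /bf (reindex_inj (inv_inj (@starK n))) /=; apply: eq_bigr => a _.
by rewrite starK mulrC.
Qed.

Lemma bfDr u v w : bf u (v + w) = bf u v + bf u w.
Proof. by rewrite /bf -big_split; apply: eq_bigr => a _; rewrite mxE mulrDr. Qed.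

Lemma bfZr u k w : bf u (k *: w) = k * bf u w.
Proof. by rewrite /bf mulr_sumr; apply: eq_bigr => a _; rewrite mxE mulrCA. Qed.

Lemma bfNr u w : bf u (- w) = - bf u w.
Proof. by rewrite -scaleN1r bfZr mulN1r. Qed.

Lemma bfDl u v w : bf (u + v) w = bf u w + bf v w.
Proof. by rewrite ![bf _ w]bfC bfDr. Qed.

Lemma bfZl u k w : bf (k *: u) w = k * bf u w.
Proof. by rewrite ![bf _ w]bfC bfZr. Qed.

Lemma bfNl u w : bf (- u) w = - bf u w.
Proof. by rewrite ![bf _ w]bfC bfNr. Qed.

Lemma bf_delta a w : bf (delta_mx a 0) w = w (star a) 0.
Proof.
rewrite /bf (bigD1 a) //= big1 ?addr0 => [|b /negPf E]; first by rewrite mxE !eqxx mul1r.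
by rewrite mxE E mul0r.
Qed.

Lemma bf_lr u w : bf u w = \sum_(i < n) (u (lshift n i) 0 * w (rshift n i) 0
                                       + u (rshift n i) 0 * w (lshift n i) 0).
Proof.
rewrite /bf big_split_ord /= big_split /=.
by congr (_ + _); apply: eq_bigr => i _; rewrite ?star_l ?star_r.
Qed.

Lemma bf_isom g u w : g \in G -> bf (g *m u) (g *m w) = bf u w.
Proof.
move=> /O2nP Gg; apply: bf_inj; rewrite -!bf_mx trmx_mul.
by rewrite -{2}Gg !mulmxA.
Qed.

Lemma mul_bf u v w : u *m v^T *m J *m w = bf v w *: u.
Proof. by rewrite -!mulmxA [v^T *m _]mulmxA bf_mx mul_mx_scalar. Qed.

Definition refl w : 'M[C]_N := 1%:M - (2 / bf w w) *: (w *m w^T *m J).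

Lemma reflE w u : refl w *m u = u - (2 * bf w u / bf w w) *: w.
Proof. by rewrite mulmxBl mul1mx -scalemxAl mul_bf scalerA mulrAC. Qed.

Lemma reflK w : bf w w != 0 -> refl w *m refl w = 1%:M.
Proof.
move=> w0; rewrite /refl; set P := w *m w^T *m J.
have PP : P *m P = bf w w *: P.
  by rewrite {2}/P !mulmxA mul_bf -!scalemxAl.
rewrite mulmxBl mul1mx mulmxBr mulmx1 -scalemxAl -scalemxAr PP.
by apply/matrixP=> i j; rewrite !mxE; field.
Qed.

Lemma refl_O w : bf w w != 0 -> refl w \in G.
Proof.
move=> w0; apply/O2nP.
have E : (refl w)^T *m J = J *m refl w.
  rewrite /refl linearB linearZ /= trmx1 mulmxBl mulmxBr mul1mx mulmx1.
  by rewrite -scalemxAl -scalemxAr !trmx_mul trmxK formJT !mulmxA.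
by rewrite E -mulmxA reflK // mulmx1.
Qed.

Lemma refl_conj h w : h \in G -> refl (h *m w) *m h = h *m refl w.
Proof.
move=> Gh; rewrite /refl bf_isom // mulmxBl mulmxBr mul1mx mulmx1 -scalemxAl -scalemxAr.
congr (_ - _ *: _); rewrite trmx_mul -!mulmxA; congr (_ *m (_ *m (_ *m _))).
by rewrite mulmxA; apply/O2nP.
Qed.

Lemma refl_entry w a b :
  refl w a b = (a == b)%:R - 2 / bf w w * (w a 0 * w (star b) 0).
Proof.
have E : (w *m w^T *m J) a b = w a 0 * w (star b) 0.
  have /matrixP/(_ a 0) := mul_bf w w (delta_mx b 0).
  rewrite [LHS]mxE (bigD1 b) //= big1 => [|c /negPf E]; last by rewrite [delta_mx _ _ _ _]mxE E mulr0.
  rewrite [delta_mx b 0 b 0]mxE !eqxx mulr1 addr0 => ->.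
  by rewrite mxE bfC bf_delta mulrC.
by rewrite /refl -E 3!mxE mxE.
Qed.

Definition swap i0 : 'M[C]_N := perm_mx (tperm (lshift n i0) (rshift n i0)).

(** Generation is stated for a property [S] of group elements that is closed under products;
    it will be specialized to the stability of a set of vectors. *)
Section Closure.
Variables (S : 'M[C]_N -> Prop) (i0 : 'I_n).
Hypothesis SM : forall g h, g \in G -> h \in G -> S g -> S h -> S (g *m h).
Hypothesis SU : forall X, so X -> X *m X = 0 -> S (1%:M + X).
Hypothesis ST : forall x : 'rV[C]_n, (forall i, x 0 i != 0) -> S (torus x).
Hypothesis torusO : forall x : 'rV[C]_n, (forall i, x 0 i != 0) -> torus x \in G.
Hypothesis swapO : swap i0 \in G.
Hypothesis SS : S (swap i0).

Lemma refl_conj_closed h h' w : bf w w != 0 -> h \in G -> h' \in G -> h *m h' = 1%:M ->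
  S h -> S h' -> S (refl (h' *m w)) -> S (refl w).
Proof.
move=> w0 Gh Gh' E Sh Sh' Sr.
have -> : refl w = h *m refl (h' *m w) *m h'.
  by rewrite -mulmxA refl_conj // mulmxA E mul1mx.
have Gr : refl (h' *m w) \in G by apply: refl_O; rewrite bf_isom.
by apply: SM => //; [apply: O2nM | apply: SM].
Qed.

(** Reflections along [w] and [w + d] are conjugate under a transvection
    whose square-zero logarithm is built from the isotropic vectors [d] and
    a multiple of a basis vector. *)
Lemma refl_move w d c : bf w w != 0 -> w c 0 != 0 -> d c 0 = 0 -> bf d d = 0 -> bf d w = 0 ->
  S (refl (w + d)) -> S (refl w).
Proof.
move=> w0 wc dc dd dw.
pose z : 'cV[C]_N := (w c 0)^-1 *: delta_mx (star c) 0.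
have zz : bf z z = 0.
  by rewrite bfZl bf_delta starK !mxE eq_sym (negPf (star_neq c)) /= mulr0 mulr0.
have zd : bf z d = 0 by rewrite bfZl bf_delta starK dc mulr0.
have zw : bf z w = 1 by rewrite bfZl bf_delta starK mulVf.
pose X := d *m z^T *m J - z *m d^T *m J.
have Xu u : X *m u = bf z u *: d - bf d u *: z by rewrite mulmxBl !mul_bf.
have XX : X *m X = 0.
  rewrite {2}/X mulmxBr !mulmxA !Xu zd dd zz [bf d z]bfC zd !scale0r subrr.
  by rewrite !mul0mx subrr.
have sX : so X.
  rewrite /so /X linearB /= !trmx_mul !trmxK formJT mulmxBl mulmxBr !mulmxA.
  by rewrite addrA subrK subrr.
have Gu t : 1%:M + t *: X \in G by apply: so_unipotent.
have Gp := Gu 1; have Gm := Gu (-1); rewrite scale1r in Gp; rewrite scaleN1r in Gm.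
have E : (1%:M - X) *m (1%:M + X) = 1%:M.
  by rewrite mulmxDr mulmx1 mulmxBl mul1mx XX subr0 subrK.
have -> : w + d = (1%:M + X) *m w.
  by rewrite mulmxDl mul1mx Xu zw dw scale1r scale0r subr0.
apply: refl_conj_closed E _ _ => //; last exact: SU.
apply: SU; last by rewrite mulmxN mulNmx XX !oppr0.
by have := soZD (-1) sX (so0 C n); rewrite scaleN1r addr0.
Qed.

Notation l0 := (lshift n i0).
Notation r0 := (rshift n i0).

Lemma plane_entry (x y : C) a :
  (x *: delta_mx l0 0 + y *: delta_mx r0 0 : 'cV[C]_N) a 0 = (a == l0)%:R * x + (a == r0)%:R * y.
Proof. by rewrite !mxE !eqxx !andbT mulrC [y * _]mulrC. Qed.

(** In the hyperbolic plane of [l0] and [r0] a reflection is the exchange of the two basis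
    vectors followed by a torus element. *)
Lemma refl_plane (x y : C) : x * y != 0 ->
  S (refl (x *: delta_mx l0 0 + y *: delta_mx r0 0)).
Proof.
move=> xy0; set w := _ + _.
have [x0 y0] : x != 0 /\ y != 0 by apply/andP; rewrite -negb_or -mulf_eq0.
have wE a : w a 0 = (a == l0)%:R * x + (a == r0)%:R * y.
  exact: plane_entry.
have ww : bf w w = 2 * (x * y).
  rewrite /w bfDl !bfZl !bf_delta star_l star_r !wE !eqxx eq_lrshift eq_rlshift /=.
  by ring.
pose t : 'rV[C]_n := \row_i (if i == i0 then - x / y else 1).
have t0 i : t 0 i != 0.
  by rewrite mxE; case: ifP => _; rewrite ?oner_neq0 // mulf_neq0 ?oppr_eq0 ?invr_eq0.
have -> : refl w = torus t *m swap i0.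
  apply/matrixP=> a b; rewrite refl_entry mul_diag_mx [RHS]mxE [perm_mx _ _ _]mxE [1%:M _ _]mxE.
  rewrite ww !wE.
  rewrite permE /=.
  elim/index_ind: a => i; elim/index_ind: b => j; rewrite ?star_l ?star_r
    ?row_mxEl ?row_mxEr !mxE !(eq_lshift, eq_rshift, eq_lrshift, eq_rlshift) /=;
    (case: (eqVneq i i0) => [?|ni]; first subst i); rewrite ?eqxx ?(eq_lshift, eq_rshift, eq_lrshift, eq_rlshift) /=;
  (case: (eqVneq j i0) => [?|nj]; first subst j); rewrite ?eqxx ?(negPf ni) ?(negPf nj) ?[i0 == j]eq_sym ?(negPf nj) /=;
  rewrite ?(eq_lshift, eq_rshift, eq_lrshift, eq_rlshift) ?eqxx ?(negPf ni) ?(negPf nj) ?[i0 == j]eq_sym ?(negPf nj) /=.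
  all: try by field; rewrite ?x0 ?y0.
  all: try by rewrite ?mulr0 ?mul0r ?invr1 ?mul1r; ring.
by apply: SM => //; [apply: torusO | apply: ST].
Qed.

(** Two applications of [refl_move] bring [w] into the plane of [l0] and [r0]: [d1] clears
    the right half of [w] except for a coordinate at [r0] chosen to keep the norm, then
    [d2] clears the left half except at [l0]. *)
Lemma refl_nonzero_coord w : bf w w != 0 -> w l0 0 != 0 -> S (refl w).
Proof.
move=> ww wl.
pose q := \sum_i w (lshift n i) 0 * w (rshift n i) 0.
have bq : bf w w = 2 * q.
  rewrite bf_lr mulr_sumr; apply: eq_bigr => i _; ring.
have q0 : q != 0 by apply: contraNneq ww => q0; rewrite bq q0 mulr0.
(* The vector with coordinates [w l0 0] and [y] in the plane has the same norm as [w]. *)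
pose y := q / w l0 0.
have y0 : y != 0 by rewrite mulf_neq0 ?invr_eq0.
pose d1 : 'cV[C]_N := col_mx 0 (\col_i ((i == i0)%:R * y - w (rshift n i) 0)).
have d1l i : d1 (lshift n i) 0 = 0 by rewrite col_mxEu mxE.
have d1r i : d1 (rshift n i) 0 = (i == i0)%:R * y - w (rshift n i) 0.
  by rewrite col_mxEd mxE.
have d1d1 : bf d1 d1 = 0.
  by rewrite bf_lr big1 // => i _; rewrite d1l mul0r mulr0 addr0.
have pick (f : 'I_n -> C) : \sum_i (i == i0)%:R * y * f i = y * f i0.
  rewrite (bigD1 i0) //= eqxx mul1r big1 ?addr0 // => i /negPf->.
  by rewrite !mul0r.
have d1w : bf d1 w = 0.
  have -> : bf d1 w = \sum_i (i == i0)%:R * y * w (lshift n i) 0 - q.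
    rewrite bf_lr /q -sumrB; apply: eq_bigr => i _; rewrite d1l d1r; ring.
  by rewrite pick divfK // subrr.
apply: (refl_move ww wl (d1l i0) d1d1 d1w).
set w1 := w + d1.
have w1l i : w1 (lshift n i) 0 = w (lshift n i) 0 by rewrite mxE d1l addr0.
have w1r i : w1 (rshift n i) 0 = (i == i0)%:R * y by rewrite mxE d1r addrC subrK.
have w1w1 : bf w1 w1 != 0.
  by rewrite bfDl !bfDr [bf w d1]bfC d1w d1d1 !addr0.
pose d2 : 'cV[C]_N := col_mx (\col_i ((i == i0)%:R * w l0 0 - w (lshift n i) 0)) 0.
have d2r i : d2 (rshift n i) 0 = 0 by rewrite col_mxEd mxE.
have d2l i : d2 (lshift n i) 0 = (i == i0)%:R * w l0 0 - w (lshift n i) 0.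
  by rewrite col_mxEu mxE.
have d2d2 : bf d2 d2 = 0.
  by rewrite bf_lr big1 // => i _; rewrite d2r mul0r mulr0 addr0.
have d2w1 : bf d2 w1 = 0.
  rewrite bf_lr big1 // => i _; rewrite d2r d2l w1r mul0r addr0.
  by case: eqP => [->|_]; rewrite ?mul1r ?subrr ?mul0r ?mulr0.
have w1c : w1 r0 0 != 0 by rewrite w1r eqxx mul1r.
apply: (refl_move w1w1 w1c (d2r i0) d2d2 d2w1).
have -> : w1 + d2 = w l0 0 *: delta_mx l0 0 + y *: delta_mx r0 0.
  apply/matrixP=> a k; rewrite ord1 plane_entry [LHS]mxE.
  elim/index_ind: a => i; rewrite ?w1l ?w1r ?d2l ?d2r
    !(eq_lshift, eq_rshift, eq_lrshift, eq_rlshift) /=; ring.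
by apply: refl_plane; rewrite mulrC divfK.
Qed.

(** It remains to make the coordinate at [l0] nonzero: by the exchange if the
    coordinate at [r0] is, and otherwise by adding the isotropic vector [l0]. *)
Lemma refl_closed w : bf w w != 0 -> S (refl w).
Proof.
have case2 v : bf v v != 0 -> v r0 0 != 0 -> S (refl v).
  move=> vv vr.
  have sE k : (swap i0 *m v) k 0 = v (tperm l0 r0 k) 0.
    by rewrite -row_permE mxE.
  have s2 : swap i0 *m swap i0 = 1%:M.
    by rewrite -perm_mxM tperm2 perm_mx1.
  apply: (refl_conj_closed (h := swap i0) (h' := swap i0)) => //.
  by apply: refl_nonzero_coord; rewrite ?bf_isom // sE tpermL.
move=> ww; case: (eqVneq (w l0 0) 0) => [wl|]; last exact: refl_nonzero_coord.
case: (eqVneq (w r0 0) 0) => [wr|]; last exact: case2.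
have [c wc] : exists c, w c 0 != 0.
  apply/existsP; apply: contraNT ww; rewrite negb_exists => /forallP w0.
  by apply/eqP; rewrite /bf big1 // => a _; have := w0 a; rewrite negbK => /eqP->; rewrite mul0r.
have dE : bf (delta_mx l0 0) w = 0 by rewrite bf_delta star_l.
have dd : bf (delta_mx l0 0 : 'cV_N) (delta_mx l0 0) = 0.
  by rewrite bf_delta star_l mxE eq_rlshift.
apply: (refl_move (c := c) _ _ _ dd dE) => //.
  by rewrite mxE; case: eqP => // E; rewrite E wl eqxx in wc.
apply: refl_nonzero_coord; last by rewrite !mxE wl !eqxx add0r oner_neq0.
by rewrite bfDl !bfDr [bf w (delta_mx _ _)]bfC dE dd !addr0.
Qed.

(** Cartan-Dieudonne, by induction on the number of moved vectors of an orthogonal basis: for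
    the last one, [g u] and [u] have the same norm, so [g u - u] or [g u + u] is anisotropic,
    and one or two reflections carry [g u] to [u]. *)
Lemma cartan_dieudonne (f : 'I_N -> 'cV[C]_N) :
  (forall a b, a != b -> bf (f a) (f b) = 0) -> (forall a, bf (f a) (f a) != 0) ->
  (forall g, (forall a, g *m f a = f a) -> g = 1%:M) ->
  forall k g, (k <= N)%N -> g \in G -> (forall a : 'I_N, (k <= a)%N -> g *m f a = f a) -> S g.
Proof.
move=> fo fn f1; elim=> [|k IH] g kN Gg gf.
  rewrite (f1 g) => [|a]; last exact: gf.
  by have := SU (so0 C n) (mul0mx _ _); rewrite addr0.
pose a0 : 'I_N := Ordinal kN; pose u := f a0.
have step h : h \in G -> (forall a : 'I_N, (k < a)%N -> h *m f a = f a) ->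
    h *m u = u -> S h.
  move=> Gh hf hu; apply: IH (ltnW kN) Gh _ => a; rewrite leq_eqVlt => /predU1P[ka|]; last exact: hf.
  by have -> : a = a0 by apply: val_inj.
have Srefl v h : bf v v != 0 -> h \in G -> S (refl v *m h) -> S h.
  move=> vv Gh Sh; rewrite -[h]mul1mx -(reflK vv) -mulmxA.
  by apply: SM => //; [exact: refl_O | by apply: O2nM => //; apply: refl_O | exact: refl_closed].
have orth h v : h \in G -> (forall a : 'I_N, (k < a)%N -> h *m f a = f a) ->
   (forall a : 'I_N, (k < a)%N -> bf v (f a) = 0) ->
   forall a : 'I_N, (k < a)%N -> refl v *m h *m f a = f a.
  by move=> Gh hf vf a ka; rewrite -mulmxA hf // reflE vf // mulr0 mul0r scale0r subr0.
have uf a : (k < a)%N -> bf u (f a) = 0.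
  by move=> ka; rewrite fo // -val_eqE /= ltn_eqF.
have guf a : (k < a)%N -> bf (g *m u) (f a) = 0.
  by move=> ka; rewrite -[f a]gf // bf_isom // uf.
set v := g *m u.
have vv : bf v v = bf u u by rewrite bf_isom.
have E : bf (v - u) (v - u) + bf (v + u) (v + u) = 4 * bf u u.
  rewrite !(bfDl, bfDr, bfNl, bfNr) vv [bf u v]bfC; ring.
have Gr w : bf w w != 0 -> refl w *m g \in G by move=> w0; apply: O2nM => //; apply: refl_O.
have vvu : bf v v - bf u u = 0 by rewrite vv subrr.
case: (eqVneq (bf (v - u) (v - u)) 0) => [d0|d0].
  have s0 : bf (v + u) (v + u) != 0.
    by rewrite d0 add0r in E; rewrite E mulf_neq0 ?fn // pnatr_eq0.
  have u0 : bf u u != 0 by apply: fn.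
  apply: (Srefl _ _ s0 Gg); apply: (Srefl _ _ u0 (Gr _ s0)); apply: step.
  - by apply: O2nM; [exact: refl_O | exact: Gr].
  - apply: (orth); [exact: Gr | | exact: uf].
    by apply: (orth) => // a ka; rewrite bfDl uf // guf // addr0.
  - rewrite -!mulmxA -/v.
    have -> : refl (v + u) *m v = - u.
      rewrite reflE; have -> : 2 * bf (v + u) v / bf (v + u) (v + u) = 1.
        apply: (mulIf s0); rewrite divfK // mul1r !(bfDl, bfDr) vv [bf u v]bfC; ring.
      by rewrite scale1r opprD addrA subrr add0r.
    rewrite reflE bfNr mulrN mulNr mulfK // scaleNr opprK scaler_nat mulr2n addrA addNr add0r //.
apply: (Srefl _ _ d0 Gg); apply: step; first exact: Gr.
  by apply: (orth) => // a ka; rewrite bfDl bfNl uf // guf // subrr.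
rewrite -mulmxA -/v reflE; have -> : 2 * bf (v - u) v / bf (v - u) (v - u) = 1.
  apply: (mulIf d0); rewrite divfK // mul1r !(bfDl, bfDr, bfNl, bfNr) vv [bf u v]bfC; ring.
by rewrite scale1r opprB addrC subrK.
Qed.

(** The orthogonal basis required by [cartan_dieudonne] is made of the sums and the
    differences of paired standard basis vectors. *)
Lemma O2n_generated g : g \in G -> S g.
Proof.
move=> Gg.
pose f a : 'cV[C]_N := match split a with
  | inl i => delta_mx (lshift n i) 0 + delta_mx (rshift n i) 0
  | inr i => delta_mx (lshift n i) 0 - delta_mx (rshift n i) 0 end.
have fl i : f (lshift n i) = delta_mx (lshift n i) 0 + delta_mx (rshift n i) 0.
  by rewrite /f (unsplitK (inl i)).
have fr i : f (rshift n i) = delta_mx (lshift n i) 0 - delta_mx (rshift n i) 0.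
  by rewrite /f (unsplitK (inr i)).
apply: (@cartan_dieudonne f _ _ _ N) => // [a b|a|h hf|a].
- elim/index_ind: a => i; elim/index_ind: b => j; rewrite !(fl, fr);
  rewrite !(eq_lshift, eq_rshift, eq_lrshift, eq_rlshift);
  rewrite !(bfDl, bfDr, bfNl, bfNr, bf_delta) ?(star_l, star_r) !mxE;
  rewrite !(eq_lshift, eq_rshift, eq_lrshift, eq_rlshift) /=;
  case: eqP => //= _ _; ring.
- elim/index_ind: a => i; rewrite !(fl, fr);
  rewrite !(bfDl, bfDr, bfNl, bfNr, bf_delta) ?(star_l, star_r) !mxE;
  rewrite !eqxx !(eq_lrshift, eq_rlshift) /= ?oppr0 ?add0r ?addr0 -?opprD ?oppr_eq0;
  by rewrite -[1 + 1]/(2 : C) pnatr_eq0.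
- have two : (2 : C) != 0 by rewrite pnatr_eq0.
  have hd a : h *m delta_mx a 0 = delta_mx a 0 :> 'cV_N.
    elim/index_ind: a => i; apply: (scalerI two); rewrite scalemxAr.
      have -> : 2 *: delta_mx (lshift n i) 0 = f (lshift n i) + f (rshift n i).
        by rewrite fl fr addrACA subrr addr0 scaler_nat mulr2n.
      by rewrite mulmxDr !hf.
    have -> : 2 *: delta_mx (rshift n i) 0 = f (lshift n i) - f (rshift n i).
        by rewrite fl fr opprB [_ + delta_mx (rshift n i) 0]addrC addrACA subrr addr0 scaler_nat mulr2n.
    by rewrite mulmxBr !hf.
  apply/matrixP=> a b; have := congr1 (fun v : 'cV_N => v a 0) (hd b).
  rewrite [RHS]mxE eqxx andbT mxE (bigD1 b) //= big1 => [|c /negPf E]; last by rewrite !mxE E mulr0.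
  by rewrite [delta_mx b 0 b 0]mxE !eqxx mulr1 addr0 => ->; rewrite mxE.
- by rewrite leqNgt ltn_ord.
Qed.

End Closure.
End Generation.

(** * The maximal torus *)

Section Torus.
Variables (C : numClosedFieldType) (n : nat).
Notation N := (n + n)%N.
Notation G := (@O2n C n).
Implicit Types (x y : 'rV[C]_n).

Definition nz x := forall i, x 0 i != 0.

Definition xpow x (nu : 'I_n -> int) : C := \prod_i x 0 i ^ nu i.

(** The value at [torus x] of the weight of the [a]-th standard basis vector. *)
Definition te x (a : 'I_N) : C := row_mx x (map_mx GRing.inv x) 0 a.

Lemma te_l x i : te x (lshift n i) = x 0 i.
Proof. by rewrite /te row_mxEl. Qed.

Lemma te_r x i : te x (rshift n i) = (x 0 i)^-1.
Proof. by rewrite /te row_mxEr mxE. Qed.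

Lemma te_star x a : te x (star a) = (te x a)^-1.
Proof. by elim/index_ind: a => i; rewrite ?star_l ?star_r te_l te_r ?invrK. Qed.

Lemma te_neq0 x a : nz x -> te x a != 0.
Proof. by move=> x0; elim/index_ind: a => i; rewrite ?te_l ?te_r ?invr_eq0. Qed.

Lemma torusE x a b : torus x a b = te x a *+ (a == b).
Proof. by rewrite /torus mxE. Qed.

Lemma torusM x y : torus x *m torus y = torus (\row_i (x 0 i * y 0 i)).
Proof.
apply/matrixP=> a b; rewrite mul_diag_mx torusE mxE torusE mulrnAr; congr (_ *+ _).
by rewrite -/(te x a); elim/index_ind: a => i; rewrite ?te_l ?te_r mxE ?invfM.
Qed.

Lemma torus1 : torus (\row_i 1) = 1%:M :> 'M[C]_N.
Proof.
apply/matrixP=> a b; rewrite torusE mxE; congr (_ *+ _).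
by elim/index_ind: a => i; rewrite ?te_l ?te_r mxE ?invr1.
Qed.

Lemma torus_tr x : (torus x)^T = torus x.
Proof. exact: tr_diag_mx. Qed.

Lemma torus_O x : nz x -> torus x \in G.
Proof.
move=> x0; apply/O2nP; rewrite torus_tr; apply/matrixP=> a b.
rewrite mul_mx_diag mul_diag_mx [LHS]mxE [(\matrix_(i, j) _) a b]mxE -/(te x a) -/(te x b) formJE.
case: eqP => [->|_]; rewrite ?mulr0 ?mul0r // te_star mulr1 mulfV //.
exact: te_neq0.
Qed.

Lemma oinv_torus x : nz x -> oinv (torus x) = torus (\row_i (x 0 i)^-1).
Proof.
move=> x0; have E : torus x *m torus (\row_i (x 0 i)^-1) = 1%:M.
  by rewrite torusM -torus1; congr torus; apply/rowP=> i; rewrite !mxE mulfV.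
by rewrite -[LHS]mulmx1 -E mulmxA oinvK ?torus_O // mul1mx.
Qed.

Definition cochar i (z : C) : 'rV[C]_n := \row_k (if k == i then z else 1).

Lemma cochar_nz i z : z != 0 -> nz (cochar i z).
Proof. by move=> z0 k; rewrite mxE; case: ifP => // _; rewrite oner_neq0. Qed.

Lemma torus_cochar i z : torus (cochar i z) = diagcurve (lshift n i) z.
Proof.
apply/matrixP=> a b; rewrite torusE !mxE star_l.
case: (eqVneq a b) => [<-|ab]; last first.
  have off c : (a == c) && (b == c) = false.
    by apply: contraNF ab => /andP[/eqP-> /eqP->].
  by rewrite !off /= !mulr0 !addr0 mulr0n.
rewrite !andbb; elim/index_ind: a => k; rewrite ?te_l ?te_r mxE;
  rewrite !(eq_lshift, eq_rshift, eq_lrshift, eq_rlshift) /= ?mulr0 ?addr0;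
  by case: (k == i); rewrite /= ?invr1 ?mulr0 ?mulr1 ?addr0 // addrC subrK.
Qed.

Lemma mjet_cochar i : mjet (fun z => torus (cochar i z)) 1%:M (F C (lshift n i) (lshift n i)).
Proof.
by apply: mjet_ext (mjet_diagcurve C (lshift n i)) => z _; rewrite torus_cochar.
Qed.

(** A multiplicative function on the torus is determined by its values on the
    cocharacters, whose product is the given element. *)
Lemma torus_ind (V : Type) (f : 'rV[C]_n -> V) (op : V -> V -> V) (f1 : V) (g : 'I_n -> C -> V) :
  (forall x y, nz x -> nz y -> f (\row_i (x 0 i * y 0 i)) = op (f x) (f y)) ->
  f (\row_i 1) = f1 -> (forall i z, z != 0 -> f (cochar i z) = g i z) ->
  forall x, nz x -> f x = \big[op/f1]_(i < n) g i (x 0 i).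
Proof.
move=> fM f1E fg x x0.
pose xs (s : seq 'I_n) : 'rV[C]_n := \row_k (if k \in s then x 0 k else 1).
have E (s : seq 'I_n) : uniq s -> f (xs s) = \big[op/f1]_(i <- s) g i (x 0 i).
  elim: s => [_|i s IH /= /andP[is_ us]].
    by rewrite big_nil -f1E; congr f; apply/rowP=> k; rewrite !mxE.
  rewrite big_cons -fg // -IH // -fM; last 2 first.
  - exact: cochar_nz.
  - by move=> k; rewrite mxE; case: ifP => // _; rewrite oner_neq0.
  congr f; apply/rowP=> k; rewrite !mxE in_cons.
  by case: eqP => [->|_]; rewrite ?(negPf is_) ?mulr1 ?mul1r.
rewrite -[X in f X]/x; have -> : x = xs (index_enum 'I_n).
  by apply/rowP=> k; rewrite mxE mem_index_enum.
rewrite E ?index_enum_uniq //; apply: eq_bigr => i _.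
by rewrite mxE mem_index_enum.
Qed.

End Torus.

Section Representation.
Variables (C : numClosedFieldType) (n m : nat).
Notation N := (n + n)%N.
Notation G := (@O2n C n).
Variable rho : 'M[C]_N -> 'M[C]_m.
Hypothesis rho_rational : rational_rep rho.

(** Take a subspace of maximal dimension among those that contain [v] and are killed by
    all the [phi (rho g)]; adding one more image [rho g w] keeps these properties, so it
    is invariant, hence everything. *)
Lemma irreducible_functional : irreducible_rep rho ->
  forall (v : 'cV[C]_m) (phi : 'rV[C]_m), v != 0 ->
  (forall g, g \in G -> phi *m rho g *m v = 0) -> phi = 0.
Proof.
move=> [_ irr] v phi v0 Hv; apply/eqP; apply: contraT => phi0; exfalso.
have [rho1 rhoM _] := rho_rational.
have claim : forall k (U : {vspace 'cV[C]_m}), (\dim {:'cV[C]_m} - \dim U <= k)%N -> v \in U ->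
   (forall u, u \in U -> forall g, g \in G -> phi *m rho g *m u = 0) -> False.
  elim=> [|k IH] U dU vU HU.
    have UF : U = fullv.
      by apply/eqP; rewrite -dimv_leqif_eq ?subvf // eqn_leq dimvS ?subvf //= -subn_eq0 -leqn0.
    case/eqP: phi0; apply/matrixP=> i j; rewrite ord1.
    have := HU (delta_mx j 0); rewrite UF memvf => /(_ isT _ (O2n1 C n)).
    rewrite rho1 mulmx1 => /matrixP/(_ 0 0).
    rewrite mxE (bigD1 j) //= big1 => [|l /negPf E]; last by rewrite mxE E mulr0.
    by rewrite [delta_mx _ _ _ _]mxE !eqxx mulr1 addr0 => ->; rewrite !mxE.
  have [U0|UF] : U = 0%VS \/ U = fullv.
  - apply: irr => g Gg w wU; apply: contraT => gw; exfalso.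
    apply: (IH (U + <[rho g *m w]>)%VS).
    - have lt : (\dim U < \dim (U + <[rho g *m w]>))%N.
        rewrite ltn_neqAle dimvS ?addvSl // andbT dimv_leqif_eq ?addvSl //.
        apply: contra gw => /eqP->; apply: (subvP (addvSr _ _)); exact: memv_line.
      by rewrite -ltnS; apply: leq_trans dU; rewrite ltn_sub2l // (leq_trans lt) // dimvS // subvf.
    - by apply: (subvP (addvSl _ _)).
    - move=> u /memv_addP[u1 u1U [u2 /vlineP[k' ->] ->]] h Gh.
      rewrite mulmxDr HU // add0r -scalemxAr -mulmxA [rho h *m _]mulmxA -rhoM //.
      by rewrite mulmxA HU ?scaler0 // O2nM.
  - by move: vU; rewrite U0 memv0 (negPf v0).
  apply: (IH U) => //; rewrite UF subnn //.
apply: (claim _ <[v]>%VS (leqnn _) (memv_line _)) => u /vlineP[k ->] g Gg.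
by rewrite -scalemxAr Hv // scaler0.
Qed.

(** The coefficients are compared one variable at a time; the variables avoid 0 because
    the identities come from Laurent polynomials. *)
Lemma coef2_eq (I I' : finType) (P R : I -> {poly C}) (P' R' : I' -> {poly C}) :
  (forall z w : C, z != 0 -> w != 0 ->
    \sum_c (P c).[z] * (R c).[w] = \sum_c (P' c).[z] * (R' c).[w]) ->
  forall k l, \sum_c (P c)`_k * (R c)`_l = \sum_c (P' c)`_k * (R' c)`_l.
Proof.
move=> H k l.
have H1 w : w != 0 -> \sum_c (P c)`_k * (R c).[w] = \sum_c (P' c)`_k * (R' c).[w].
  move=> w0; have E : \sum_c (R c).[w] *: P c = \sum_c (R' c).[w] *: P' c.
    apply/eqP; rewrite -subr_eq0; apply/eqP/polyX_vanish => z z0.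
    rewrite hornerD hornerN !horner_sum; apply/eqP; rewrite subr_eq0; apply/eqP.
    rewrite (eq_bigr (fun c => (P c).[z] * (R c).[w])) => [|c _]; last by rewrite hornerZ mulrC.
    by rewrite H //; apply: eq_bigr => c _; rewrite hornerZ mulrC.
  have := congr1 (fun p : {poly C} => p`_k) E; rewrite !coef_sum.
  rewrite (eq_bigr (fun c => (P c)`_k * (R c).[w])) => [->|c _]; last by rewrite coefZ mulrC.
  by apply: eq_bigr => c _; rewrite coefZ mulrC.
have E : \sum_c (P c)`_k *: R c = \sum_c (P' c)`_k *: R' c.
  apply/eqP; rewrite -subr_eq0; apply/eqP/polyX_vanish => w w0.
  rewrite hornerD hornerN !horner_sum; apply/eqP; rewrite subr_eq0; apply/eqP.
  rewrite (eq_bigr (fun c => (P c)`_k * (R c).[w])) => [|c _]; last by rewrite hornerZ.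
  by rewrite H1 //; apply: eq_bigr => c _; rewrite hornerZ.
have := congr1 (fun p : {poly C} => p`_l) E; rewrite !coef_sum.
rewrite (eq_bigr (fun c => (P c)`_k * (R c)`_l)) => [->|c _]; last by rewrite coefZ.
by apply: eq_bigr => c _; rewrite coefZ.
Qed.

Lemma cochar_poly i : exists d (Q : 'M[{poly C}]_m), forall z, z != 0 ->
  forall a b, z ^+ d * rho (torus (cochar i z)) a b = (Q a b).[z].
Proof.
have [_ _ rhoP] := rho_rational.
have H a b : exists d (q : {poly C}), forall z, z != 0 ->
   z ^+ d * rho (torus (cochar i z)) a b = q.[z].
  have [z z0|u [v [d [q [E _ _]]]]] := @laurent_curve _ _ _ _ (fun z => torus (cochar i z)) _ _ rhoP _ (mjet_cochar C i) a b.
    exact/torus_O/cochar_nz.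
  by exists d, q.
have [d Hd] := fin_all_exists (fun a => fin_all_exists (H a)).
have [q Hq] := fin_all_exists (fun a => fin_all_exists (Hd a)).
exists (\sum_a \sum_b d a b)%N.
exists (\matrix_(a, b) ('X^((\sum_a \sum_b d a b) - d a b) * q a b)) => z z0 a b.
have le : (d a b <= \sum_a \sum_b d a b)%N.
  by rewrite (bigD1 a) //= (bigD1 b) //= -!addnA leq_addr.
by rewrite mxE hornerM hornerXn -Hq // mulrA -exprD subnK.
Qed.

(** Along the [i]-th cocharacter, [z ^+ d * rho] is a polynomial in [z] with matrix
    coefficients [A i k]. Multiplicativity makes these orthogonal idempotents with sum 1,
    and those of different cocharacters commute; the matrix [S] diagonalizes them
    together, and the weight records which idempotent does not kill a given basis
    vector. *)
Lemma torus_diagonalizable : (0 < m)%N ->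
  exists (S : 'M[C]_m) (wt : 'I_m -> 'I_n -> int), S \in unitmx /\
    forall x, nz x -> S *m rho (torus x) *m invmx S = diag_mx (\row_j xpow x (wt j)).
Proof.
move=> m0; have [rho1 rhoM _] := rho_rational.
have [d Hd] := fin_all_exists cochar_poly.
have [Q HQ] := fin_all_exists Hd => {Hd}.
have Gc i z : z != 0 -> torus (cochar i z) \in G by move=> z0; apply/torus_O/cochar_nz.
pose A i k : 'M[C]_m := \matrix_(a, b) (Q i a b)`_k.
pose D := (\max_i \max_a \max_b size (Q i a b))%N.
have leD i a b : (size (Q i a b) <= D)%N.
  by rewrite /D; apply: leq_trans (leq_bigmax i); apply: leq_trans (leq_bigmax a); apply: (leq_bigmax b).
have QD i a b z : (Q i a b).[z] = \sum_(k < D) (Q i a b)`_k * z ^+ k.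
  by rewrite (horner_coef_wide _ (leD i a b)).
have AA i k l : (k < D)%N -> A i k *m A i l = A i k *+ (k == l).
  move=> kD; apply/matrixP=> a b; rewrite mxE.
  rewrite (eq_bigr (fun c => (Q i a c)`_k * (Q i c b)`_l)) => [|c _]; last by rewrite !mxE.
  rewrite (@coef2_eq _ 'I_D _ _ (fun c => (Q i a b)`_c *: 'X^c) (fun c => 'X^c)).
    rewrite (bigD1 (Ordinal kD)) //= big1 => [|c ck].
      rewrite coefZ !coefXn eqxx mulr1 addr0 mulmxnE mxE eq_sym.
      by case: eqP; rewrite ?mulr1 ?mulr0.
    rewrite coefZ coefXn; case: eqP => [E|]; last by rewrite mulr0 mul0r.
    by case/eqP: ck; apply: val_inj.
  move=> z w z0 w0.
  have zw0 : z * w != 0 by rewrite mulf_neq0.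
  have E : \sum_c (Q i a c).[z] * (Q i c b).[w] = (Q i a b).[z * w].
    rewrite -HQ // exprMn.
    have -> : cochar i (z * w) = \row_k (cochar i z 0 k * cochar i w 0 k).
      by apply/rowP=> s; rewrite !mxE; case: eqP; rewrite ?mulr1.
    rewrite -torusM rhoM ?Gc // mxE mulr_sumr; apply: eq_bigr => c _.
    by rewrite -!HQ //; apply: mulrACA.
  by rewrite E QD; apply: eq_bigr => c _; rewrite hornerZ !hornerXn exprMn mulrA.
have AC i j k l : A i k *m A j l = A j l *m A i k.
  apply/matrixP=> a b; rewrite !mxE.
  rewrite (eq_bigr (fun c => (Q i a c)`_k * (Q j c b)`_l)) => [|c _]; last by rewrite !mxE.
  rewrite [RHS](eq_bigr (fun c => (Q i c b)`_k * (Q j a c)`_l)) => [|c _]; last by rewrite !mxE mulrC.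
  apply: coef2_eq => z w z0 w0.
  have E : (z ^+ d i *: rho (torus (cochar i z))) *m (w ^+ d j *: rho (torus (cochar j w))) =
           (w ^+ d j *: rho (torus (cochar j w))) *m (z ^+ d i *: rho (torus (cochar i z))).
    rewrite -!scalemxAl -!scalemxAr -!rhoM ?Gc // scalerA mulrC -scalerA !torusM.
    by congr (_ *: (_ *: rho (torus _))); apply/rowP=> s; rewrite !mxE mulrC.
  have /matrixP/(_ a b) := E; rewrite !mxE.
  rewrite (eq_bigr (fun c => (Q i a c).[z] * (Q j c b).[w])) => [->|c _]; last first.
    by rewrite -!HQ // !mxE.
  by apply: eq_bigr => c _; rewrite -!HQ // !mxE mulrC.
have A1 i : \sum_(k < D) A i k = 1%:M.
  apply/matrixP=> a b; rewrite summxE.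
  have := HQ i 1 (oner_neq0 _) a b; rewrite expr1n mul1r QD.
  have -> : cochar i 1 = (\row_s 1 : 'rV[C]_n) by apply/rowP=> s; rewrite !mxE; case: eqP.
  by rewrite torus1 rho1 => ->; apply: eq_bigr => k _; rewrite mxE expr1n mulr1.
pose As := [seq A i.1 i.2 | i : 'I_n * 'I_D].
have /codiagonalizableP[S Su /allP Sd] :
   {in As &, forall B B', comm_mx B B'} /\ {in As, forall B, diagonalizable B}.
  split=> [X Y /mapP[[i k] _ ->] /mapP[[j l] _ ->]|Y /mapP[[i k] _ ->]]; first exact: AC.
  have [m' Em] : exists m', m = m'.+1 by case: (m) m0 => // m' _; exists m'.
  have := AA i k k (ltn_ord k); rewrite eqxx mulr1n.
  move: (A i k); rewrite Em => X BB; apply/diagonalizableP.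
  (* An idempotent is annihilated by X (X - 1), which has simple roots. *)
  exists [:: 0; 1]; first by rewrite /= inE eq_sym oner_neq0.
  rewrite !big_cons big_nil mulr1 subr0; apply: mxminpoly_min.
  rewrite rmorphM rmorphB /= horner_mx_X horner_mx_C mulrBr -[X * X]/(X *m X) BB.
  by rewrite mulr1 subrr.
exists S.
pose B i k := S *m A i k *m invmx S.
have Bd i k : (k < D)%N -> is_diag_mx (B i k).
  move=> kD; have /Sd /= : A i (Ordinal kD) \in As by apply/mapP; exists (i, Ordinal kD); rewrite ?mem_enum.
  by rewrite /B -conjumx.
have BB i k l : (k < D)%N -> B i k *m B i l = B i k *+ (k == l).
  move=> kD; rewrite /B -!mulmxA [invmx S *m _]mulmxA mulVmx // mul1mx.
  rewrite [A i k *m _]mulmxA AA //; case: eqP => _; rewrite ?mulr1n // !mulr0n.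
  by rewrite mul0mx mulmx0.
have Bjj i k l j : (k < D)%N -> B i k j j * B i l j j = B i k j j *+ (k == l).
  move=> kD; have /matrixP/(_ j j) := BB i k l kD; rewrite mulmxnE => <-.
  rewrite [RHS]mxE (bigD1 j) //= big1 ?addr0 // => c cj.
  have /is_diag_mxP Bd' := Bd i k kD; rewrite Bd' ?mul0r //.
  by apply: contraNneq cj => E; apply/eqP/val_inj.
have B1 i j : \sum_(k < D) B i k j j = 1.
  rewrite -summxE -mulmx_suml -mulmx_sumr A1 mulmx1 mulmxV //.
  by rewrite mxE eqxx.
have pickw j i : exists k : 'I_D, forall l : 'I_D, B i l j j = (l == k)%:R.
  have [k Bk] : exists k : 'I_D, B i k j j != 0.
    apply/existsP; apply: contraT; rewrite negb_exists => /forallP H.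
    have := B1 i j; rewrite big1 => [|k _]; last by apply/eqP; have := H k; rewrite negbK.
    by move/eqP; rewrite eq_sym oner_eq0.
  exists k => l; have := Bjj i k l j (ltn_ord k).
  case: (eqVneq l k) => [->|lk].
    by rewrite eqxx mulr1n => E; apply: (mulfI Bk); rewrite E mulr1.
  have -> : ((k : nat) == l) = false by apply: contraNF lk => /eqP E; apply/eqP/val_inj.
  by move/eqP; rewrite mulr0n mulf_eq0 (negPf Bk) => /eqP.
have [kw Hk] := fin_all_exists (fun j => fin_all_exists (pickw j)).
exists (fun j i => (kw j i : nat)%:Z - (d i)%:Z); split=> //.
pose T x := S *m rho (torus x) *m invmx S.
have TM x y : nz x -> nz y -> T (\row_i (x 0 i * y 0 i)) = T x *m T y.
  move=> x0 y0; rewrite /T -torusM rhoM ?torus_O // -!mulmxA [invmx S *m _]mulmxA.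
  by rewrite mulVmx // mul1mx !mulmxA.
have T1 : T (\row_i 1) = 1%:M by rewrite /T torus1 rho1 mulmx1 mulmxV.
have Tc i z : z != 0 -> T (cochar i z) = diag_mx (\row_j z ^ ((kw j i : nat)%:Z - (d i)%:Z)).
  move=> z0; have zd : z ^+ d i != 0 by rewrite expf_neq0.
  have E : z ^+ d i *: T (cochar i z) = \sum_(k < D) z ^+ k *: B i k.
    rewrite /T scalemxAl scalemxAr.
    have -> : z ^+ d i *: rho (torus (cochar i z)) = \sum_(k < D) z ^+ k *: A i k.
      apply/matrixP=> a b; rewrite mxE HQ // QD summxE; apply: eq_bigr => k _.
      by rewrite !mxE mulrC.
    rewrite mulmx_sumr mulmx_suml; apply: eq_bigr => k _.
    by rewrite -scalemxAr -scalemxAl.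
  apply/matrixP=> a b; apply: (mulfI zd); have /matrixP/(_ a b) := E.
  rewrite mxE => ->; rewrite summxE mxE mxE; case: eqP => [<-|/eqP ab].
    rewrite mulr1n (bigD1 (kw a i)) //= big1 => [|k kk]; last first.
      by rewrite mxE Hk (negPf kk) mulr0.
    rewrite mxE Hk eqxx mulr1 addr0 -[z ^+ d i]/(z ^ (d i)%:Z) -expfzDr //.
    by rewrite addrC subrK.
  rewrite mulr0n mulr0 big1 // => k _; rewrite mxE.
  by have /is_diag_mxP -> := Bd i k (ltn_ord k); rewrite ?mulr0.
move=> x x0; rewrite -/(T x) (torus_ind TM T1 Tc) //.
have E (s : seq 'I_n) : \big[mulmx/1%:M]_(i <- s) diag_mx (\row_j x 0 i ^ ((kw j i : nat)%:Z - (d i)%:Z))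
   = diag_mx (\row_j \prod_(i <- s) x 0 i ^ ((kw j i : nat)%:Z - (d i)%:Z)).
  elim: s => [|i s IH].
    rewrite big_nil; apply/matrixP=> a b; rewrite !mxE big_nil //.
  rewrite big_cons IH mulmx_diag; congr diag_mx; apply/rowP=> j.
  by rewrite !mxE big_cons.
by rewrite E.
Qed.

End Representation.

(** * Signed permutations *)

Section SignedPermutations.
Variables (C : numClosedFieldType) (n : nat).
Notation N := (n + n)%N.
Notation G := (@O2n C n).
Implicit Types (x : 'rV[C]_n) (s : {perm 'I_N}).

Definition signed s := forall a, s (star a) = star (s a).

Lemma signedV s : signed s -> signed s^-1%g.
Proof. by move=> ss a; apply: (@perm_inj _ s); rewrite ss !permKV. Qed.

Definition sact s x : 'rV[C]_n := \row_i te x (s (lshift n i)).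

Lemma te_sact s x a : signed s -> te (sact s x) a = te x (s a).
Proof.
move=> ss; elim/index_ind: a => i; rewrite ?te_l ?te_r mxE //.
by rewrite -te_star -ss star_l.
Qed.

Lemma sact_nz s x : nz x -> nz (sact s x).
Proof. by move=> x0 i; rewrite mxE te_neq0. Qed.

Lemma perm_mx_mulE k s (M : 'M[C]_(N, k)) a j : (perm_mx s *m M) a j = M (s a) j.
Proof. by rewrite -row_permE mxE. Qed.

Lemma perm_mx_torus s x : signed s -> perm_mx s *m torus x = torus (sact s x) *m perm_mx s.
Proof.
move=> ss; apply/matrixP=> a b; rewrite perm_mx_mulE mul_diag_mx torusE [RHS]mxE.
by rewrite [perm_mx _ _ _]mxE [1%:M _ _]mxE -/(te (sact s x) a) te_sact // mulr_natr.
Qed.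

Lemma signed_O s : signed s -> perm_mx s \in G.
Proof.
move=> ss; apply/O2nP; rewrite tr_perm_mx -mulmxA; apply/matrixP=> a b.
by rewrite perm_mx_mulE formJ_mulE mxE mxE formJE ss permKV eq_sym.
Qed.

Lemma oinv_perm s : signed s -> oinv (perm_mx s) = perm_mx s^-1 :> 'M[C]_N.
Proof.
move=> ss; have E : perm_mx s *m perm_mx s^-1 = 1%:M :> 'M[C]_N.
  by rewrite -perm_mxM mulgV perm_mx1.
by rewrite -[LHS]mulmx1 -E mulmxA oinvK ?signed_O // mul1mx.
Qed.

Lemma perm_mx_F s a b : signed s ->
  perm_mx s *m F C a b *m oinv (perm_mx s) = F C (s^-1 a)%g (s^-1 b)%g.
Proof.
move=> ss; rewrite /F -proj_so_conj ?signed_O //; congr proj_so.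
rewrite oinv_perm //; apply/matrixP=> c d; rewrite -mulmxA perm_mx_mulE.
rewrite -[delta_mx a b *m _]trmxK trmx_mul tr_perm_mx invgK mxE perm_mx_mulE !mxE.
by rewrite !(can2_eq (permK s) (permKV s)).
Qed.

Lemma torus_F x a b : nz x ->
  torus x *m F C a b *m oinv (torus x) = (te x a / te x b) *: F C a b.
Proof.
move=> x0; have E c d : torus x *m delta_mx c d *m oinv (torus x) = (te x c / te x d) *: delta_mx c d.
  rewrite oinv_torus //; apply/matrixP=> e f.
  rewrite mul_mx_diag mul_diag_mx [LHS]mxE -/(te (\row_i (x 0 i)^-1) f) [X in X * _]mxE -/(te x e).
  rewrite [RHS]mxE [delta_mx c d e f]mxE.
  have -> : te (\row_i (x 0 i)^-1) f = (te x f)^-1.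
    by elim/index_ind: f => i; rewrite ?te_l ?te_r mxE.
  case: eqP => [->|_]; last by rewrite /= !mulr0 mul0r.
  by case: eqP => [->|_]; rewrite /= ?mulr0 ?mul0r // !mulr1.
rewrite !FE mulmxBr mulmxBl !E !te_star invrK [_^-1 * _]mulrC -scalerBr //.
Qed.

(** For [i0] the last index, this is an element of the orthogonal group of
    determinant -1 that normalizes the torus and permutes the positive roots. *)
Definition swap_perm i0 : {perm 'I_N} := tperm (lshift n i0) (rshift n i0).

Lemma swap_signed i0 : signed (swap_perm i0).
Proof.
move=> a; rewrite /swap_perm; case: (tpermP _ _ a) => [->|->|/eqP al /eqP ar].
- by rewrite star_l tpermR star_r.
- by rewrite star_r tpermL star_l.
- rewrite tpermD // eq_sym star_eq.
  + by rewrite star_l.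
  + by rewrite star_r.
Qed.

End SignedPermutations.

(** * The module generated by a highest weight vector *)

(** The height of the weight of a basis vector: [F a b] is a sum of positive
    root vectors when [ht b < ht a]. *)
Definition ht n (a : 'I_(n + n)) : int :=
  match split a with inl i => n%:Z - i%:Z | inr i => i%:Z - n%:Z end.

Lemma ht_l n (i : 'I_n) : ht (lshift n i) = n%:Z - i%:Z.
Proof. by rewrite /ht (unsplitK (inl i)). Qed.

Lemma ht_r n (i : 'I_n) : ht (rshift n i) = i%:Z - n%:Z.
Proof. by rewrite /ht (unsplitK (inr i)). Qed.

Lemma ht_inj n : injective (@ht n).
Proof.
move=> d c; elim/index_ind: c => i; elim/index_ind: d => j; rewrite ?ht_l ?ht_r => E.
- by congr lshift; apply: val_inj => /=; lia.
- by have := ltn_ord i; have := ltn_ord j; lia.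
- by have := ltn_ord i; have := ltn_ord j; lia.
- by congr rshift; apply: val_inj => /=; lia.
Qed.

Section HighestWeight.
Variables (C : numClosedFieldType) (n m : nat).
Notation N := (n + n)%N.
Notation G := (@O2n C n).
Variables (rho drho : 'M[C]_N -> 'M[C]_m) (i0 : 'I_n).
Hypothesis rho_rational : rational_rep rho.
Hypothesis drhoP : differential rho drho.
Hypothesis last_i0 : forall i : 'I_n, (i <= i0)%N.

Let rho1 : rho 1%:M = 1%:M. Proof. by case: rho_rational. Qed.
Let rhoM : {in G &, forall g h, rho (g *m h) = rho g *m rho h}.
Proof. by case: rho_rational. Qed.
Let rhoP := let: And3 _ _ H := rho_rational in H.

HB.instance Definition _ := GRing.isLinear.Build C 'M[C]_N 'M[C]_m _ drho (proj1 drhoP).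

Local Notation E a b := (drho (F C a b)).
Local Notation sw := (swap_perm i0).

Lemma rho_torus_E x a b : nz x ->
  rho (torus x) *m E a b = (te x a / te x b) *: (E a b *m rho (torus x)).
Proof.
move=> x0; rewrite (drho_comm rho1 rhoM drhoP) ?torus_O //; last exact: F_so.
by rewrite torus_F // linearZ /= -scalemxAl.
Qed.

Lemma rho_perm_E s a b : signed s ->
  rho (perm_mx s) *m E a b = E (s^-1 a)%g (s^-1 b)%g *m rho (perm_mx s).
Proof.
move=> ss; rewrite (drho_comm rho1 rhoM drhoP) ?signed_O //; last exact: F_so.
by rewrite perm_mx_F.
Qed.

Lemma rho_perm_torus s x : signed s -> nz x ->
  rho (perm_mx s) *m rho (torus x) = rho (torus (sact s x)) *m rho (perm_mx s).
Proof.
move=> ss x0; rewrite -!rhoM ?signed_O ?torus_O ?perm_mx_torus //; exact: sact_nz.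
Qed.

Lemma E_star_self a : E a (star a) = 0.
Proof. by rewrite FE starK subrr linear0. Qed.

Lemma swV : sw^-1%g = sw. Proof. exact: tpermV. Qed.

(** [lshift n i0] and [rshift n i0] have consecutive heights, so exchanging them keeps the
    order of heights except on that pair, whose [E] vanishes. *)
Lemma ht_swap c d : ht d < ht c -> d != star c -> ht (sw d) < ht (sw c).
Proof.
have li (i : 'I_n) : i != i0 -> (i < i0)%N by move=> ni; rewrite ltn_neqAle ni last_i0.
have lt0 := ltn_ord i0.
rewrite /swap_perm; case: (tpermP _ _ c) => [->|->|/eqP cl /eqP cr];
case: (tpermP _ _ d) => [->|->|/eqP dl /eqP dr]; rewrite ?star_l ?star_r ?eqxx ?ltxx //;
rewrite ?ht_l ?ht_r.
- elim/index_ind: d dl dr => j; rewrite ?ht_l ?ht_r ?(eq_lshift, eq_rshift) => dl dr;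
    have := ltn_ord j; [have := li _ dl | have := li _ dr]; lia.
- elim/index_ind: d dl dr => j; rewrite ?ht_l ?ht_r ?(eq_lshift, eq_rshift) => dl dr;
    have := ltn_ord j; [have := li _ dl | have := li _ dr]; lia.
- elim/index_ind: c cl cr => j; rewrite ?ht_l ?ht_r ?(eq_lshift, eq_rshift) => dl dr;
    have := ltn_ord j; [have := li _ dl | have := li _ dr]; lia.
- elim/index_ind: c cl cr => j; rewrite ?ht_l ?ht_r ?(eq_lshift, eq_rshift) => dl dr;
    have := ltn_ord j; [have := li _ dl | have := li _ dr]; lia.
Qed.

(** On a line [1 + t X] of group elements the representation is the
    exponential of [t drho X], so it preserves what [drho X] preserves. *)
Lemma unipotent_stable (U : 'cV[C]_m -> Prop) X :
  (forall k u w, U u -> U w -> U (k *: u + w)) -> U 0 ->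
  so X -> X *m X = 0 -> (forall w, U w -> U (drho X *m w)) ->
  forall w, U w -> U (rho (1%:M + X) *m w).
Proof.
move=> UD U0 sX XX UX w Uw.
have Gt t : 1%:M + t *: X \in G by apply: so_unipotent.
have [q Hq] := fin_all_exists (fun a => fin_all_exists (rational_on_line rhoP Gt a)).
have jet_horner (p : {poly C}) t : jet (fun z => p.[z - 1 + t]) p.[t] p^`().[t].
  exists 0%N, (p \Po ('X - 1 + t%:P)); split=> [z _||].
  - by rewrite expr0 mul1r horner_comp !hornerE.
  - by rewrite horner_comp !hornerE subrr add0r.
  - by rewrite deriv_comp derivD derivB derivX !derivC subr0 addr0 mulr1 horner_comp !hornerE subrr add0r.
(* On the line [rho] turns sums of parameters into products, whence a linear differential
   equation. *)
have ode a b : (q a b)^`() = \sum_c (drho X) a c *: q c b.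
  apply/eqP; rewrite -subr_eq0; apply/eqP/polyX_vanish => t _.
  apply/eqP; rewrite hornerD hornerN subr_eq0; apply/eqP.
  have j1 := mjetM (proj2 drhoP _ _ (fun z _ => Gt (z - 1)) (mjet_line X)) (mjet_cst (rho (1%:M + t *: X))).
  have j2 : jet (fun z => (rho (1%:M + (z - 1) *: X) *m rho (1%:M + t *: X)) a b) (q a b).[t] (q a b)^`().[t].
    apply: jet_ext (jet_horner (q a b) t) => z _.
    rewrite -rhoM // -Hq; congr (rho _ a b).
    rewrite mulmxDr mulmx1 mulmxDl mul1mx -!scalemxAr -scalemxAl XX !scaler0 addr0.
    by rewrite scalerDl addrA.
  have [_ <-] := jet_uniq (j1 a b) j2.
  rewrite mulmx0 addr0 mxE horner_sum; apply: eq_bigr => c _.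
  by rewrite hornerZ Hq.
pose D := (\max_a \max_b size (q a b))%N.
have leD a b : (size (q a b) <= D)%N.
  by rewrite /D; apply: leq_trans (leq_bigmax a); apply: (leq_bigmax b).
pose M k : 'M[C]_m := \matrix_(a, b) (q a b)`_k.
have M0 : M 0%N = 1%:M.
  apply/matrixP=> a b; rewrite mxE -horner_coef0 -Hq scale0r addr0 rho1 //.
have MS k : M k.+1 = k.+1%:R^-1 *: (drho X *m M k).
  apply/matrixP=> a b; rewrite mxE [RHS]mxE.
  have := congr1 (fun p : {poly C} => p`_k) (ode a b).
  rewrite coef_deriv coef_sum => E.
  have -> : (drho X *m M k) a b = k.+1%:R * (q a b)`_k.+1.
    by rewrite mulr_natl E mxE; apply: eq_bigr => c _; rewrite coefZ mxE.
  by rewrite mulKf // pnatr_eq0.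
have -> : rho (1%:M + X) = \sum_(k < D) M k.
  apply/matrixP=> a b; rewrite -[X in 1%:M + X]scale1r Hq summxE (horner_coef_wide _ (leD a b)).
  by apply: eq_bigr => k _; rewrite mxE expr1n mulr1.
have UM k : U (M k *m w).
  elim: k => [|k IH]; first by rewrite M0 mul1mx.
  by rewrite MS -scalemxAl -mulmxA -[_ *: _]addr0; apply: UD => //; apply: UX.
rewrite mulmx_suml; apply: (big_ind U) => // u u' Uu Uu'.
by rewrite -[u]scale1r; apply: UD.
Qed.

Variable v : 'cV[C]_m.
Hypothesis v_low : forall c d, ht d < ht c -> E c d *m v = 0.
Hypothesis v_eig : forall c, exists k, E c c *m v = k *: v.
Hypothesis v_tor : forall x, nz x -> exists k, rho (torus x) *m v = k *: v.
Local Notation v' := (rho (perm_mx sw) *m v).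

(** The vectors reached from [v] and from its image under the exchange [sw] by at most [k]
    lowering operators. An inductive relation instead of a subspace gives
    induction on the way in which a vector is reached. *)
Inductive cyc : nat -> 'cV[C]_m -> Prop :=
| cyc_v k : cyc k v
| cyc_v' k : cyc k v'
| cyc_0 k : cyc k 0
| cyc_lin k a u w : cyc k u -> cyc k w -> cyc k (a *: u + w)
| cyc_low k a b w : ht a < ht b -> cyc k w -> cyc k.+1 (E a b *m w).

Lemma cycS k w : cyc k w -> cyc k.+1 w.
Proof.
elim=> {k w} [k|k|k|k a u w _ IHu _ IHw|k a b w ab _ IH]; try by constructor.
Qed.

Lemma cycZ k a w : cyc k w -> cyc k (a *: w).
Proof. by move=> cw; rewrite -[_ *: _]addr0; apply: cyc_lin => //; apply: cyc_0. Qed.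

Lemma E_v c d k : ht d <= ht c -> cyc k (E c d *m v).
Proof.
rewrite le_eqVlt => /predU1P[/ht_inj->|dc]; last by rewrite v_low //; apply: cyc_0.
by have [e ->] := v_eig c; apply/cycZ/cyc_v.
Qed.

Lemma E_perm_v c d : E c d *m v' = rho (perm_mx sw) *m (E (sw c) (sw d) *m v).
Proof.
rewrite [RHS]mulmxA rho_perm_E; last exact: swap_signed.
by rewrite swV !tpermK mulmxA.
Qed.

Lemma E_v' c d k : ht d <= ht c -> cyc k (E c d *m v').
Proof.
rewrite le_eqVlt => /predU1P[/ht_inj->|dc]; last first.
  case: (eqVneq d (star c)) => [->|dsc]; first by rewrite E_star_self mul0mx; apply: cyc_0.
  by rewrite E_perm_v v_low ?ht_swap // mulmx0; apply: cyc_0.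
by rewrite E_perm_v; have [e ->] := v_eig (sw c); rewrite -scalemxAr; apply/cycZ/cyc_v'.
Qed.

(** A raising or diagonal operator is moved past the last lowering operator at the cost of
    the bracket, which is again in the Lie algebra and acts on a vector reached with one
    step less. *)
Lemma cyc_E k w : cyc k w ->
  (forall c d, ht d <= ht c -> cyc k (E c d *m w)) /\ (forall c d, cyc k.+1 (E c d *m w)).
Proof.
suff H k' w' : cyc k' w' -> forall c d, ht d <= ht c -> cyc k' (E c d *m w').
  move=> cw; split=> c d; first exact: H.
  case: (lerP (ht d) (ht c)) => cd; first by apply/cycS/H.
  exact: cyc_low.
elim=> {k' w' k w} [k|k|k|k a u w _ IHu _ IHw|k a b w ab cw IH] c d cd.
- exact: E_v.
- exact: E_v'.
- by rewrite mulmx0; apply: cyc_0.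
- by rewrite mulmxDr -scalemxAr; apply: cyc_lin; [apply: IHu | apply: IHw].
have -> : E c d *m (E a b *m w) = E a b *m (E c d *m w) +
    drho (F C c d *m F C a b - F C a b *m F C c d) *m w.
  rewrite -(drho_bracket rho1 rhoM drhoP); try exact: F_so.
  by rewrite mulmxBl !mulmxA addrC subrK.
rewrite -[X in X + _]scale1r; apply: cyc_lin; first by apply: cyc_low => //; apply: IH.
set Z := _ - _; have sZ : so Z by apply: so_comm; apply: F_so.
move: Z sZ; apply: so_ind => [|e f|e X Y _ _ cX cY].
- by rewrite linear0 mul0mx; apply: cyc_0.
- case: (lerP (ht f) (ht e)) => ef; first by apply/cycS/IH.
  exact: cyc_low.
- by rewrite linearP /= mulmxDl -scalemxAl; apply: cyc_lin.
Qed.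

Lemma cyc_torus x k w : nz x -> cyc k w -> cyc k (rho (torus x) *m w).
Proof.
move=> x0; elim=> {k w} [k|k|k|k a u w _ IHu _ IHw|k a b w ab cw IH].
- by have [e ->] := v_tor x0; apply/cycZ/cyc_v.
- have sG : sw = sw by []; rewrite mulmxA.
  have ss := @swap_signed n i0.
  have -> : rho (torus x) *m rho (perm_mx sw) = rho (perm_mx sw) *m rho (torus (sact sw x)).
    rewrite rho_perm_torus //; last exact: sact_nz.
    congr (rho (torus _) *m _); apply/rowP=> i.
    by rewrite mxE te_sact // tpermK te_l.
  have [e E'] := v_tor (sact_nz sw x0).
  by rewrite -mulmxA E' -scalemxAr; apply/cycZ/cyc_v'.
- by rewrite mulmx0; apply: cyc_0.
- by rewrite mulmxDr -scalemxAr; apply: cyc_lin.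
- by rewrite mulmxA rho_torus_E // -scalemxAl -mulmxA; apply/cycZ/cyc_low.
Qed.

Lemma cyc_swap k w : cyc k w -> cyc k (rho (perm_mx sw) *m w).
Proof.
have ss := @swap_signed n i0.
elim=> {k w} [k|k|k|k a u w _ IHu _ IHw|k a b w ab cw IH].
- exact: cyc_v'.
- rewrite mulmxA -rhoM ?signed_O // -perm_mxM tperm2 perm_mx1 rho1 mul1mx.
  exact: cyc_v.
- by rewrite mulmx0; apply: cyc_0.
- by rewrite mulmxDr -scalemxAr; apply: cyc_lin.
- rewrite mulmxA rho_perm_E // swV -mulmxA.
  case: (eqVneq b (star a)) => [->|bsa].
    by rewrite ss E_star_self mul0mx; apply: cyc_0.
  apply: cyc_low => //; apply: ht_swap => //.
  by rewrite eq_sym star_eq.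
Qed.

(** It is enough to treat a set of generators: unipotent elements are exponentials of
    elements of the Lie algebra, and the torus and the exchange permute the
    operators [E a b] up to scalars. *)
Lemma cyc_stable g w : g \in G -> (exists k, cyc k w) -> exists k, cyc k (rho g *m w).
Proof.
move=> Gg; move: w.
have cyc_le k l u : (k <= l)%N -> cyc k u -> cyc l u.
  by move=> /subnK <-; elim: (l - k)%N => // p IH /IH/cycS.
have UD a u w : (exists k, cyc k u) -> (exists k, cyc k w) -> exists k, cyc k (a *: u + w).
  move=> [k cu] [l cw]; exists (maxn k l); apply: cyc_lin.
    by apply: cyc_le cu; apply: leq_maxl.
  by apply: cyc_le cw; apply: leq_maxr.
apply: (@O2n_generated C n (fun g => forall w, (exists k, cyc k w) -> exists k, cyc k (rho g *m w)) i0) => //.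
- by move=> h h' Gh Gh' Hh Hh' w Uw; rewrite rhoM // -mulmxA; apply/Hh/Hh'.
- move=> X sX XX; apply: (unipotent_stable (U := fun w => exists k, cyc k w)) => //; first by exists 0%N; apply: cyc_0.
  move=> w [k cw]; exists k.+1; move: X sX {XX}; apply: so_ind => [|e f|e X Y _ _ cX cY].
  + by rewrite linear0 mul0mx; apply: cyc_0.
  + by have [_ H] := cyc_E cw; apply: H.
  + by rewrite linearP /= mulmxDl -scalemxAl; apply: cyc_lin.
- by move=> x x0 w [k cw]; exists k; apply: cyc_torus.
- by move=> x x0; apply: torus_O.
- by apply: signed_O; apply: swap_signed.
- by move=> w [k cw]; exists k; apply: cyc_swap.
Qed.

End HighestWeight.

(** * Dominance of the highest weight *)

Lemma expz_inj (C : numClosedFieldType) (e f : int) :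
  (forall z : C, z != 0 -> z ^ e = z ^ f) -> e = f.
Proof.
move=> H; have [_] := jet_uniq (jet_ext H (jet_expz C e)) (jet_expz C f).
by move/eqP; rewrite eqr_int => /eqP.
Qed.

Section Prefix.
Variable n : nat.
Implicit Types (mu nu : 'I_n -> int).

Definition pre (t : nat) mu : int := \sum_(i < n | (i < t)%N) mu i.

Lemma preD t mu nu : pre t (fun i => mu i + nu i) = pre t mu + pre t nu.
Proof. by rewrite /pre big_split. Qed.

Lemma preB t mu nu : pre t (fun i => mu i - nu i) = pre t mu - pre t nu.
Proof. by rewrite /pre sumrB. Qed.

Lemma eq_pre t mu nu : mu =1 nu -> pre t mu = pre t nu.
Proof. by move=> E; apply: eq_bigr. Qed.

(** The strict dominance order: [mu] is below [nu]. *)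
Definition below nu mu : bool :=
  [forall t : 'I_n.+1, pre t mu <= pre t nu] && [exists i, mu i != nu i].

(** Weight of the [a]-th standard basis vector. *)
Definition eps (a : 'I_(n + n)) : 'I_n -> int :=
  fun i => (a == lshift n i)%:Z - (a == rshift n i)%:Z.

Lemma pre_eps_l t i : pre t (eps (lshift n i)) = (i < t)%N%:Z.
Proof.
rewrite /pre big_mkcond (bigD1 i) //= big1 => [|j ji].
  by rewrite /eps eqxx eq_lrshift subr0 addr0; case: ifP.
by rewrite /eps eq_lrshift eq_lshift eq_sym (negPf ji) subr0; case: ifP.
Qed.

Lemma pre_eps_r t i : pre t (eps (rshift n i)) = - (i < t)%N%:Z.
Proof.
rewrite /pre big_mkcond (bigD1 i) //= big1 => [|j ji].
  by rewrite /eps eqxx eq_rlshift sub0r addr0; case: ifP => //; rewrite oppr0.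
by rewrite /eps eq_rlshift eq_rshift eq_sym (negPf ji) subr0; case: ifP.
Qed.

Lemma pre_eps_le t a b : ht a <= ht b -> pre t (eps a) <= pre t (eps b).
Proof.
elim/index_ind: a => i; elim/index_ind: b => j; rewrite ?ht_l ?ht_r ?pre_eps_l ?pre_eps_r;
  have := ltn_ord i; have := ltn_ord j; case: (ltnP i t); case: (ltnP j t); lia.
Qed.

Lemma pre_eps_lt a b : ht a < ht b -> exists t : 'I_n.+1, pre t (eps a) < pre t (eps b).
Proof.
have li (i : 'I_n) : (i < n.+1)%N by rewrite ltnS ltnW.
elim/index_ind: a => i; elim/index_ind: b => j; rewrite ?ht_l ?ht_r => H;
  have := ltn_ord i; have := ltn_ord j.
- exists (Ordinal (li i)); rewrite !pre_eps_l /=; lia.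
- lia.
- exists ord_max; rewrite pre_eps_l pre_eps_r /=; lia.
- exists (Ordinal (li j)); rewrite !pre_eps_r /=; lia.
Qed.

End Prefix.

Section Dominance.
Variables (C : numClosedFieldType) (n m : nat).
Notation N := (n + n)%N.
Notation G := (@O2n C n).
Variables (rho drho : 'M[C]_N -> 'M[C]_m) (i0 : 'I_n).
Hypothesis rho_rational : rational_rep rho.
Hypothesis drhoP : differential rho drho.
Hypothesis last_i0 : forall i : 'I_n, (i <= i0)%N.
Variable wt : 'I_m -> 'I_n -> int.
Hypothesis rho_diag : forall x, nz x -> rho (torus x) = diag_mx (\row_j xpow x (wt j)).

HB.instance Definition _ := GRing.isLinear.Build C 'M[C]_N 'M[C]_m _ drho (proj1 drhoP).

Local Notation E a b := (drho (F C a b)).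
Local Notation sw := (swap_perm i0).

Lemma xpow_cochar (i : 'I_n) (z : C) mu : xpow (cochar i z : 'rV[C]_n) mu = z ^ mu i.
Proof.
rewrite /xpow (bigD1 i) //= big1 => [|j /negPf ji]; first by rewrite mxE eqxx mulr1.
by rewrite mxE ji exp1rz.
Qed.

Lemma te_cochar (i : 'I_n) (z : C) (a : 'I_N) : te (cochar i z) a = z ^ eps a i.
Proof.
elim/index_ind: a => j; rewrite ?te_l ?te_r /eps mxE ?eq_lshift ?eq_rshift ?eq_lrshift ?eq_rlshift eq_sym;
by case: eqP => _; rewrite ?subr0 ?sub0r ?oppr0 ?expr1z ?expr0z ?exprN1 ?invr1.
Qed.

(** Both sides are the derivative of [rho] along the [i]-th cocharacter. *)
Lemma drho_FE i : E (lshift n i) (lshift n i) = diag_mx (\row_j (wt j i)%:~R).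
Proof.
have j1 := proj2 drhoP _ _ (fun z z0 => torus_O (cochar_nz i z0)) (mjet_cochar C i).
have EE (z : C) : z != 0 -> diag_mx (\row_j z ^ wt j i) = rho (torus (cochar i z)).
  move=> z0; rewrite rho_diag; last exact: cochar_nz.
  by congr diag_mx; apply/rowP=> j; rewrite !mxE xpow_cochar.
have j2 : mjet (fun z : C => diag_mx (\row_j z ^ wt j i)) 1%:M (diag_mx (\row_j (wt j i)%:~R)).
  move=> a b; rewrite !mxE; case: (eqVneq a b) => [->|ab].
    rewrite mulr1n; apply: jet_ext (jet_expz C (wt b i)) => z _.
    by rewrite !mxE eqxx mulr1n.
  rewrite !mulr0n; apply: jet_ext (jet_cst 0) => z _; by rewrite !mxE (negPf ab) mulr0n.
by have [] := mjet_uniq j1 (mjet_ext EE j2).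
Qed.

(** Conjugation by the torus multiplies [E a b] by the character of weight
    [eps a - eps b]. *)
Lemma E_weight a b j k : E a b j k != 0 -> forall i, wt j i = wt k i + eps a i - eps b i.
Proof.
move=> Ejk i; apply: (@expz_inj C) => z z0; have xz := cochar_nz (n := n) i z0.
have := rho_torus_E rho_rational drhoP a b xz.
rewrite rho_diag // => /matrixP/(_ j k); rewrite mul_diag_mx mxE [RHS]mxE mul_mx_diag.
rewrite [in RHS]mxE !mxE !xpow_cochar !te_cochar => H.
move: (eps a i) (eps b i) H => ea eb H.
apply: (mulIf Ejk); rewrite H !expfzDr // -invr_expz.
by have aux (p q r s : C) : p * q * (r * s) = s * p * q * r by ring; apply: aux.
Qed.

Variable (lam : 'I_n -> nat) (v : 'cV[C]_m).
Hypothesis v_neq0 : v != 0.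
Hypothesis v_low : forall c d, ht d < ht c -> E c d *m v = 0.
Hypothesis v_tor : forall x, nz x -> rho (torus x) *m v = xpow x (fun i => (lam i)%:Z) *: v.

Lemma v_supp j : v j 0 != 0 -> forall i, wt j i = lam i.
Proof.
move=> vj i; apply: (@expz_inj C) => z z0; have xz := cochar_nz (n := n) i z0.
have /matrixP/(_ j 0) := v_tor xz.
by rewrite rho_diag // mul_diag_mx mxE [RHS]mxE mxE !xpow_cochar => /(mulIf vj).
Qed.

Lemma v_eig c : exists k, E c c *m v = k *: v.
Proof.
have H i : E (lshift n i) (lshift n i) *m v = (lam i)%:R *: v.
  apply/matrixP=> j k; rewrite drho_FE mul_diag_mx !mxE ord1.
  by case: (eqVneq (v j 0) 0) => [->|/v_supp->]; rewrite ?mulr0 // pmulrn.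
elim/index_ind: c => i; first by exists (lam i)%:R.
exists (- (lam i)%:R); have := F_star C (lshift n i) (lshift n i); rewrite star_l => ->.
by rewrite linearN /= mulNmx H scaleNr.
Qed.

Hypothesis sw_v : (exists e, rho (perm_mx sw) *m v = e *: v) \/ lam i0 != 0%N.

Definition lamz (i : 'I_n) : int := (lam i)%:Z.

(** Satisfied by the whole module generated by [v], this excludes a second weight that is not
    below [lam]. *)
Definition good (w : 'cV[C]_m) :=
  exists c, forall j, ~~ below lamz (wt j) -> w j 0 = c * v j 0.

Lemma sw_v_supp j : (rho (perm_mx sw) *m v) j 0 != 0 ->
  forall i, wt j i = if i == i0 then - lamz i else lamz i.
Proof.
move=> vj i; apply: (@expz_inj C) => z z0; have xz := cochar_nz (n := n) i z0.
have ss := @swap_signed n i0.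
have ax := sact_nz sw xz.
have H := rho_perm_torus rho_rational ss ax.
have aa : sact sw (sact sw (cochar i z)) = cochar i z.
  by apply/rowP=> k; rewrite mxE te_sact // tpermK te_l.
rewrite aa in H.
have /matrixP/(_ j 0) : rho (torus (cochar i z)) *m (rho (perm_mx sw) *m v) =
    xpow (sact sw (cochar i z)) lamz *: (rho (perm_mx sw) *m v).
  by rewrite mulmxA -H -mulmxA v_tor // -scalemxAr.
rewrite rho_diag // mul_diag_mx mxE [RHS]mxE mxE !xpow_cochar => /(mulIf vj) ->.
rewrite /xpow (bigD1 i) //= big1 => [|k ki]; last first.
  rewrite mxE te_cochar /eps /swap_perm; case: tpermP => [/eqP||_ _]; rewrite ?eq_lshift ?eq_rshift ?eq_lrshift ?eq_rlshift.
  - by move/eqP=> Ek; rewrite Ek in ki; rewrite (negPf ki) subrr expr0z exp1rz.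
  - by move/eqP; rewrite eq_lrshift.
  - by rewrite (negPf ki) subrr expr0z exp1rz.
rewrite mulr1 mxE te_cochar /eps /swap_perm.
case: (eqVneq i i0) => [->|ii0].
  by rewrite tpermL eq_rlshift eqxx sub0r exprN1 -exprz_inv.
rewrite tpermD ?eq_lshift ?eq_rlshift //; last by rewrite eq_sym.
by rewrite eqxx eq_lrshift subr0 expr1z.
Qed.

(** Lowering strictly decreases weights; the image of [v] under the exchange is either
    proportional to [v], or has the strictly lower weight with last coordinate
    [- lam i0]. *)
Lemma cyc_good k w : cyc rho drho i0 v k w -> good w.
Proof.
elim=> {k w} [k|k|k|k a u w _ [c cu] _ [d dw]|k a b w ab _ [c cw]].
- by exists 1 => j _; rewrite mul1r.
- case: sw_v => [[e Ev]|l0]; first by exists e => j _; rewrite Ev mxE.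
  exists 0 => j; rewrite mul0r => H; apply/eqP; apply: contraNT H => /sw_v_supp wj.
  apply/andP; split.
    apply/forallP=> t; apply: ler_sum => i _; rewrite wj; case: ifP => // _.
    by rewrite /lamz; lia.
  by apply/existsP; exists i0; rewrite wj eqxx /lamz; lia.
- by exists 0 => j _; rewrite mxE mul0r.
- by exists (a * c + d) => j bj; rewrite !mxE cu // dw // mulrDl mulrA.
exists 0 => j bj; rewrite mul0r mxE big1 // => k' _.
apply/eqP; apply: contraNT bj; rewrite mulf_eq0 negb_or => /andP[Ejk wk].
have wjk := E_weight Ejk.
have pk (t : 'I_n.+1) : pre t (wt k') <= pre t lamz.
  case: (boolP (below lamz (wt k'))) => [/andP[/forallP/(_ t)//]|nb].
  rewrite cw // mulf_eq0 negb_or in wk; case/andP: wk => _ /v_supp vk.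
  by rewrite (eq_pre t vk).
have pj t : pre t (wt j) = pre t (wt k') + pre t (eps a) - pre t (eps b).
  by rewrite (eq_pre t wjk) preB preD.
apply/andP; split.
  apply/forallP=> t; rewrite pj; have := pk t; have := pre_eps_le t (ltW ab); lia.
apply: contraT; rewrite negb_exists => /forallP H.
have wl : wt j =1 lamz by move=> i; apply/eqP; have := H i; rewrite negbK.
have [t] := pre_eps_lt ab.
by have := pj t; rewrite (eq_pre t wl); have := pk t; lia.
Qed.

Hypothesis irr : forall (v : 'cV[C]_m) (phi : 'rV[C]_m), v != 0 ->
  (forall g, g \in G -> phi *m rho g *m v = 0) -> phi = 0.

(** If a second basis vector [j] had a weight not below [lam], the functional
    [phi = v_j0 e_j - v_j e_j0] would kill all of [rho g v] by [cyc_good], against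
    irreducibility. *)
Lemma highest_weight_unique :
  exists j0, wt j0 =1 lamz /\ forall j, j != j0 -> below lamz (wt j).
Proof.
have [j0 vj0] : exists j, v j 0 != 0.
  apply/existsP; apply: contraT; rewrite negb_exists => /forallP H.
  by case/eqP: v_neq0; apply/colP=> j; apply/eqP; have := H j; rewrite negbK mxE.
exists j0; split=> [|j jj]; first exact: v_supp.
apply: contraT => bj.
pose phi : 'rV[C]_m := v j0 0 *: delta_mx 0 j - v j 0 *: delta_mx 0 j0.
have b0 : ~~ below lamz (wt j0).
  rewrite negb_and; apply/orP; right; rewrite negb_exists; apply/forallP=> i.
  by rewrite v_supp // negbK.
have dE (w : 'cV[C]_m) l : ((delta_mx 0 l : 'rV[C]_m) *m w) 0 0 = w l 0.
  by rewrite -rowE mxE.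
have : phi = 0.
  apply: (irr v_neq0) => g Gg; apply/matrixP=> a b; rewrite !ord1 -mulmxA.
  have [k ck] := cyc_stable rho_rational drhoP last_i0 v_low v_eig
     (fun x x0 => ex_intro _ _ (v_tor x0)) Gg (ex_intro _ 0%N (cyc_v rho drho i0 v 0)).
  have [c cE] := cyc_good ck.
  rewrite mulmxBl -!scalemxAl mxE [X in X + _]mxE [X in _ + X]mxE [X in - X]mxE !dE !cE //.
  by rewrite mxE; ring.
move/matrixP/(_ 0 j); rewrite !mxE !eqxx (negPf jj) /= mulr1 mulr0 subr0 => Ev.
by rewrite Ev eqxx in vj0.
Qed.

End Dominance.

(** * The Casimir element and the radial equation *)

(** Multiplying [\sum E_ab (x) E_ba] by [h] on the left of the first factor is the same as
    multiplying by [h] on the right of the second. *)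
Lemma conj_tensor_half (C : numClosedFieldType) (N : nat) (V : lmodType C)
   (Phi : 'M[C]_N -> 'M[C]_N -> V) (h h' : 'M[C]_N) :
  (forall X, linear (Phi X)) -> (forall Y, linear (Phi^~ Y)) -> h *m h' = 1%:M ->
  \sum_a \sum_b Phi (h *m delta_mx a b) (delta_mx b a *m h') =
  \sum_a \sum_b Phi (delta_mx a b) (delta_mx b a).
Proof.
move=> PR PL hh; rewrite exchange_big [RHS]exchange_big; apply: eq_bigr => b _ /=.
have E1 a : h *m delta_mx a b = \sum_c h c a *: delta_mx c b.
  apply/matrixP=> i j; rewrite mxE summxE (bigD1 a) //= big1 => [|k /negPf ka].
    rewrite (bigD1 i) //= big1 => [|k /negPf ki]; last by rewrite !mxE eq_sym ki mulr0.
    by rewrite !mxE !eqxx.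
  by rewrite !mxE ka mulr0.
have E2 a : delta_mx b a *m h' = \sum_f h' a f *: delta_mx b f.
  apply/matrixP=> i j; rewrite mxE summxE (bigD1 a) //= big1 => [|k /negPf ka].
    rewrite (bigD1 j) //= big1 => [|k /negPf kj]; last by rewrite !mxE [j == k]eq_sym kj andbF mulr0.
    by rewrite !mxE !eqxx !andbT mulrC !addr0.
  by rewrite !mxE ka andbF mul0r.
have PRs X (I : finType) (f : I -> C) (Y : I -> 'M[C]_N) :
    Phi X (\sum_i f i *: Y i) = \sum_i f i *: Phi X (Y i).
  pose L : {linear 'M[C]_N -> V} := HB.pack (Phi X) (GRing.isLinear.Build _ _ _ _ _ (PR X)).
  by rewrite -[Phi X]/(L : _ -> _) linear_sum; apply: eq_bigr => i _; rewrite linearZ.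
have PLs Y (I : finType) (f : I -> C) (X : I -> 'M[C]_N) :
    Phi (\sum_i f i *: X i) Y = \sum_i f i *: Phi (X i) Y.
  pose L : {linear 'M[C]_N -> V} := HB.pack (Phi^~ Y) (GRing.isLinear.Build _ _ _ _ _ (PL Y)).
  by rewrite -[LHS]/(L _) linear_sum; apply: eq_bigr => i _; rewrite linearZ.
transitivity (\sum_c \sum_f (h *m h') c f *: Phi (delta_mx c b) (delta_mx b f)).
  rewrite (eq_bigr (fun a => \sum_c \sum_f (h c a * h' a f) *: Phi (delta_mx c b) (delta_mx b f))).
    rewrite exchange_big; apply: eq_bigr => c _; rewrite exchange_big; apply: eq_bigr => f _.
    by rewrite -scaler_suml mxE.
  move=> a _; rewrite E1 E2 PLs; apply: eq_bigr => c _.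
  by rewrite PRs scaler_sumr; apply: eq_bigr => f _; rewrite scalerA.
rewrite hh; apply: eq_bigr => c _; rewrite (bigD1 c) //= big1 => [|f fc].
  by rewrite mxE eqxx scale1r addr0.
by rewrite mxE eq_sym (negPf fc) scale0r.
Qed.

(** Invariance of the tensor [\sum E_ab (x) E_ba], seen through an arbitrary bilinear map
    [Phi], is what makes the Casimir element central. *)
Lemma conj_tensor (C : numClosedFieldType) (N : nat) (V : lmodType C)
   (Phi : 'M[C]_N -> 'M[C]_N -> V) (h h' : 'M[C]_N) :
  (forall X, linear (Phi X)) -> (forall Y, linear (Phi^~ Y)) -> h *m h' = 1%:M ->
  \sum_a \sum_b Phi (h *m delta_mx a b *m h') (h *m delta_mx b a *m h') =
  \sum_a \sum_b Phi (delta_mx a b) (delta_mx b a).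
Proof.
move=> PR PL hh.
have E1 := @conj_tensor_half C N V (fun X Y => Phi (X *m h') (h *m Y)) h h'.
have E2 := @conj_tensor_half C N V (fun X Y => Phi Y X) h h'.
rewrite [RHS]exchange_big -E2 // [RHS]exchange_big /= -E1 //.
- by apply: eq_bigr => a _; apply: eq_bigr => b _; rewrite mulmxA.
- by move=> X k Y Z /=; rewrite mulmxDr -scalemxAr PR.
- by move=> Y k X Z /=; rewrite mulmxDl -scalemxAl PL.
Qed.

Section Casimir.
Variables (C : numClosedFieldType) (n m : nat).
Notation N := (n + n)%N.
Notation G := (@O2n C n).
Variables (rho drho : 'M[C]_N -> 'M[C]_m).
Hypothesis rho_rational : rational_rep rho.
Hypothesis drhoP : differential rho drho.
Hypothesis irr : forall (v : 'cV[C]_m) (phi : 'rV[C]_m), v != 0 ->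
  (forall g, g \in G -> phi *m rho g *m v = 0) -> phi = 0.

HB.instance Definition _ := GRing.isLinear.Build C 'M[C]_N 'M[C]_m _ drho (proj1 drhoP).

Let rho1 : rho 1%:M = 1%:M. Proof. by case: rho_rational. Qed.
Let rhoM : {in G &, forall g h, rho (g *m h) = rho g *m rho h}.
Proof. by case: rho_rational. Qed.

Local Notation E a b := (drho (F C a b)).

Definition casimir : 'M[C]_m := \sum_a \sum_b E a b *m E b a.

Lemma casimir_comm h : h \in G -> rho h *m casimir = casimir *m rho h.
Proof.
move=> Gh; set h' := oinv h.
have hh' : h *m h' = 1%:M := oinvKr Gh.
have h'h : h' *m h = 1%:M := oinvK Gh.
pose D (X : 'M[C]_N) := drho (proj_so X).
have DL k X Y : D (k *: X + Y) = k *: D X + D Y by rewrite /D !linearP.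
have E1 := @conj_tensor C N _ (fun X Y => D X *m D Y) h h' _ _ hh'.
have adj a b : D (h *m delta_mx a b *m h') = rho h *m E a b *m rho h'.
  by rewrite /D proj_so_conj // (drho_adj rhoM drhoP) //; apply: F_so.
have rh : rho h' *m rho h = 1%:M by rewrite -rhoM ?O2n_oinv // h'h rho1.
have CE : casimir = \sum_a \sum_b D (h *m delta_mx a b *m h') *m D (h *m delta_mx b a *m h').
  rewrite E1 //.
  - by move=> X k Y Z; rewrite DL mulmxDr -scalemxAr.
  - by move=> X k Y Z; rewrite DL mulmxDl -scalemxAl.
rewrite [in RHS]CE /casimir.
rewrite mulmx_sumr mulmx_suml; apply: eq_bigr => a _.
rewrite mulmx_sumr mulmx_suml; apply: eq_bigr => b _.
rewrite !adj -!mulmxA rh mulmx1 [rho h' *m (rho h *m _)]mulmxA rh mul1mx.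
by [].
Qed.

(** Irreducibility enters through [irr]: a nonzero column of [Z - c] and a left eigenvector
    of [Z] for [c] would contradict it. *)
Lemma schur Z : (0 < m)%N -> (forall h, h \in G -> rho h *m Z = Z *m rho h) ->
  exists c, Z = c%:M.
Proof.
move=> m0 ZC; have [c /eigenvalueP[u uZ u0]] := eigenvalue_closed Z m0.
exists c; apply/eqP; rewrite -subr_eq0; apply: contraT => Z0.
have [j vj] : exists j, col j (Z - c%:M) != 0.
  apply/existsP; apply: contraT; rewrite negb_exists => /forallP H.
  case/eqP: Z0; apply/matrixP=> a j; have := H j; rewrite negbK => /eqP/matrixP/(_ a 0).
  by rewrite mxE [RHS]mxE => ->; rewrite mxE.
case/eqP: u0; apply: (irr vj) => g Gg.
rewrite colE mulmxA -[u *m _ *m _]mulmxA; have -> : rho g *m (Z - c%:M) = (Z - c%:M) *m rho g.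
  by rewrite mulmxBr mulmxBl ZC // mul_mx_scalar mul_scalar_mx.
by rewrite !mulmxA mulmxBr uZ mul_mx_scalar subrr !mul0mx.
Qed.

Lemma F_comm (a b : 'I_N) : b != star a -> F C a b *m F C b a - F C b a *m F C a b = F C a a - F C b b.
Proof.
move=> bsa; have sab : (star a == b) = false by rewrite eq_sym (negPf bsa).
have asb : (a == star b) = false by rewrite -star_eq sab.
rewrite !FE !mulmxBl !mulmxBr !mul_delta_mx_cond !eqxx.
rewrite sab (negPf bsa) asb [star b == a]eq_sym asb !mulr0n !mulr1n.
by apply/matrixP=> i j; rewrite !mxE; ring.
Qed.

Variable wt : 'I_m -> 'I_n -> int.
Hypothesis rho_diag : forall x, nz x -> rho (torus x) = diag_mx (\row_j xpow x (wt j)).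

Section AtPoint.
Variable x : 'rV[C]_n.
Hypothesis x0 : nz x.
Hypothesis x_gen : forall a b, a != b -> b != star a -> te x a != te x b.
Local Notation T := (rho (torus x)).
Local Notation h a := (\tr (E a a *m T)).
Local Notation t a b := (\tr (E a b *m E b a *m T)).

(** Moving [T] around the trace, past [E b a], multiplies it by a ratio of the [te x]; compared
    with the commutator of [E a b] and [E b a], this is a linear equation for
    the trace. *)
Lemma trace_EE a b : a != b -> b != star a ->
  t a b = (h a - h b) * (te x a / (te x a - te x b)).
Proof.
move=> ab bsa; have [ta tb] := (te_neq0 a x0, te_neq0 b x0).
have tab : te x a - te x b != 0 by rewrite subr_eq0 x_gen.
have E1 : t a b = te x a / te x b * t b a.
  have := rho_torus_E rho_rational drhoP b a x0 => E2.
  have E3 : E b a *m T = (te x a / te x b) *: (T *m E b a).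
    rewrite E2 scalerA (_ : _ * _ = 1) ?scale1r //; field.
    by rewrite ta tb.
  rewrite -mulmxA E3 -scalemxAr mxtraceZ mulmxA mxtrace_mulC mulmxA.
  by [].
have E2 : t a b - t b a = h a - h b.
  rewrite -!raddfB /= -!mulmxBl (drho_bracket rho1 rhoM drhoP); try exact: F_so.
  by rewrite F_comm // raddfB.
apply: (mulIf tab); rewrite -mulrA divfK // -E2.
by move: (t a b) (t b a) E1 => u w ->; field.
Qed.

(** Twice the logarithmic derivative of the Weyl denominator in the direction of [a], see
    [alternant_derivative]. *)
Definition rad a : C := \sum_(b | (b != a) && (b != star a)) (te x a + te x b) / (te x a - te x b).

Lemma h_star a : h (star a) = - h a.
Proof. by rewrite F_star linearN /= mulNmx raddfN. Qed.

Lemma rad_star a : rad (star a) = - rad a.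
Proof.
rewrite /rad (reindex_inj (inv_inj (@starK n))) /= -sumrN; apply: eq_big => [b|b].
  by rewrite !eq_star.
rewrite !eq_star => /andP[ba bsa].
have [ta tb] := (te_neq0 a x0, te_neq0 b x0).
have ab : te x a - te x b != 0.
  by rewrite subr_eq0 x_gen // eq_sym.
have ab' : te x b - te x a != 0 by rewrite -oppr_eq0 opprB.
rewrite !te_star; field.
by rewrite ta tb ab mulN1r ab'.
Qed.

Lemma trace_casimir :
  \tr (casimir *m T) = 2 * \sum_(i < n) (t (lshift n i) (lshift n i) + h (lshift n i) * rad (lshift n i)).
Proof.
have E1 : \tr (casimir *m T) = \sum_a (t a a + h a * rad a).
  rewrite mulmx_suml raddf_sum /= big_split /=.
  have E2 a : \tr ((\sum_b E a b *m E b a) *m T) = t a a +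
      \sum_(b | (b != a) && (b != star a)) (h a - h b) * (te x a / (te x a - te x b)).
    rewrite mulmx_suml raddf_sum (bigD1 a) //=; congr (_ + _).
    rewrite (bigID (fun b => b == star a)) /= big1 => [|b /andP[_ /eqP->]].
      rewrite add0r; apply: eq_big => // b /andP[ba bsa].
      by rewrite trace_EE // eq_sym.
    by rewrite FE starK subrr linear0 !mul0mx raddf0.
  rewrite (eq_bigr _ (fun a _ => E2 a)) big_split /=; congr (_ + _).
  under eq_bigr => a _ do (under eq_bigr => b _ do rewrite mulrBl).
  under eq_bigr => a _ do rewrite sumrB.
  rewrite sumrB.
  have -> : \sum_a \sum_(b | (b != a) && (b != star a)) h b * (te x a / (te x a - te x b)) =
     - \sum_a \sum_(b | (b != a) && (b != star a)) h a * (te x b / (te x a - te x b)).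
    rewrite (exchange_big_dep xpredT) //= -sumrN; apply: eq_bigr => b _; rewrite -sumrN.
    apply: eq_big => [a|a _]; first by rewrite [b == a]eq_sym [b == star a]eq_sym star_eq.
    by rewrite -mulrN -mulrN -invrN opprB.
  rewrite opprK -big_split; apply: eq_bigr => a _ /=.
  rewrite -big_split /rad mulr_sumr; apply: eq_bigr => b _ /=.
  by rewrite -mulrDr -mulrDl.
rewrite E1 big_split_ord /= mulr_natl mulr2n; congr (_ + _); apply: eq_bigr => i _.
by rewrite -star_l h_star rad_star mulrNN F_star linearN /= mulNmx mulmxN opprK.
Qed.

Lemma rad_l i : rad (lshift n i) =
  \sum_(j | j != i) ((x 0 i + x 0 j) / (x 0 i - x 0 j) + (x 0 i + (x 0 j)^-1) / (x 0 i - (x 0 j)^-1)).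
Proof.
rewrite /rad big_split_ord /= big_split /= te_l; congr (_ + _).
  apply: eq_big => [j|j _]; last by rewrite te_l.
  by rewrite star_l eq_lshift eq_lrshift andbT.
apply: eq_big => [j|j _]; last by rewrite te_r.
by rewrite star_l eq_rshift eq_rlshift.
Qed.

End AtPoint.

(** The trace of the Casimir element against [torus x], computed as a scalar multiple of the
    character and as a sum over pairs of indices. *)
Lemma radial_equation : (0 < m)%N -> exists c : C, forall x, nz x ->
  (forall a b, a != b -> b != star a -> te x a != te x b) ->
  c * \sum_j xpow x (wt j) = \sum_j (\sum_i (wt j i)%:~R ^+ 2) * xpow x (wt j) +
    \sum_i (\sum_j (wt j i)%:~R * xpow x (wt j)) *
      \sum_(j | j != i) ((x 0 i + x 0 j) / (x 0 i - x 0 j) + (x 0 i + (x 0 j)^-1) / (x 0 i - (x 0 j)^-1)).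
Proof.
move=> m0; have [c Ec] := schur m0 casimir_comm.
(* The pairs (a, b) and (star b, star a) give the same term, hence the factor 2. *)
exists (c / 2) => x x0 xg.
have two0 : (2 : C) != 0 by rewrite pnatr_eq0.
apply: (mulfI two0).
have trT : \tr (rho (torus x)) = \sum_j xpow x (wt j).
  by rewrite rho_diag // mxtrace_diag; apply: eq_bigr => j _; rewrite mxE.
have H := trace_casimir x0 xg; rewrite Ec mul_scalar_mx mxtraceZ trT in H.
rewrite mulrA [2 * (c / 2)]mulrC divfK // H; congr (_ * _).
rewrite big_split /=; congr (_ + _).
  transitivity (\sum_i \sum_j ((wt j i)%:~R ^+ 2 * xpow x (wt j) : C)).
    apply: eq_bigr => i _; rewrite (drho_FE drhoP rho_diag) rho_diag //.
    rewrite !mulmx_diag mxtrace_diag; apply: eq_bigr => j _; by rewrite !mxE expr2.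
  by rewrite exchange_big; apply: eq_bigr => j _; rewrite mulr_suml.
apply: eq_bigr => i _; rewrite rad_l; congr (_ * _).
rewrite (drho_FE drhoP rho_diag) rho_diag // mulmx_diag mxtrace_diag.
by apply: eq_bigr => j _; rewrite !mxE.
Qed.

End Casimir.

(** * The weights of an irreducible character *)

Section RootSubgroups.
Variables (C : numClosedFieldType) (n : nat).
Notation N := (n + n)%N.
Notation G := (@O2n C n).

Lemma root_subE (i j : 'I_n) (s : C) : root_sub i j s = 1%:M + s *: F C (lshift n i) (lshift n j).
Proof.
rewrite /root_sub FE !star_l; apply/matrixP=> a b.
elim/index_ind: a => k; elim/index_ind: b => l;
rewrite ?(block_mxEul, block_mxEur, block_mxEdl, block_mxEdr) !mxE;
rewrite !(eq_lshift, eq_rshift, eq_lrshift, eq_rlshift) /= ?subr0 ?sub0r ?addr0 ?mulr0 ?addr0 //.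
  by rewrite andbF mulr0 addr0.
by rewrite andbF mulr0n oppr0 mulr0 addr0.
by rewrite mulrN.
Qed.

Lemma root_addE (i j : 'I_n) (s : C) : root_add i j s = 1%:M + s *: F C (lshift n i) (rshift n j).
Proof.
rewrite /root_add FE star_l star_r; apply/matrixP=> a b.
elim/index_ind: a => k; elim/index_ind: b => l;
rewrite ?(block_mxEul, block_mxEur, block_mxEdl, block_mxEdr) !mxE;
rewrite !(eq_lshift, eq_rshift, eq_lrshift, eq_rlshift) /= ?andbF ?subr0 ?sub0r ?addr0 ?mulr0 ?addr0 ?add0r //.
Qed.

Variables (m : nat).

Lemma rational_conj (rho : 'M[C]_N -> 'M[C]_m) S : S \in unitmx -> rational_rep rho ->
  rational_rep (fun g => S *m rho g *m invmx S).
Proof.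
move=> Su [rho1 rhoM rhoP]; split.
- by rewrite rho1 mulmx1 mulmxV.
- move=> g h Gg Gh; rewrite rhoM // -!mulmxA [invmx S *m _]mulmxA mulVmx // mul1mx.
  by rewrite !mulmxA.
have [P HP] := fin_all_exists (fun i => fin_all_exists (rhoP i)).
move=> i j; exists (\sum_b \sum_a (S i a * invmx S b j) *: P a b) => g Gg.
rewrite mxE raddf_sum; apply: eq_bigr => b _ /=.
rewrite mxE mulr_suml raddf_sum; apply: eq_bigr => a _ /=.
by rewrite mevalZ HP // mulrAC.
Qed.

Lemma fixed_drho (rho drho : 'M[C]_N -> 'M[C]_m) X v : differential rho drho ->
  (forall s, 1%:M + s *: X \in G) ->
  (forall s, rho (1%:M + s *: X) *m v = v :> 'cV_m) -> drho X *m v = 0.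
Proof.
move=> drhoP GX vX.
have j1 := mjetM (proj2 drhoP _ _ (fun z _ => GX (z - 1)) (mjet_line X)) (mjet_cst v).
have j2 := mjet_ext (fun z _ => vX (z - 1)) j1.
have [_] := mjet_uniq j2 (mjet_cst v); by rewrite mulmx0 addr0.
Qed.

(** Every positive root vector is, up to sign, the derivative of one of the root
    subgroups in the definition of a highest weight vector. *)
Lemma positive_root_kills (rho drho : 'M[C]_N -> 'M[C]_m) v : differential rho drho ->
  (forall (i j : 'I_n) (s : C), (i < j)%N ->
     rho (root_sub i j s) *m v = v :> 'cV_m /\ rho (root_add i j s) *m v = v) ->
  forall a b, ht b < ht a -> drho (F C a b) *m v = 0.
Proof.
move=> drhoP hv.
have dN X : drho (- X) = - drho X.
  have D0 : drho 0 = 0.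
    have := proj1 drhoP 1 0 0; rewrite !scale1r !addr0 => /eqP.
    by rewrite -[X in X == _]addr0 (inj_eq (addrI _)) eq_sym => /eqP.
  by have := proj1 drhoP (-1) X 0; rewrite !scaleN1r D0 !addr0.
have so_line a b : a != b -> forall s, 1%:M + s *: F C a b \in G.
  by move=> ab s; apply: so_unipotent; [exact: F_so | exact: F_square0].
have Ksub (i j : 'I_n) : (i < j)%N -> drho (F C (lshift n i) (lshift n j)) *m v = 0.
  move=> ij; apply: (fixed_drho drhoP) => s.
    by apply: so_line; rewrite eq_lshift -val_eqE ltn_eqF.
  by rewrite -root_subE; case: (hv i j s ij).
have Kadd (i j : 'I_n) : (i < j)%N -> drho (F C (lshift n i) (rshift n j)) *m v = 0.
  move=> ij; apply: (fixed_drho drhoP) => s.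
    by apply: so_line; rewrite eq_lrshift.
  by rewrite -root_addE; case: (hv i j s ij).
have D0 : drho 0 = 0 by have := dN 0; rewrite oppr0 => /eqP; rewrite -subr_eq0 opprK -mulr2n -scaler_nat scaler_eq0 pnatr_eq0 => /eqP.
move=> a b; elim/index_ind: a => i; elim/index_ind: b => j; rewrite ?ht_l ?ht_r => H.
- by apply: Ksub; lia.
- case: (ltngtP i j) => [ij|ji|/val_inj ->]; first exact: Kadd.
    rewrite -[lshift n i]star_r -[rshift n j]star_l F_star dN mulNmx Kadd //.
    by rewrite oppr0.
  by rewrite FE star_l star_r subrr D0 mul0mx.
- by have := ltn_ord i; have := ltn_ord j; lia.
- rewrite -[rshift n i]star_l -[rshift n j]star_l F_star dN mulNmx Ksub ?oppr0 //.
  lia.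
Qed.

End RootSubgroups.

Section WeightsOfCharacter.
Variables (C : numClosedFieldType) (n : nat).
Notation N := (n + n)%N.
Notation G := (@O2n C n).

(** The facts on the weights from which Weyl's formula is derived. The
    highest weight vector [v1] is first replaced by one that the exchange [sw] maps to a
    multiple of itself, if the last part of [lam] vanishes: then [sw] keeps the weight
    [lam], and [v1 + sw v1] or, if this is zero, [v1] will do. This is where the
    two extensions of a representation of SO(2n) to O(2n) are treated alike. *)
Lemma chO2n_weights (lam : n.-tuple nat) (ch : 'rV[C]_n -> C) : (0 < n)%N ->
  is_chO2n lam ch -> exists m (wt : 'I_m -> 'I_n -> int) (j0 : 'I_m) (c : C),
  [/\ forall x, nz x -> ch x = \sum_j xpow x (wt j),
      forall s (x : 'rV[C]_n), signed s -> nz x ->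
        \sum_j xpow (sact s x) (wt j) = \sum_j xpow x (wt j),
      wt j0 =1 lamz (tnth lam), forall j, j != j0 -> below (lamz (tnth lam)) (wt j)
    & forall x : 'rV[C]_n, nz x -> (forall a b, a != b -> b != star a -> te x a != te x b) ->
      c * \sum_j xpow x (wt j) = \sum_j (\sum_i (wt j i)%:~R ^+ 2) * xpow x (wt j) +
       \sum_i (\sum_j (wt j i)%:~R * xpow x (wt j)) *
         \sum_(j | j != i) ((x 0 i + x 0 j) / (x 0 i - x 0 j) + (x 0 i + (x 0 j)^-1) / (x 0 i - (x 0 j)^-1))].
Proof.
move=> n0 [m [rho0 [rat0 irr0 [v0 [v0n v0t v0r]] Hch]]].
have m0 := proj1 irr0.
have irrf0 := irreducible_functional rat0 irr0.
have [S [wt [Su Sd]]] := torus_diagonalizable rat0 m0.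
pose rho g := S *m rho0 g *m invmx S.
have rat : rational_rep rho := rational_conj Su rat0.
have [rho1 rhoM rhoP] := rat.
have diag x : nz x -> rho (torus x) = diag_mx (\row_j xpow x (wt j)) by apply: Sd.
have irrf (v : 'cV[C]_m) (phi : 'rV[C]_m) : v != 0 ->
    (forall g, g \in G -> phi *m rho g *m v = 0) -> phi = 0.
  move=> vn H; have vn' : invmx S *m v != 0.
    by apply: contraNneq vn => E; rewrite -[v]mul1mx -(mulmxV Su) -mulmxA E mulmx0.
  have := irrf0 (invmx S *m v) (phi *m S) vn' => E.
  rewrite -[phi]mulmx1 -(mulmxV Su) mulmxA E ?mul0mx // => g Gg.
  by have := H g Gg; rewrite /rho !mulmxA.
have [drho drhoP] := differential_exists rho1 rhoP.
have pn : (n.-1 < n)%N by rewrite prednK.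
pose i0 : 'I_n := Ordinal pn.
have last_i0 (i : 'I_n) : (i <= i0)%N by rewrite /= -ltnS prednK.
pose lz := lamz (tnth lam).
pose v1 := S *m v0.
have SS w : invmx S *m (S *m w) = w :> 'cV[C]_m by rewrite mulmxA mulVmx // mul1mx.
have v1n : v1 != 0 by apply: contraNneq v0n => E; rewrite -[v0]SS -/v1 E mulmx0.
have v1t x : nz x -> rho (torus x) *m v1 = xpow x lz *: v1.
  by move=> x0; rewrite /rho /v1 -!mulmxA SS v0t // scalemxAr.
have v1l : forall a b, ht b < ht a -> drho (F C a b) *m v1 = 0.
  apply: (positive_root_kills drhoP) => i j s ij.
  by have [E1 E2] := v0r i j s ij; rewrite /rho /v1 -!mulmxA !SS E1 E2.
set sw := swap_perm i0.
have ss : signed sw := @swap_signed n i0.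
pose v2 := rho (perm_mx sw) *m v1.
have [v [vn vl vt sv]] : exists v : 'cV[C]_m, [/\ v != 0,
    forall a b, ht b < ht a -> drho (F C a b) *m v = 0,
    forall x, nz x -> rho (torus x) *m v = xpow x lz *: v
    & (exists e, rho (perm_mx sw) *m v = e *: v) \/ tnth lam i0 != 0%N].
  case: (eqVneq (tnth lam i0) 0%N) => [l0|l0]; last by exists v1; split=> //; right.
  have v2l a b : ht b < ht a -> drho (F C a b) *m v2 = 0.
    move=> ab; case: (eqVneq b (star a)) => [->|bsa].
      by rewrite (E_star_self drhoP) mul0mx.
    by rewrite /v2 (E_perm_v i0 rat drhoP) v1l ?mulmx0 // (ht_swap last_i0).
  have v2t x : nz x -> rho (torus x) *m v2 = xpow x lz *: v2.
    move=> x0; have xa := sact_nz sw x0.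
    have aa : sact sw (sact sw x) = x.
      by apply/rowP=> k; rewrite mxE te_sact // tpermK te_l.
    have := rho_perm_torus rat ss xa; rewrite aa => E.
    rewrite /v2 mulmxA -E -mulmxA v1t // -scalemxAr; congr (_ *: _).
    apply: eq_bigr => i _; rewrite mxE /sw /swap_perm; case: tpermP => [/eqP|/eqP|_ _].
    - by rewrite eq_lshift => /eqP->; rewrite /lz /lamz l0 !expr0z.
    - by rewrite eq_lrshift.
    - by rewrite te_l.
  have v22 : rho (perm_mx sw) *m v2 = v1.
    by rewrite mulmxA -rhoM ?signed_O // -perm_mxM tperm2 perm_mx1 rho1 mul1mx.
  case: (eqVneq (v1 + v2) 0) => [E|nE].
    exists v1; split=> //; left; exists (-1).
    by rewrite -/v2 scaleN1r; apply/eqP; rewrite -addr_eq0 addrC E.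
  exists (v1 + v2); split=> //.
  - by move=> a b ab; rewrite mulmxDr v1l // v2l // addr0.
  - by move=> x x0; rewrite mulmxDr v1t // v2t // scalerDr.
  - by left; exists 1; rewrite mulmxDr v22 scale1r addrC.
have [j0 [wj0 wj]] := highest_weight_unique rat drhoP last_i0 diag vn vl vt sv irrf.
have [c Hc] := radial_equation rat drhoP irrf diag m0.
have trE x : nz x -> \tr (rho (torus x)) = \sum_j xpow x (wt j).
  by move=> x0; rewrite diag // mxtrace_diag; apply: eq_bigr => j _; rewrite mxE.
exists m, wt, j0, c; split=> //.
- move=> x x0; rewrite Hch // -trE // /rho mxtrace_mulC mulmxA mulVmx // mul1mx.
  by [].
- move=> s x sg x0; have xa := sact_nz s x0; rewrite -!trE //.
  have E := rho_perm_torus rat sg x0.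
  have P1 : rho (perm_mx s) *m rho (perm_mx s^-1) = 1%:M.
    rewrite -rhoM ?signed_O //; last exact: signedV.
    by rewrite -perm_mxM mulgV perm_mx1 rho1.
  rewrite -[rho (torus (sact s x))]mulmx1 -P1 mulmxA -E mxtrace_mulC mulmxA.
  by rewrite (mulmx1C P1) mul1mx.
Qed.

End WeightsOfCharacter.

(** * Sums of characters of the torus *)

Section Independence.
Variables (C : numClosedFieldType) (n : nat).
Implicit Types (x y : 'rV[C]_n).

Lemma expz_indep (K : finType) (b : K -> C) (e : K -> int) :
  (forall z, z != 0 -> \sum_k b k * z ^ e k = 0) ->
  forall f, \sum_(k | e k == f) b k = 0.
Proof.
move=> H f.
pose M := (\sum_k `|e k| + `|f|)%N.
have eM k : (0 <= e k + M%:Z).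
  have : (`|e k| <= M)%N by rewrite /M (bigD1 k) //= -addnA leq_addr.
  lia.
have fM : 0 <= f + M%:Z by rewrite /M; lia.
pose q : {poly C} := \sum_k b k *: 'X^(absz (e k + M%:Z)).
have q0 : q = 0.
  apply: polyX_vanish => z z0; rewrite horner_sum.
  rewrite (eq_bigr (fun k => z ^ M%:Z * (b k * z ^ e k))) => [|k _].
    by rewrite -mulr_sumr H // mulr0.
  rewrite hornerZ hornerXn -[z ^+ _]/(z ^ (absz (e k + M%:Z))%:Z) gez0_abs //.
  by rewrite expfzDr // mulrA mulrC.
have := congr1 (fun p : {poly C} => p`_(absz (f + M%:Z))) q0.
rewrite coef0 coef_sum => {2}<-; rewrite big_mkcond; apply: eq_bigr => k _.
rewrite coefZ coefXn; have := eM k; case: eqP => [->|ne] ek.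
  by rewrite eqxx mulr1.
by case: eqP => [E|]; rewrite ?mulr0 //; lia.
Qed.

Lemma xpowM x y mu : xpow (\row_i (x 0 i * y 0 i)) mu = xpow x mu * xpow y mu.
Proof.
by rewrite /xpow -big_split; apply: eq_bigr => i _; rewrite mxE expfzMl.
Qed.

Lemma xpow1 mu : xpow (\row_(_ < n) (1 : C)) mu = 1.
Proof. by apply: big1 => i _; rewrite mxE exp1rz. Qed.

Lemma xpowD x mu nu : nz x -> xpow x (fun i => mu i + nu i) = xpow x mu * xpow x nu.
Proof. by move=> x0; rewrite /xpow -big_split; apply: eq_bigr => i _; rewrite expfzDr. Qed.

(** The exponents are separated one coordinate at a time, along the cocharacters. *)
Lemma xpow_indep1 (K : finType) (b : K -> C) (nu : K -> 'I_n -> int) :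
  (forall x, nz x -> \sum_k b k * xpow x (nu k) = 0) ->
  forall mu : 'I_n -> int, \sum_(k | [forall i, nu k i == mu i]) b k = 0.
Proof.
move=> H mu.
have claim (s : seq 'I_n) x : nz x ->
    \sum_(k | all (fun i => nu k i == mu i) s) b k * xpow x (nu k) = 0.
  elim: s x => [|i s IH] x x0 /=; first exact: H.
  pose b' k := (if all (fun i => nu k i == mu i) s then b k * xpow x (nu k) else 0).
  have := @expz_indep K b' (fun k => nu k i) _ (mu i); rewrite /b' => E.
  rewrite big_mkcondr /= -[RHS]E => [|z z0].
    by rewrite big_mkcond [RHS]big_mkcond.
  have xz : nz (\row_j (x 0 j * cochar i z 0 j)).
    by move=> j; rewrite mxE mulf_neq0 // cochar_nz.
  rewrite -[RHS](IH _ xz) [RHS]big_mkcond; apply: eq_bigr => k _.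
  by case: ifP => _; rewrite ?mul0r // xpowM xpow_cochar mulrA.
have := claim (enum 'I_n) _ (fun i => _).
have o1 : nz (\row_(_ < n) (1 : C)) by move=> i; rewrite mxE oner_neq0.
have := claim (enum 'I_n) _ o1 => E _; rewrite -[RHS]E.
apply: eq_big => [k|k _]; last by rewrite xpow1 mulr1.
apply/forallP/allP => [h i _|h i]; first exact: h.
by apply: h; rewrite mem_enum.
Qed.

(** Exponents as finite functions, to have a decidable equality. *)
Definition fun_of (mu : 'I_n -> int) : {ffun 'I_n -> int} := [ffun i => mu i].

(** Characters of the torus are linearly independent: an identity between sums
    of characters may be transported by any function of the exponents. *)
Lemma xpow_indep (K L : finType) (b : K -> C) (nu : K -> 'I_n -> int)
   (d : L -> C) (mu : L -> 'I_n -> int) (H : {ffun 'I_n -> int} -> C) :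
  (forall x, nz x -> \sum_k b k * xpow x (nu k) = \sum_l d l * xpow x (mu l)) ->
  \sum_k b k * H (fun_of (nu k)) = \sum_l d l * H (fun_of (mu l)).
Proof.
move=> E.
pose bb (k : K + L) := match k with inl k => b k | inr l => - d l end.
pose nn (k : K + L) := match k with inl k => nu k | inr l => mu l end.
have Z x : nz x -> \sum_k bb k * xpow x (nn k) = 0.
  move=> x0; rewrite big_sumType /= E // -big_split /= big1 // => l _.
  by rewrite mulNr subrr.
suff S : \sum_k bb k * H (fun_of (nn k)) = 0.
  move: S; rewrite big_sumType /=.
  under [X in _ + X]eq_bigr => l _ do rewrite mulNr.
  by rewrite sumrN => /eqP; rewrite subr_eq0 => /eqP.
pose s := undup [seq fun_of (nn k) | k : (K + L)%type].
rewrite (eq_bigr (fun k => \sum_(f <- s | f == fun_of (nn k)) bb k * H f)) => [|k _].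
  rewrite (exchange_big_dep xpredT) //= big1 // => f _.
  rewrite -mulr_suml.
  have E' := xpow_indep1 Z f.
  rewrite (eq_bigl (fun k => [forall i, nn k i == f i])) ?E' ?mul0r // => k.
  apply/eqP/forallP => [-> i|h]; first by rewrite ffunE.
  by apply/ffunP=> i; rewrite ffunE; apply/esym/eqP.
rewrite -big_filter (_ : filter _ _ = [:: fun_of (nn k)]) ?big_seq1 //.
rewrite (eq_filter (a2 := pred1 (fun_of (nn k)))) // filter_pred1_uniq ?undup_uniq //.
by rewrite mem_undup; apply/mapP; exists k; rewrite ?mem_enum.
Qed.

End Independence.

Section Density.
Variables (C : numClosedFieldType) (n : nat).
Implicit Types (x : 'rV[C]_n) (f : 'rV[C]_n -> C).

(** The coordinates grow at pairwise distinct rates, so that for any [x] the [ycoord] are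
    distinct at all but finitely many points of the curve. *)
Definition curve x (z : C) : 'rV[C]_n := \row_i (x 0 i * z ^+ i.+1).

Definition ycoord x i : C := x 0 i + (x 0 i)^-1.

(** The existence of a jet means that [f] is a Laurent polynomial along the curve. *)
Definition regular f := forall x, nz x -> exists a b, jet (fun z => f (curve x z)) a b.

Lemma regularD f g : regular f -> regular g -> regular (fun x => f x + g x).
Proof.
by move=> rf rg x x0; have [a [b H]] := rf x x0; have [c [d H']] := rg x x0;
  exists (a + c), (b + d); apply: jetD.
Qed.

Lemma regularM f g : regular f -> regular g -> regular (fun x => f x * g x).
Proof.
by move=> rf rg x x0; have [a [b H]] := rf x x0; have [c [d H']] := rg x x0;
  do 2!eexists; apply: jetM; eassumption.
Qed.

Lemma regular_cst c : regular (fun=> c).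
Proof. by move=> x _; exists c, 0; apply: jet_cst. Qed.

Lemma curve_nz x z : nz x -> z != 0 -> nz (curve x z).
Proof. by move=> x0 z0 i; rewrite mxE mulf_neq0 // expf_neq0. Qed.

Lemma curve1 x : curve x 1 = x.
Proof. by apply/rowP=> i; rewrite mxE expr1n mulr1. Qed.

Lemma regular_xpow mu : regular (fun x => xpow x mu).
Proof.
move=> x x0; exists (xpow x mu), (xpow x mu * \sum_i (mu i)%:~R * i.+1%:R).
have -> : xpow x mu * \sum_i (mu i)%:~R * i.+1%:R =
  \prod_i x 0 i ^ mu i * \sum_i ((x 0 i) ^ mu i * ((mu i)%:~R * i.+1%:R)) / (x 0 i) ^ mu i.
  congr (_ * _); apply: eq_bigr => i _.
  by rewrite mulrAC divff ?mul1r // expfz_neq0.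
have J := @jet_prod C 'I_n (index_enum _) xpredT
  (fun i z => x 0 i ^ mu i * z ^ (mu i * i.+1%:Z)) (fun i => x 0 i ^ mu i)
  (fun i => x 0 i ^ mu i * ((mu i)%:~R * i.+1%:R)).
apply: jet_ext (J _ _) => [z z0|i _|i _].
- apply: eq_bigr => i _; rewrite mxE expfzMl; congr (_ * _).
  by rewrite mulrC -exprz_exp.
- by rewrite expfz_neq0.
have := jetZ (x 0 i ^ mu i) (jet_expz C (mu i * i.+1%:Z)).
by rewrite mulr1 intrM.
Qed.

Lemma regular_sum (I : Type) (r : seq I) (P : pred I) (g : I -> 'rV[C]_n -> C) :
  (forall i, P i -> regular (g i)) -> regular (fun x => \sum_(i <- r | P i) g i x).
Proof.
move=> H; elim: r => [|i r IH] x x0.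
  by exists 0, 0; apply: jet_ext (jet_cst 0) => z _; rewrite big_nil.
case Pi : (P i).
  have [a [b J]] := regularD (H i Pi) IH x0.
  by exists a, b; apply: jet_ext J => z _; rewrite big_cons Pi.
by have [a [b J]] := IH x x0; exists a, b; apply: jet_ext J => z _; rewrite big_cons Pi.
Qed.

Lemma regular_prod (I : Type) (r : seq I) (P : pred I) (g : I -> 'rV[C]_n -> C) :
  (forall i, P i -> regular (g i)) -> regular (fun x => \prod_(i <- r | P i) g i x).
Proof.
move=> H; elim: r => [|i r IH] x x0.
  by exists 1, 0; apply: jet_ext (jet_cst 1) => z _; rewrite big_nil.
case Pi : (P i).
  have [a [b J]] := regularM (H i Pi) IH x0.
  by exists a, b; apply: jet_ext J => z _; rewrite big_cons Pi.
by have [a [b J]] := IH x x0; exists a, b; apply: jet_ext J => z _; rewrite big_cons Pi.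
Qed.

Lemma regular_ext f g : (forall x, nz x -> f x = g x) -> regular f -> regular g.
Proof.
move=> E rf x x0; have [a [b J]] := rf x x0; exists a, b; apply: jet_ext J => z z0.
by rewrite E //; apply: curve_nz.
Qed.

(** Along [curve x] the function is a Laurent polynomial in [z] that vanishes wherever the
    polynomials [p i j] do not. *)
Lemma regular_density f : regular f ->
  (forall x, nz x -> (forall i j, i != j -> ycoord x i != ycoord x j) -> f x = 0) ->
  forall x, nz x -> f x = 0.
Proof.
move=> rf H x x0; have [a [b [d [q [Hq q1 _]]]]] := rf x x0.
(* The difference of two [ycoord] on the curve, times [z ^+ n] to clear denominators. *)
pose p (i j : 'I_n) : {poly C} := x 0 i *: 'X^(n + i.+1) + (x 0 i)^-1 *: 'X^(n - i.+1)
   - x 0 j *: 'X^(n + j.+1) - (x 0 j)^-1 *: 'X^(n - j.+1).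
have pE i j z : z != 0 -> (p i j).[z] = z ^+ n * (ycoord (curve x z) i - ycoord (curve x z) j).
  move=> z0; rewrite /p !(hornerD, hornerN, hornerZ, hornerXn) /ycoord !mxE !invfM.
  have e k : (k < n)%N -> z ^+ (n - k.+1) = z ^+ n * (z ^+ k.+1)^-1.
    by move=> kn; rewrite -{2}(subnK kn) exprD mulfK // expf_neq0.
  rewrite !e // !exprD; set u := z ^+ n; set v := z ^+ i.+1; set w := z ^+ j.+1.
  by rewrite !mulrDr !mulrN; ring.
have p0 i j : i != j -> p i j != 0.
  move=> ij; apply: contraTneq ij => pij; rewrite negbK.
  have := congr1 (fun p : {poly C} => p`_(n + i.+1)) pij.
  rewrite /p coef0 !coefB !coefD !coefZ !coefXn eqxx.
  have -> : (n + i.+1 == n - i.+1)%N = false by have := ltn_ord i; lia.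
  have -> : (n + i.+1 == n - j.+1)%N = false by have := ltn_ord i; have := ltn_ord j; lia.
  rewrite eqn_add2l eqSS; case: (eqVneq (i : nat) j) => [/val_inj -> //|_].
  by rewrite !mulr0 !mulr1 !subr0 addr0 => /eqP; rewrite (negPf (x0 i)).
pose pp := 'X * \prod_i \prod_(j | j != i) p i j.
have pp0 : pp != 0.
  rewrite mulf_neq0 ?polyX_eq0 //; apply/prodf_neq0 => i _; apply/prodf_neq0 => j ji.
  by rewrite p0 // eq_sym.
have q0 : q = 0.
  apply: (poly_vanish_nz pp0) => z; rewrite hornerM hornerX mulf_eq0 negb_or => /andP[z0 pz].
  rewrite -Hq // H ?mulr0 //; first exact: curve_nz.
  move=> i j ij; apply: contraNneq pz => E.
  rewrite horner_prod (bigD1 i) //= horner_prod (bigD1 j) //= 1?eq_sym //.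
  by rewrite pE // E subrr mulr0 !mul0r.
have := Hq 1 (oner_neq0 _); rewrite expr1n mul1r curve1 q0 horner0 //.
Qed.

End Density.

(** * Exponents dominated by a sorted exponent *)

Section Orders.
Variable n : nat.

(** Summation by parts. *)
Lemma abel_nonneg (d f : nat -> int) :
  (forall t, (t <= n)%N -> 0 <= \sum_(i < t) d i) ->
  (forall i j, (i <= j < n)%N -> f j <= f i) -> (forall i, 0 <= f i) ->
  0 <= \sum_(i < n) d i * f i.
Proof.
case: n => [|k] Hd Hf f0; first by rewrite big_ord0.
have H t : (t <= k)%N -> (\sum_(i < t.+1) d i) * f t <= \sum_(i < t.+1) d i * f i.
  elim: t => [|t IH] tk; first by rewrite !big_ord1.
  rewrite big_ord_recr [X in _ <= X]big_ord_recr /= mulrDl lerD2r.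
  apply: le_trans (IH (ltnW tk)); apply: ler_wpM2l; first by apply: Hd; lia.
  by apply: Hf; lia.
by apply: le_trans (H k (leqnn _)); apply: mulr_ge0; [apply: Hd|].
Qed.

(** By summation by parts [eta - f] has a nonnegative inner product with [f], so equality of
    the norms forces [eta - f] to vanish. *)
Lemma dominated_norm (eta f : 'I_n -> int) :
  (forall t, (t <= n)%N -> pre t f <= pre t eta) ->
  (forall i j : 'I_n, (i <= j)%N -> f j <= f i) -> (forall i, 0 <= f i) ->
  \sum_i f i ^+ 2 = \sum_i eta i ^+ 2 -> f =1 eta.
Proof.
move=> Hd Hf f0 E.
pose ext (g : 'I_n -> int) k := if insub k is Some i then g i else 0.
have extE g (i : 'I_n) : ext g i = g i by rewrite /ext valK.
have preE g t : (t <= n)%N -> \sum_(i < t) ext g i = pre t g.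
  move=> tn; rewrite (big_ord_widen n (ext g) tn) /pre; apply: eq_bigr => i _.
  exact: extE.
have A : 0 <= \sum_(i < n) ext (fun i => eta i - f i) i * ext f i.
  apply: abel_nonneg.
  - by move=> t tn; rewrite preE // preB subr_ge0 Hd.
  - move=> i j /andP[ij jn].
    by rewrite -[i]/(val (Ordinal (leq_ltn_trans ij jn))) -[j]/(val (Ordinal jn)) !extE Hf.
  - by move=> i; rewrite /ext; case: insubP.
have B : \sum_i (eta i - f i) ^+ 2 = - (2 * \sum_(i < n) ext (fun i => eta i - f i) i * ext f i).
  have -> : \sum_i (eta i - f i) ^+ 2 =
     (\sum_i eta i ^+ 2 - \sum_i f i ^+ 2) - 2 * \sum_i (eta i - f i) * f i.
    rewrite -sumrB mulr_sumr -sumrB; apply: eq_bigr => i _; ring.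
  rewrite E subrr sub0r; congr (- (_ * _)); apply: eq_bigr => i _.
  by rewrite !extE.
have Z : \sum_i (eta i - f i) ^+ 2 = 0.
  apply/eqP; rewrite eq_le; apply/andP; split; last by apply: sumr_ge0 => i _; apply: sqr_ge0.
  by rewrite B oppr_le0 mulr_ge0.
move=> i; have := psumr_eq0P (fun i _ => sqr_ge0 (eta i - f i)) Z (i := i) isT.
by move/eqP; rewrite sqrf_eq0 subr_eq0 => /eqP.
Qed.

(** After subtraction of the value at [t], the terms before [t] are nonnegative and the
    others are not positive. *)
Lemma perm_prefix (f : 'I_n -> int) (s : 'S_n) t :
  (forall i j : 'I_n, (i <= j)%N -> f j <= f i) -> pre t (fun i => f (s i)) <= pre t f.
Proof.
move=> Hf; case: (leqP n t) => [nt|tn].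
  have full (g : 'I_n -> int) : pre t g = \sum_i g i.
    by apply: eq_bigl => i; rewrite (leq_trans (ltn_ord i) nt).
  by rewrite !full [X in _ <= X](reindex_inj (@perm_inj _ s)).
pose c := f (Ordinal tn).
have H (g : 'I_n -> int) : pre t g = pre t (fun i => g i - c) + pre t (fun _ : 'I_n => c).
  by rewrite -preD; apply: eq_pre => i; rewrite subrK.
rewrite (H f) H lerD2r.
have -> : pre t (fun i => f (s i) - c) = \sum_(i | (s^-1%g i < t)%N) (f i - c).
  rewrite [RHS](reindex_inj (@perm_inj _ s)); apply: eq_bigl => i.
  by rewrite permK.
rewrite /pre [X in X <= _]big_mkcond [X in _ <= X]big_mkcond; apply: ler_sum => i _.
case: (ltnP i t) => it.
  case: ifP => // _; rewrite subr_ge0; apply: Hf => /=; exact: ltnW.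
by case: ifP => // _; rewrite subr_le0; apply: Hf.
Qed.

Lemma sorting_perm (f : 'I_n -> int) :
  exists s : 'S_n, forall i j : 'I_n, (i <= j)%N -> f (s j) <= f (s i).
Proof.
pose t := [tuple f i | i < n].
have /tuple_permP[s Hs] : perm_eq (sort >=%O t) t by rewrite perm_sort.
exists s => i j ij.
have St : sorted >=%O (sort >=%O t) by apply: sort_sorted => a b; apply: le_total.
have := sorted_leq_nth ge_trans ge_refl 0 St; rewrite Hs => /(_ i j).
rewrite !inE size_tuple !ltn_ord => /(_ isT isT ij).
by rewrite -!tnth_nth !tnth_mktuple.
Qed.

End Orders.

(** * Chebyshev polynomials and determinants *)

Section Chebyshev.
Variable C : numClosedFieldType.

(** [cheb k] is the monic polynomial such that [x^k + x^-k] is [cheb k] at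
    [x + x^-1] for [k > 0]. *)
Fixpoint cheb (k : nat) : {poly C} :=
  match k with
  | 0 => 1
  | S k' => match k' with
            | 0 => 'X
            | S k'' => 'X * cheb k' - (if k'' == 0%N then 2%:P else cheb k'')
            end
  end.

Lemma cheb_rec k : cheb k.+2 = 'X * cheb k.+1 - (1 + (k == 0%N)%:R) *: cheb k.
Proof.
rewrite -[LHS]/('X * cheb k.+1 - (if k == 0%N then 2%:P else cheb k)).
by case: k => [|k]; rewrite ?addr0 ?scale1r // -alg_polyC.
Qed.

Lemma cheb_monic k : cheb k \is monic /\ size (cheb k) = k.+1.
Proof.
elim/ltn_ind: k => -[|[|k]] IH; first by rewrite monic1 size_poly1.
  by rewrite monicX size_polyX.
have [m1 s1] := IH k.+1 (ltnSn _); have [m0 s0] := IH k (leqnSn _).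
have sX : size ('X * cheb k.+1) = k.+3 by rewrite mulrC size_mulX ?s1 // -size_poly_eq0 s1.
pose c : C := 1 + (k == 0%N)%:R; pose p := 'X * cheb k.+1; pose q := - (c *: cheb k).
have lt : (size q < size p)%N.
  by rewrite /q /p size_polyN sX; apply: leq_ltn_trans (size_scale_leq _ _) _; rewrite s0; lia.
rewrite cheb_rec -[_ - _]/(p + q); split; last by rewrite size_polyDl // /p sX.
by rewrite monicE lead_coefDl // lead_coefM lead_coefX mul1r (monicP m1).
Qed.

Lemma cheb_eval k (x : C) : x != 0 ->
  (1 + (k == 0%N)%:R) * (cheb k).[x + x^-1] = x ^ k%:Z + x ^ (- k%:Z).
Proof.
move=> x0; have n0 j : (j.+1 == 0%N)%:R = 0 :> C by [].
elim/ltn_ind: k => -[|[|k]] IH.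
- by rewrite hornerC mulr1 oppr0.
- by rewrite hornerX n0 addr0 mul1r expr1z exprN1.
have := IH k.+1 (ltnSn _); rewrite n0 addr0 mul1r => E1.
have E0 := IH k (leqnSn _).
rewrite mul1r cheb_rec hornerD hornerN hornerM hornerX hornerZ E1 E0.
have e (a : int) : x ^ (a + 1) = x ^ a * x by rewrite expfzDr // expr1z.
have e1 (a : int) : x ^ (a - 1) = x ^ a * x^-1 by rewrite expfzDr // exprN1.
have -> : k.+2%:Z = k%:Z + 1 + 1 by lia.
have -> : k.+1%:Z = k%:Z + 1 by lia.
rewrite !opprD !e !e1; field; exact: x0.
Qed.

(** A triangular change of basis from the monomials, with determinant 1. *)
Lemma det_monic k (p : 'I_k -> {poly C}) (y : 'I_k -> C) :
  (forall i, p i \is monic /\ size (p i) = i.+1) ->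
  \det (\matrix_(i, j) (p i).[y j]) = \prod_(i < k) \prod_(j < k | (i < j)%N) (y j - y i).
Proof.
move=> Hp; pose L : 'M[C]_k := \matrix_(i, l) (p i)`_l.
have -> : \matrix_(i, j) (p i).[y j] = L *m Vandermonde k (\row_j y j).
  apply/matrixP=> i j; rewrite !mxE.
  rewrite (@horner_coef_wide _ k); last by have [_ ->] := Hp i.
  by apply: eq_bigr => l _; rewrite !mxE.
rewrite det_mulmx det_Vandermonde det_trig; last first.
  apply/is_trig_mxP=> i j ij; rewrite mxE nth_default //.
  by have [_ ->] := Hp i.
rewrite big1 ?mul1r => [|i _].
  by apply: eq_bigr => i _; apply: eq_bigr => j _; rewrite !mxE.
by have [/monicP <- si] := Hp i; rewrite mxE lead_coefE si.
Qed.

End Chebyshev.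

(** * Alternants *)

Section Alternants.
Variables (C : numClosedFieldType) (n : nat).
Notation N := (n + n)%N.
Notation W := ('S_n * {ffun 'I_n -> bool})%type.
Implicit Types (x : 'rV[C]_n) (w : W) (nu mu : 'I_n -> int) (eta : 'I_n -> nat).

(** Signed permutations appear here as pairs of a permutation and a choice of signs; only
    the permutation contributes to the sign, since the alternants are invariant
    under the inversion of one variable. *)
Definition wsign w : C := (-1) ^+ (w.1 : bool).

Definition wact w nu : 'I_n -> int :=
  fun j => let i := (w.1^-1)%g j in if w.2 i then - nu i else nu i.

Definition wpt w x : 'rV[C]_n :=
  \row_i (if w.2 i then (x 0 (w.1 i))^-1 else x 0 (w.1 i)).

Lemma wpt_nz w x : nz x -> nz (wpt w x).
Proof. by move=> x0 i; rewrite mxE; case: ifP; rewrite ?invr_eq0. Qed.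

Lemma wact_perm w nu i : wact w nu (w.1 i) = if w.2 i then - nu i else nu i.
Proof. by rewrite /wact permK. Qed.

Lemma xpow_wpt w x nu : xpow (wpt w x) nu = xpow x (wact w nu).
Proof.
rewrite /xpow [RHS](reindex_inj (@perm_inj _ w.1)); apply: eq_bigr => i _.
by rewrite mxE wact_perm; case: ifP => // _; rewrite exprz_inv.
Qed.

Definition wimg w (a : 'I_N) : 'I_N :=
  let g i := if w.2 i then rshift n (w.1 i) else lshift n (w.1 i) in
  match split a with inl i => g i | inr i => star (g i) end.

Lemma wimg_l w i : wimg w (lshift n i) = if w.2 i then rshift n (w.1 i) else lshift n (w.1 i).
Proof. by rewrite /wimg (unsplitK (inl i)). Qed.

Lemma wimg_r w i : wimg w (rshift n i) = if w.2 i then lshift n (w.1 i) else rshift n (w.1 i).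
Proof. by rewrite /wimg (unsplitK (inr i)); case: (w.2 i); rewrite ?star_l ?star_r. Qed.

Lemma wimg_inj w : injective (wimg w).
Proof.
move=> a b; elim/index_ind: a => i; elim/index_ind: b => j; rewrite ?wimg_l ?wimg_r;
case Ei: (w.2 i); case Ej: (w.2 j) => /eqP; rewrite ?eq_lshift ?eq_rshift ?eq_lrshift ?eq_rlshift //;
move=> /eqP/perm_inj E //; rewrite ?E //; by rewrite E Ej in Ei.
Qed.

Definition wperm w : {perm 'I_N} := perm (@wimg_inj w).

Lemma wperm_signed w : signed (wperm w).
Proof.
by move=> a; rewrite !permE; elim/index_ind: a => i; rewrite ?star_l ?star_r ?wimg_l ?wimg_r;
  case: (w.2 i); rewrite ?star_l ?star_r.
Qed.

Lemma sact_wperm w x : sact (wperm w) x = wpt w x.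
Proof.
apply/rowP=> i; rewrite !mxE -/(te x _) permE wimg_l.
by case: (w.2 i); rewrite ?te_l ?te_r.
Qed.

Definition alternant nu x : C := \det (\matrix_(i, j) (x 0 j ^ nu i + x 0 j ^ (- nu i))).

Lemma alternant_sum nu x : alternant nu x = \sum_(w : W) wsign w * xpow x (wact w nu).
Proof.
rewrite -(pair_bigA _ (fun s f => wsign (s, f) * xpow x (wact (s, f) nu))) /=.
apply: eq_bigr => s _; rewrite /wsign /= -mulr_sumr; congr (_ * _).
transitivity (\prod_i \sum_(b : bool) (if b then x 0 (s i) ^ (- nu i) else x 0 (s i) ^ nu i)).
  by apply: eq_bigr => i _; rewrite mxE big_bool /= addrC.
rewrite bigA_distr_bigA; apply: eq_bigr => f _; rewrite -xpow_wpt.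
by apply: eq_bigr => i _; rewrite mxE /=; case: (f i); rewrite // exprz_inv.
Qed.

Lemma alternant_wpt nu w x : alternant nu (wpt w x) = wsign w * alternant nu x.
Proof.
rewrite /alternant.
have -> : \matrix_(i, j) (wpt w x 0 j ^ nu i + wpt w x 0 j ^ (- nu i)) =
   (\matrix_(i, j) (x 0 j ^ nu i + x 0 j ^ (- nu i))) *m perm_mx (w.1)^-1.
  rewrite -col_permE; apply/matrixP=> i j; rewrite !mxE.
  by case: (w.2 j) => //; rewrite !exprz_inv opprK addrC.
by rewrite det_mulmx det_perm odd_permV mulrC.
Qed.

Lemma alternant_abs nu eta (s : 'S_n) x : (forall i, `|nu (s i)|%N = eta i) ->
  alternant nu x = (-1) ^+ s * alternant (fun i => (eta i)%:Z) x.
Proof.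
move=> H; rewrite /alternant.
have -> : \matrix_(i, j) (x 0 j ^ nu i + x 0 j ^ (- nu i)) =
   perm_mx s^-1 *m (\matrix_(i, j) (x 0 j ^ (eta i)%:Z + x 0 j ^ (- (eta i)%:Z))).
  rewrite -row_permE; apply/matrixP=> i j; rewrite !mxE.
  have := H (s^-1 i)%g; rewrite permKV => <-.
  case: (lerP 0 (nu i)) => ni; first by rewrite gez0_abs.
  by rewrite ltz0_abs // opprK addrC.
by rewrite det_mulmx det_perm odd_permV.
Qed.

(** Order of the stabilizer of [eta] in the group of sign changes. *)
Definition cstab eta : C := \prod_i (1 + (eta i == 0%N)%:R).

Lemma cstab_neq0 eta : cstab eta != 0.
Proof.
have two0 : (2 : C) != 0 by rewrite pnatr_eq0.
apply/prodf_neq0 => i _; case: (eta i == 0%N); first exact: two0.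
by rewrite addr0 oner_neq0.
Qed.

(** The alternant in the variables [ycoord], free of the factors 2 due to zero exponents. *)
Definition zdet eta x : C := \det (\matrix_(i, j) (cheb C (eta i)).[ycoord x j]).

Lemma alternant_zdet eta x : nz x ->
  alternant (fun i => (eta i)%:Z) x = cstab eta * zdet eta x.
Proof.
move=> x0; rewrite /alternant /zdet.
have -> : \matrix_(i, j) (x 0 j ^ (eta i)%:Z + x 0 j ^ (- (eta i)%:Z)) =
  diag_mx (\row_i (1 + (eta i == 0%N)%:R)) *m \matrix_(i, j) (cheb C (eta i)).[ycoord x j].
  apply/matrixP=> i j; rewrite mul_diag_mx [RHS]mxE [X in X * _]mxE [X in _ * X]mxE.
  by rewrite /ycoord cheb_eval // mxE.
rewrite det_mulmx det_diag; congr (_ * _); apply: eq_bigr => i _; by rewrite mxE.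
Qed.

(** A signed permutation that fixes an exponent with distinct nonnegative parts changes
    at most the sign of a zero part. *)
Lemma stabilizer_sum eta : injective eta ->
  \sum_(w : W) wsign w * (fun_of (wact w (fun i => (eta i)%:Z)) == fun_of (fun i => (eta i)%:Z))%:R
   = cstab eta.
Proof.
move=> ie.
have H (s : 'S_n) (f : {ffun 'I_n -> bool}) :
   wsign (s, f) * (fun_of (wact (s, f) (fun i => (eta i)%:Z)) == fun_of (fun i => (eta i)%:Z))%:R
   = (s == 1%g)%:R * \prod_i (if f i then (eta i == 0%N)%:R else 1).
  case: (eqVneq s 1%g) => [->|s1].
    rewrite /wsign odd_perm1 expr0 mul1r [RHS]mul1r.
    case: (boolP [forall i, f i ==> (eta i == 0%N)]) => [/forallP h|].
      rewrite big1 => [|i _]; last first.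
        by have := h i; case: (f i) => //= ->.
      have -> : fun_of (wact (1%g, f) (fun i => (eta i)%:Z)) = fun_of (fun i => (eta i)%:Z).
        apply/ffunP=> i; rewrite !ffunE /wact /= invg1 perm1.
        by have := h i; case: (f i) => //= /eqP->.
      by rewrite eqxx.
    rewrite negb_forall => /existsP[i]; rewrite negb_imply => /andP[fi ei].
    rewrite [RHS](bigD1 i) //= fi (negPf ei) mul0r; case: eqP => //.
    move=> /ffunP/(_ i); rewrite !ffunE /wact /= invg1 perm1 fi; lia.
  rewrite mul0r; case: eqP => [/ffunP E|_]; last by rewrite mulr0.
  case/eqP: s1; apply/permP=> i; rewrite perm1; apply: ie.
  have := E (s i); rewrite !ffunE wact_perm /=; case: (f i); lia.
rewrite -(pair_bigA _ (fun s f => wsign (s, f) *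
   (fun_of (wact (s, f) (fun i => (eta i)%:Z)) == fun_of (fun i => (eta i)%:Z))%:R)) /=.
rewrite (bigD1 1%g) //= [X in _ + X]big1 => [|s s1]; last first.
  by apply: big1 => f _; rewrite H (negPf s1) mul0r.
rewrite addr0 (eq_bigr _ (fun f _ => H 1%g f)) eqxx.
under eq_bigr => f _ do rewrite mul1r.
rewrite -(bigA_distr_bigA (fun i b => if b then (eta i == 0%N)%:R else 1)).
by apply: eq_bigr => i _; rewrite big_bool /= addrC.
Qed.

(** The half sum of the positive roots of SO(2n). *)
Definition deltaz (i : 'I_n) : nat := (n - i.+1)%N.

Lemma deltaz_inj : injective deltaz.
Proof. by move=> i j; rewrite /deltaz => E; apply: val_inj; have := ltn_ord i; have := ltn_ord j; move: E => /=; lia. Qed.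

Lemma zdet_deltaz x :
  zdet deltaz x = (-1) ^+ (perm (@rev_ord_inj n)) * \prod_(i < n) \prod_(j < n | (i < j)%N) (ycoord x j - ycoord x i).
Proof.
rewrite /zdet -(@det_monic C n (fun i => cheb C i)); last by move=> i; apply: cheb_monic.
have -> : \matrix_(i, j) (cheb C (deltaz i)).[ycoord x j] =
  perm_mx (perm (@rev_ord_inj n)) *m \matrix_(i, j) (cheb C i).[ycoord x j].
  by rewrite -row_permE; apply/matrixP=> i j; rewrite !mxE permE.
by rewrite det_mulmx det_perm.
Qed.

End Alternants.

(** * Weyl's character formula *)

Section Weyl.
Variables (C : numClosedFieldType) (n : nat).
Notation N := (n + n)%N.
Notation W := ('S_n * {ffun 'I_n -> bool})%type.
Implicit Types (x : 'rV[C]_n) (w : W).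

Definition dz (i : 'I_n) : int := (deltaz i)%:Z.

Definition radial x i : C := \sum_(j | j != i)
  ((x 0 i + x 0 j) / (x 0 i - x 0 j) + (x 0 i + (x 0 j)^-1) / (x 0 i - (x 0 j)^-1)).

(** Points where the Weyl denominator does not vanish. *)
Definition generic x := forall i j, i != j -> ycoord x i != ycoord x j.

Lemma generic_te x : nz x -> generic x ->
  forall a b, a != b -> b != star a -> te x a != te x b.
Proof.
move=> x0 gx a b ab bsa; apply/eqP=> E.
have Y (i j : 'I_n) : i != j -> te x a + (te x a)^-1 = ycoord x i ->
   te x b + (te x b)^-1 = ycoord x j -> False.
  by move=> ij E1 E2; have := gx i j ij; rewrite -E1 -E2 E eqxx.
move: ab bsa E Y; elim/index_ind: a => i; elim/index_ind: b => j;
  rewrite ?star_l ?star_r ?eq_lshift ?eq_rshift ?eq_lrshift ?eq_rlshift // ?te_l ?te_r ?invrK => ab bsa E.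
- by apply; first exact: ab.
- by apply; [by rewrite eq_sym; exact: bsa | | rewrite addrC].
- by apply; [by rewrite eq_sym; exact: bsa | rewrite addrC | ].
- by apply; [exact: ab | rewrite addrC | rewrite addrC].
Qed.

(** Only the pairs containing [i] contribute. This is the logarithmic derivative of a
    Vandermonde product in the variable [y i]. *)
Lemma pair_log_sum (y : 'I_n -> C) i (be : C) :
  \sum_(p : 'I_n * 'I_n | (p.1 < p.2)%N)
     ((p.2 == i)%:R * be - (p.1 == i)%:R * be) / (y p.2 - y p.1) =
  \sum_(j | j != i) be / (y i - y j).
Proof.
rewrite -(pair_big_dep xpredT (fun k l : 'I_n => (k < l)%N)
  (fun k l => ((l == i)%:R * be - (k == i)%:R * be) / (y l - y k))) /=.
transitivity (\sum_(k < n) \sum_(l < n | (k < l)%N) (l == i)%:R * be / (y l - y k) +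
              \sum_(k < n) \sum_(l < n | (k < l)%N) (k == i)%:R * be / (y k - y l)).
  rewrite -big_split; apply: eq_bigr => k _; rewrite -big_split; apply: eq_bigr => l _ /=.
  by rewrite mulrBl -mulrN -invrN opprB.
rewrite (exchange_big_dep xpredT) //= -big_split (bigD1 i) //= [X in _ + X]big1 => [|k ki].
  rewrite addr0 [RHS](bigID (fun j : 'I_n => (j < i)%N)) /=; congr (_ + _).
    apply: eq_big => [j|j _]; last by rewrite ?eqxx !mul1r.
    by case: (eqVneq j i) => [->|]; rewrite ?ltnn.
  apply: eq_big => [j|j _]; last by rewrite ?eqxx !mul1r.
  by rewrite ltnNge leq_eqVlt negb_or (inj_eq val_inj).
by rewrite !big1 ?addr0 // => l _; rewrite (negPf ki) !mul0r.
Qed.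

(** The derivative along the [i]-th cocharacter of the Weyl denominator, computed from its
    expansion as a sum of characters and from its factorization as a Vandermonde
    product. *)
Lemma alternant_derivative x i : nz x -> generic x ->
  2 * \sum_(w : W) wsign C w * (wact w dz i)%:~R * xpow x (wact w dz) =
  alternant dz x * radial x i.
Proof.
move=> x0 gx.
pose xc z : 'rV[C]_n := \row_j (x 0 j * cochar i z 0 j).
have xc_nz z : z != 0 -> nz (xc z).
  by move=> z0 j; rewrite mxE mulf_neq0 // cochar_nz.
pose K : C := cstab C (@deltaz n) * (-1) ^+ (perm (@rev_ord_inj n)).
have AK x' : nz x' -> alternant dz x' =
    K * \prod_(p : 'I_n * 'I_n | (p.1 < p.2)%N) (ycoord x' p.2 - ycoord x' p.1).
  move=> x0'; rewrite alternant_zdet // zdet_deltaz mulrA; congr (_ * _).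
  by rewrite (pair_big_dep xpredT (fun k l : 'I_n => (k < l)%N)).
have j1 : jet (fun z => alternant dz (xc z)) (alternant dz x)
    (\sum_(w : W) wsign C w * (wact w dz i)%:~R * xpow x (wact w dz)).
  rewrite alternant_sum.
  have J (w : W) : xpredT w -> jet (fun z => wsign C w * xpow x (wact w dz) * z ^ wact w dz i)
      (wsign C w * xpow x (wact w dz)) (wsign C w * (wact w dz i)%:~R * xpow x (wact w dz)).
    move=> _; have := jetZ (wsign C w * xpow x (wact w dz)) (jet_expz C (wact w dz i)).
    by rewrite mulr1 mulrAC.
  apply: jet_ext (jet_sum (index_enum _) J) => z z0.
  rewrite alternant_sum; apply: eq_bigr => w _.
  by rewrite /xc xpowM xpow_cochar mulrA.
pose be := x 0 i - (x 0 i)^-1.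
have jy k : jet (fun z => ycoord (xc z) k) (ycoord x k) ((k == i)%:R * be).
  case: (eqVneq k i) => [->|ki]; rewrite ?mul1r ?mul0r.
    have := jetD (jetZ (x 0 i) (jet_id C)) (jetZ (x 0 i)^-1 (jet_inv C)).
    rewrite !mulr1 mulrN1; apply: jet_ext => z z0.
    by rewrite /ycoord !mxE eqxx invfM.
  apply: jet_ext (jet_cst (ycoord x k)) => z z0.
  by rewrite /ycoord !mxE (negPf ki) mulr1.
have jp (p : 'I_n * 'I_n) : (p.1 < p.2)%N ->
   jet (fun z => ycoord (xc z) p.2 - ycoord (xc z) p.1) (ycoord x p.2 - ycoord x p.1)
     ((p.2 == i)%:R * be - (p.1 == i)%:R * be).
  by move=> _; apply: jetD => //; apply: jetN.
have np (p : 'I_n * 'I_n) : (p.1 < p.2)%N -> ycoord x p.2 - ycoord x p.1 != 0.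
  by move=> pp; rewrite subr_eq0 gx // -val_eqE gtn_eqF.
have j2 := jetZ K (jet_prod (index_enum _) np jp).
have j3 := jet_ext (fun z z0 => esym (AK _ (xc_nz z z0))) j2.
have [_ ->] := jet_uniq j1 j3.
rewrite [K * _]mulrA -AK // pair_log_sum mulrCA; congr (_ * _).
rewrite mulr_sumr; apply: eq_bigr => j ji.
have xi := x0 i; have xj := x0 j.
have yij : ycoord x i - ycoord x j != 0 by rewrite subr_eq0 gx // eq_sym.
have E : ycoord x i - ycoord x j = (x 0 i - x 0 j) * (x 0 i - (x 0 j)^-1) / x 0 i.
  by rewrite /ycoord; field; rewrite xi xj.
move: yij; rewrite {}E !mulf_eq0 !negb_or => /andP[/andP[d1 d2] _].
have d3 : x 0 i * x 0 j - 1 != 0.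
  by apply: contraNneq d2 => E; rewrite -(mulfK xj (x 0 i)) -[X in _ - X]mul1r -mulrBl E mul0r.
rewrite /be; field.
by rewrite xi xj d1 d3.
Qed.

Section Formula.
Variables (lam : 'I_n -> nat) (m : nat) (wt : 'I_m -> 'I_n -> int) (j0 : 'I_m) (c : C).
Hypothesis lam_mono : forall i j : 'I_n, (i <= j)%N -> (lam j <= lam i)%N.
Hypothesis wt_inv : forall s x, signed s -> nz x ->
  \sum_j xpow (sact s x) (wt j) = \sum_j xpow x (wt j).
Hypothesis wt_j0 : wt j0 =1 lamz lam.
Hypothesis wt_below : forall j, j != j0 -> below (lamz lam) (wt j).
Hypothesis wt_radial : forall x, nz x -> (forall a b, a != b -> b != star a -> te x a != te x b) ->
  c * \sum_j xpow x (wt j) = \sum_j (\sum_i (wt j i)%:~R ^+ 2) * xpow x (wt j) +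
    \sum_i (\sum_j (wt j i)%:~R * xpow x (wt j)) * radial x i.

Local Notation chi x := (\sum_j xpow x (wt j)).
Let eta (i : 'I_n) : nat := (lam i + deltaz i)%N.
Let ez (i : 'I_n) : int := (eta i)%:Z.

Lemma eta_inj : injective eta.
Proof.
move=> i j; rewrite /eta /deltaz => E; apply/val_inj => /=.
have := ltn_ord i; have := ltn_ord j.
case: (ltngtP i j) => // ij; have := lam_mono (ltnW ij); move: E ij => /=; lia.
Qed.

Lemma pre_wt j t : (t <= n)%N -> pre t (wt j) <= pre t (lamz lam).
Proof.
move=> tn; case: (eqVneq j j0) => [->|/wt_below/andP[/forallP H _]].
  by rewrite (eq_pre t wt_j0).
by have tn1 : (t < n.+1)%N by []; have := H (Ordinal tn1).
Qed.

(** The multiset of weights is invariant under signed permutations, so the conjugate of a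
    weight is a weight; independence of characters turns the invariance of the character
    into this statement. *)
Lemma pre_wact_wt j w t : (t <= n)%N -> pre t (wact w (wt j)) <= pre t (lamz lam).
Proof.
move=> tn.
pose H (f : {ffun 'I_n -> int}) : C := (pre t (lamz lam) < pre t f)%R%:R.
have H0 k : H (fun_of (wt k)) = 0.
  rewrite /H (_ : pre t (fun_of (wt k)) = pre t (wt k)); last by apply: eq_pre => i; rewrite ffunE.
  by rewrite ltNge pre_wt.
have E x : nz x -> \sum_k 1 * xpow x (wact w (wt k)) = \sum_k 1 * xpow x (wt k).
  move=> x0; rewrite -!mulr_sumr -(wt_inv (wperm_signed w) x0).
  congr (_ * _); apply: eq_bigr => k _.
  by rewrite sact_wperm xpow_wpt.
have := xpow_indep H E; rewrite [RHS]big1 => [S0|k _]; last by rewrite H0 mulr0.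
have /psumr_eq0P S1 : forall k : 'I_m, xpredT k -> 0 <= 1 * H (fun_of (wact w (wt k))).
  by move=> k _; rewrite mul1r ler0n.
have := S1 S0 j isT; rewrite mul1r /H => /eqP; rewrite pnatr_eq0 eqb0 -leNgt.
by rewrite (_ : pre t (fun_of _) = pre t (wact w (wt j))) //; apply: eq_pre => i; rewrite ffunE.
Qed.

Lemma dz_mono (i j : 'I_n) : (i <= j)%N -> dz j <= dz i.
Proof. by rewrite /dz /deltaz; lia. Qed.

Lemma pre_abs_dz w (s : 'S_n) t : pre t (fun i => `|wact w dz (s i)|) <= pre t dz.
Proof.
have -> : pre t (fun i => `|wact w dz (s i)|) = pre t (fun i => dz ((s * w.1^-1)%g i)).
  apply: eq_pre => i; rewrite permM /wact; case: ifP => _; rewrite ?normrN;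
  by rewrite ger0_norm // /dz.
exact: perm_prefix dz_mono.
Qed.

Lemma pre_abs_wt j (s : 'S_n) t : (t <= n)%N ->
  pre t (fun i => `|wt j (s i)|) <= pre t (lamz lam).
Proof.
move=> tn; pose w : W := (s^-1%g, [ffun i => wt j i < 0]).
have -> : pre t (fun i => `|wt j (s i)|) = pre t (wact w (wt j)).
  apply: eq_pre => i; rewrite /wact /= invgK ffunE.
  by case: ltrP => h; [rewrite ltr0_norm | rewrite ger0_norm].
exact: pre_wact_wt.
Qed.

Notation K := ('I_m * W)%type.
Let nuk (k : K) : 'I_n -> int := fun i => wt k.1 i + wact k.2 dz i.
Let bk (k : K) : C := wsign C k.2.
Let nrm (f : 'I_n -> int) : C := \sum_i (f i)%:~R ^+ 2.

Lemma chi_alternant x : nz x ->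
  chi x * alternant dz x = \sum_(k : K) bk k * xpow x (nuk k).
Proof.
move=> x0; rewrite alternant_sum mulr_suml.
rewrite -(pair_bigA _ (fun j w => wsign C w * xpow x (fun i => wt j i + wact w dz i))) /=.
apply: eq_bigr => j _; rewrite mulr_sumr; apply: eq_bigr => w _.
by rewrite xpowD // mulrCA.
Qed.

(** The eigenvalue of the Laplacian on the product of the character and the Weyl denominator. *)
Let kap : C := c + nrm dz.

(** The product of the character and the Weyl denominator is an eigenvector of the Laplacian:
    by the product rule its Laplacian has three terms, and the mixed one is the
    first-order term of the radial equation by [alternant_derivative]. *)
Lemma eigen_generic x : nz x -> generic x ->
  \sum_(k : K) (bk k * (nrm (nuk k) - kap)) * xpow x (nuk k) = 0.
Proof.
move=> x0 gx.
have nw w : nrm (wact w dz) = nrm dz.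
  rewrite /nrm (reindex_inj (@perm_inj _ w.1)); apply: eq_bigr => i _.
  by rewrite wact_perm; case: ifP => // _; rewrite intrN sqrrN.
pose D i := \sum_(w : W) wsign C w * (wact w dz i)%:~R * xpow x (wact w dz).
have E1 : \sum_(k : K) (bk k * (nrm (nuk k) - kap)) * xpow x (nuk k) =
  (\sum_j nrm (wt j) * xpow x (wt j)) * alternant dz x
  + \sum_i (\sum_j (wt j i)%:~R * xpow x (wt j)) * (2 * D i)
  - c * chi x * alternant dz x.
  rewrite -(pair_bigA _ (fun j w => wsign C w * (nrm (fun i => wt j i + wact w dz i) - kap) *
     xpow x (fun i => wt j i + wact w dz i))) /=.
  have -> : \sum_i (\sum_j (wt j i)%:~R * xpow x (wt j)) * (2 * D i) =
     \sum_j \sum_(w : W) \sum_i ((wt j i)%:~R * xpow x (wt j)) *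
       (2 * (wsign C w * (wact w dz i)%:~R * xpow x (wact w dz))).
    rewrite exchange_big /= (eq_bigr (fun i => \sum_j \sum_(w : W) ((wt j i)%:~R * xpow x (wt j)) *
       (2 * (wsign C w * (wact w dz i)%:~R * xpow x (wact w dz))))); last first.
      move=> i _; rewrite mulr_suml; apply: eq_bigr => j _.
      by rewrite /D !mulr_sumr.
    rewrite exchange_big /= [RHS]exchange_big; apply: eq_bigr => j _ /=.
    by rewrite exchange_big.
  rewrite alternant_sum mulr_suml [c * chi x]mulr_sumr [X in _ - X]mulr_suml.
  rewrite -big_split -sumrB; apply: eq_bigr => j _ /=.
  rewrite !mulr_sumr -big_split -sumrB; apply: eq_bigr => w _ /=.
  rewrite xpowD //.
  have -> : \sum_i ((wt j i)%:~R * xpow x (wt j)) * (2 * (wsign C w * (wact w dz i)%:~R * xpow x (wact w dz)))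
     = (wsign C w * xpow x (wt j) * xpow x (wact w dz)) * \sum_i 2 * ((wt j i)%:~R * (wact w dz i)%:~R).
    by rewrite mulr_sumr; apply: eq_bigr => i _; ring.
  have -> : nrm (fun i => wt j i + wact w dz i) =
     nrm (wt j) + \sum_i 2 * ((wt j i)%:~R * (wact w dz i)%:~R) + nrm dz.
    rewrite -(nw w) /nrm -!big_split; apply: eq_bigr => i _ /=.
    by rewrite intrD; ring.
  rewrite /kap; set s := \sum_i _; set p := xpow x (wt j); set q := xpow x _; set e := wsign C w.
  by set u := nrm (wt j); set d := nrm dz; ring.
rewrite E1.
have E2 : \sum_i (\sum_j (wt j i)%:~R * xpow x (wt j)) * (2 * D i) =
   (\sum_i (\sum_j (wt j i)%:~R * xpow x (wt j)) * radial x i) * alternant dz x.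
  rewrite mulr_suml; apply: eq_bigr => i _.
  by rewrite alternant_derivative // mulrA mulrAC.
rewrite E2 -mulrDl -wt_radial //; last exact: generic_te.
by rewrite subrr.
Qed.

Lemma eigen x : nz x -> \sum_(k : K) (bk k * (nrm (nuk k) - kap)) * xpow x (nuk k) = 0.
Proof.
move: x; apply: (@regular_density C n (fun x => \sum_(k : K) (bk k * (nrm (nuk k) - kap)) * xpow x (nuk k))).
  apply: (@regular_sum C n K (index_enum _) xpredT (fun k x => (bk k * (nrm (nuk k) - kap)) * xpow x (nuk k))) => k _.
  apply: (@regularM C n (fun=> _) (fun x => xpow x (nuk k))); [exact: regular_cst | exact: regular_xpow].
by move=> x x0 gx; apply: eigen_generic.
Qed.

Lemma eigen_transport (H : {ffun 'I_n -> int} -> C) :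
  \sum_(k : K) (bk k * (nrm (nuk k) - kap)) * H (fun_of (nuk k)) = 0.
Proof.
have E x : nz x -> \sum_(k : K) (bk k * (nrm (nuk k) - kap)) * xpow x (nuk k) =
   \sum_(l : 'I_0) 0 * xpow x dz by move=> x0; rewrite eigen // big_ord0.
by have := xpow_indep (mu := fun=> dz) H E => ->; rewrite big_ord0.
Qed.

(** Only the highest weight and the trivial Weyl element (up to the stabilizer)
    contribute to the leading exponent [ez]. *)
Lemma leading_sum (h : K -> C) :
  \sum_(k : K) h k * (fun_of (nuk k) == fun_of ez)%:R =
  \sum_(w : W) h (j0, w) * (fun_of (wact w dz) == fun_of dz)%:R.
Proof.
rewrite (eq_bigr (fun k => h (k.1, k.2) * (fun_of (nuk (k.1, k.2)) == fun_of ez)%:R)) => [|[] //].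
rewrite -(pair_bigA _ (fun j w => h (j, w) * (fun_of (nuk (j, w)) == fun_of ez)%:R)) /=.
rewrite (bigD1 j0) //= [X in _ + X]big1 => [|j jj].
  rewrite addr0; apply: eq_bigr => w _; congr (_ * (_ : bool)%:R).
  apply/eqP/eqP => /ffunP E; apply/ffunP=> i; have := E i; rewrite !ffunE /nuk /=;
    rewrite wt_j0 /ez /eta /lamz /dz; lia.
apply: big1 => w _; case: eqP => [/ffunP E|_]; last by rewrite mulr0.
exfalso; have /andP[/forallP H /existsP[i ni]] := wt_below jj.
have P (t : 'I_n.+1) : pre t (wt j) = pre t (lamz lam).
  have e1 : pre t (wt j) + pre t (wact w dz) = pre t (lamz lam) + pre t dz.
    rewrite -!preD; apply: eq_pre => k; have := E k.
    by rewrite !ffunE /nuk /ez /eta /lamz /dz /=; lia.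
  have e2 : pre t (wact w dz) <= pre t dz.
    apply: le_trans (pre_abs_dz w 1%g t); apply: ler_sum => k _; rewrite perm1; exact: ler_norm.
  have := H t; lia.
have preS (f : 'I_n -> int) : pre i.+1 f = pre i f + f i.
  rewrite /pre (bigD1 i) //= addrC; congr (_ + _); apply: eq_bigl => k.
  by rewrite -val_eqE /=; lia.
have li : (i < n.+1)%N by apply: ltnW; rewrite ltnS.
have Si : (i.+1 < n.+1)%N by rewrite ltnS.
have := P (Ordinal li); have := P (Ordinal Si); rewrite /= !preS => e1 e2.
by move: ni; rewrite -subr_eq0; lia.
Qed.

(** The coefficient of the leading exponent is nonzero by [leading_sum]. *)
Lemma kap_norm : kap = nrm ez.
Proof.
have := eigen_transport (fun f => (f == fun_of ez)%:R).
have -> : \sum_(k : K) (bk k * (nrm (nuk k) - kap)) * (fun_of (nuk k) == fun_of ez)%:R =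
  \sum_(k : K) (bk k * (nrm ez - kap)) * (fun_of (nuk k) == fun_of ez)%:R.
  apply: eq_bigr => k _; case: eqP => [/ffunP E|_]; last by rewrite !mulr0.
  congr (_ * (_ - _) * _); apply: eq_bigr => i _.
  by have := E i; rewrite !ffunE => ->.
rewrite (leading_sum (fun k => bk k * (nrm ez - kap))).
rewrite (eq_bigr (fun w => (nrm ez - kap) * (wsign C w * (fun_of (wact w dz) == fun_of dz)%:R))).
  rewrite -mulr_sumr stabilizer_sum; last exact: deltaz_inj.
  move/eqP; rewrite mulf_eq0 (negPf (cstab_neq0 _ _)) orbF subr_eq0 => /eqP//.
by move=> w _; rewrite /bk [RHS]mulrA; congr (_ * _); apply: mulrC.
Qed.

(** The absolute values of the exponent, sorted, are dominated by [ez] and have the same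
    norm, so [dominated_norm] applies. *)
Lemma nuk_abs_perm k : nrm (nuk k) = kap -> exists s : 'S_n, forall i, `|nuk k (s i)|%N = eta i.
Proof.
rewrite kap_norm => E.
have [s Hs] := sorting_perm (fun i => `|nuk k i|).
exists s => i.
have H : (fun i => `|nuk k (s i)|) =1 ez.
  apply: dominated_norm => // [t tn|].
    have -> : pre t ez = pre t (lamz lam) + pre t dz.
      by rewrite -preD; apply: eq_pre => l; rewrite /ez /eta /lamz /dz; lia.
    apply: le_trans (lerD (pre_abs_wt k.1 s tn) (pre_abs_dz k.2 s t)).
    by rewrite -preD; apply: ler_sum => l _; apply: ler_normD.
  have -> : \sum_i `|nuk k (s i)| ^+ 2 = \sum_i `|nuk k i| ^+ 2.
    by rewrite [RHS](reindex_inj (@perm_inj _ s)).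
  apply/eqP; rewrite -(eqr_int C) !rmorph_sum /=; apply/eqP.
  rewrite (eq_bigr (fun i => (nuk k i)%:~R ^+ 2)) => [|l _].
    by rewrite -/(nrm (nuk k)) E; apply: eq_bigr => l _; rewrite rmorphXn.
  by rewrite real_normK ?num_real // rmorphXn.
by have /= := H i; rewrite -abszE => -[].
Qed.

(** The product of the character and the Weyl denominator is antisymmetrized. The terms
    whose exponent has the wrong norm drop out, the others are multiples of one
    alternant, and the coefficient of the leading exponent gives the factor. *)
Theorem weyl_character x : nz x -> chi x * zdet (@deltaz n) x = zdet eta x.
Proof.
have cw : #|{: W}|%:R != 0 :> C.
  by rewrite pnatr_eq0 -lt0n; apply/card_gt0P; exists (1%g, [ffun=> false]).
(* The product is antisymmetric, so summing its images with signs multiplies it by the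
   order of the group and turns each exponent into an alternant. *)
have anti x' : nz x' -> #|{: W}|%:R * (chi x' * alternant dz x') = \sum_(k : K) bk k * alternant (nuk k) x'.
  move=> x0.
  have E w : wsign C w * (chi (wpt w x') * alternant dz (wpt w x')) = chi x' * alternant dz x'.
    rewrite alternant_wpt -(wt_inv (wperm_signed w) x0).
    under [in RHS]eq_bigr => j _ do rewrite sact_wperm.
    by rewrite mulrCA; congr (_ * _); rewrite mulrA -expr2 /wsign sqrr_sign mul1r.
  transitivity (\sum_(w : W) wsign C w * (chi (wpt w x') * alternant dz (wpt w x'))).
    by rewrite (eq_bigr _ (fun w _ => E w)) sumr_const mulr_natl.
  rewrite (eq_bigr (fun w => \sum_(k : K) bk k * (wsign C w * xpow x' (wact w (nuk k))))) => [|w _].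
    rewrite exchange_big; apply: eq_bigr => k _ /=.
    by rewrite -mulr_sumr -alternant_sum.
  rewrite chi_alternant; last exact: wpt_nz.
  rewrite mulr_sumr; apply: eq_bigr => k _.
  by rewrite xpow_wpt mulrCA.
have sgn k : exists e : C, forall x', nrm (nuk k) == kap -> alternant (nuk k) x' = e * alternant ez x'.
  case: (eqVneq (nrm (nuk k)) kap) => [/nuk_abs_perm[s Hs]|]; last by exists 0.
  by exists ((-1) ^+ s) => x' _; apply: alternant_abs.
have [e He] := fin_all_exists sgn.
pose C1 : C := \sum_(k | nrm (nuk k) == kap) bk k * e k.
have prop x' : nz x' -> \sum_(k : K) bk k * alternant (nuk k) x' = C1 * alternant ez x'.
  move=> x0; rewrite (bigID (fun k => nrm (nuk k) == kap)) /=.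
  rewrite [X in _ + X](_ : _ = 0); last first.
    have := eigen_transport (fun f => if nrm f == kap then 0 else alternant f x' / (nrm f - kap)).
    move=> H; rewrite -[RHS]H [RHS](bigID (fun k => nrm (nuk k) == kap)) /=.
    have nE k : nrm (fun_of (nuk k)) = nrm (nuk k).
      by apply: eq_bigr => i _; rewrite ffunE.
    rewrite [X in _ = X + _]big1 ?add0r => [|k Hk]; last by rewrite nE Hk mulr0.
    apply: eq_bigr => k Hk; rewrite nE (negPf Hk).
    have -> : alternant (fun_of (nuk k)) x' = alternant (nuk k) x'.
      by congr (\det _); apply/matrixP=> a b; rewrite !mxE ffunE.
    rewrite -mulrA; congr (_ * _); rewrite mulrCA mulfV ?mulr1 // subr_eq0 //.
  rewrite addr0 /C1 mulr_suml; apply: eq_bigr => k Hk.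
  by rewrite (He k x' Hk) mulrA.
have E1 x' : nz x' -> #|{: W}|%:R * (chi x' * alternant dz x') = C1 * alternant ez x'.
  by move=> x0; rewrite anti // prop.
have C1E : #|{: W}|%:R * cstab C (@deltaz n) = C1 * cstab C eta.
  have E2 x' : nz x' -> \sum_(k : K) (#|{: W}|%:R * bk k) * xpow x' (nuk k) =
     \sum_(w : W) (C1 * wsign C w) * xpow x' (wact w ez).
    move=> x0; under eq_bigr => k _ do rewrite -mulrA.
    rewrite -mulr_sumr -chi_alternant // E1 // alternant_sum mulr_sumr.
    by apply: eq_bigr => w _; rewrite mulrA.
  have := xpow_indep (fun f => (f == fun_of ez)%:R) E2.
  rewrite (leading_sum (fun k => #|{: W}|%:R * bk k)).
  under eq_bigr => w _ do rewrite -mulrA.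
  rewrite -mulr_sumr stabilizer_sum; last exact: deltaz_inj.
  under [in RHS]eq_bigr => w _ do rewrite -mulrA.
  by rewrite -mulr_sumr stabilizer_sum //; apply: eta_inj.
move=> x0; have := E1 x x0; rewrite !alternant_zdet // => E2.
have cc : #|{: W}|%:R * cstab C (@deltaz n) != 0 by rewrite mulf_neq0 ?cstab_neq0.
apply: (mulfI cc); rewrite {2}C1E -[RHS]mulrA -E2.
by rewrite -mulrA; congr (_ * _); apply: mulrCA.
Qed.

End Formula.
End Weyl.

(** * A dual Cauchy identity *)

Section DualCauchy.
Variable C : numClosedFieldType.

(** Pairs of distinct rows: [T l k] refers to row [l] and to the [k]-th of the other rows,
    so the pair [k < l] occurs once as [(l, k)] and once as [(k, l - 1)]. *)
Lemma sum_triangle (T : nat -> nat -> C) m :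
  \sum_(l < m.+1) \sum_(k < m) T l k = \sum_(l < m.+1) \sum_(k < l) (T l k + T k l.-1).
Proof.
elim: m => [|m IH]; first by rewrite !big_ord1 !big_ord0.
rewrite big_ord_recr [RHS]big_ord_recr /= -IH big_split /=.
under eq_bigr => l _ do rewrite big_ord_recr /=.
by rewrite big_split /= -!addrA; congr (_ + _); rewrite addrC.
Qed.

Definition vdm (g : nat -> C) m := \prod_(i < m) \prod_(j < m | (i < j)%N) (g j - g i).

Lemma vdmS g m : vdm g m.+1 = vdm g m * \prod_(i < m) (g m - g i).
Proof.
rewrite /vdm big_ord_recr /= [X in _ * X]big1 ?mulr1 => [|j]; last first.
  by rewrite ltnNge -ltnS ltn_ord.
rewrite -big_split; apply: eq_bigr => i _ /=.
rewrite big_mkcond big_ord_recr /= ltn_ord -big_mkcond /=.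
by [].
Qed.

(** The alternant with exponents [0, ..., n + 1] except [k] and [l], for [k < l]. *)
Definition gapdet n (y : 'I_n -> C) l k : C :=
  \det (\matrix_(i < n, j < n) (cheb C (bump l (bump k i))).[y j]).

Lemma gapdet_swap n (y : 'I_n -> C) l k : (l <= k)%N -> gapdet y l k = gapdet y k.+1 l.
Proof.
move=> lk; congr (\det _); apply/matrixP=> i j; rewrite !mxE.
by rewrite bumpC [bump l k]/bump lk add1n /unbump ltnNge lk subn0.
Qed.

(** The points [y] followed by [Y1] and [Y2], indexed by all of [nat] as [vdm] requires. *)
Definition pts n (y : 'I_n -> C) (Y1 Y2 : C) (k : nat) : C :=
  if insub k is Some i then y i else if k == n then Y1 else Y2.

Lemma pts_ord n (y : 'I_n -> C) Y1 Y2 (j : 'I_n) : pts y Y1 Y2 j = y j.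
Proof. by rewrite /pts valK. Qed.

Lemma pts_n n (y : 'I_n -> C) Y1 Y2 : pts y Y1 Y2 n = Y1.
Proof. by rewrite /pts insubF ?ltnn // eqxx. Qed.

Lemma pts_nS n (y : 'I_n -> C) Y1 Y2 : pts y Y1 Y2 n.+1 = Y2.
Proof.
rewrite /pts insubF; last by rewrite ltnNge leqnSn.
by rewrite gtn_eqF.
Qed.

(** The columns of [Y2] and [Y1] are expanded one after the other, and the two terms
    with the same pair of rows are collected. *)
Lemma vandermonde_laplace n (y : 'I_n -> C) (Y1 Y2 : C) :
  vdm (pts y Y1 Y2) n.+2 =
  \sum_(l < n.+2) \sum_(k < l) (-1) ^+ (l + k) *
    ((cheb C l).[Y1] * (cheb C k).[Y2] - (cheb C l).[Y2] * (cheb C k).[Y1]) * gapdet y l k.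
Proof.
have p1 := pts_n y Y1 Y2; have p2 := pts_nS y Y1 Y2; have py := pts_ord y Y1 Y2.
have bm m j : (j < m)%N -> bump m j = j by move=> jm; rewrite /bump leqNgt jm.
rewrite /vdm -(@det_monic C n.+2 (fun i => cheb C i) (fun j => pts y Y1 Y2 j)); last by move=> i; apply: cheb_monic.
rewrite (expand_det_col _ ord_max).
pose T l k := (-1) ^+ (l + k).+1 * ((cheb C l).[Y2] * (cheb C (bump l k)).[Y1]) * gapdet y l k.
transitivity (\sum_(l < n.+2) \sum_(k < n.+1) T l k).
  apply: eq_bigr => l _; rewrite mxE /= p2 /cofactor /=.
  rewrite (expand_det_col _ ord_max) !mulr_sumr; apply: eq_bigr => k _.
  rewrite !mxE /= [bump n.+1 n]bm // p1 /cofactor /=.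
  have -> : row' k (col' ord_max (row' l (col' ord_max (\matrix_(i, j) (cheb C i).[pts y Y1 Y2 j])))) =
     \matrix_(i < n, j < n) (cheb C (bump l (bump k i))).[y j].
    apply/matrixP=> i j; rewrite !mxE /= -(py j); congr (_.[pts _ _ _ _]).
    by rewrite !bm // ltnS ltnW.
  rewrite -/(gapdet y l k) /T.
  have -> : (-1) ^+ (l + k).+1 = (-1) ^+ (l + n.+1) * (-1) ^+ (k + n) :> C.
    rewrite -exprD -signr_odd -[in RHS]signr_odd; congr (_ ^+ nat_of_bool _).
    by rewrite !oddD /= !oddD; case: (odd l); case: (odd k); case: (odd n).
  by ring.
rewrite sum_triangle; apply: eq_bigr => l _; apply: eq_bigr => k _.
have kl := ltn_ord k; have lE : (l.-1).+1 = l by lia.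
rewrite /T [gapdet y k l.-1]gapdet_swap ?lE; last by lia.
have -> : bump l k = k by rewrite /bump leqNgt kl.
have -> : bump k l.-1 = l by rewrite /bump; lia.
have -> : (k + l.-1).+1 = (l + k)%N by lia.
rewrite exprS; ring.
Qed.

(** The pair of rows is reindexed as [l = n + 1 - p], [k = n - p - q]. *)
Lemma dual_cauchy n (y : 'I_n -> C) (Y1 Y2 : C) :
  (Y1 - Y2) * (\prod_i ((y i - Y1) * (y i - Y2)) *
     \prod_(i < n) \prod_(j < n | (i < j)%N) (y j - y i)) =
  \sum_(0 <= p < n.+1) \sum_(0 <= q < (n - p).+1) (-1) ^+ q *
    ((cheb C (n.+1 - p)).[Y1] * (cheb C (n - p - q)).[Y2] -
     (cheb C (n - p - q)).[Y1] * (cheb C (n.+1 - p)).[Y2]) *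
    gapdet y (n.+1 - p) (n - p - q).
Proof.
have p1 := pts_n y Y1 Y2; have p2 := pts_nS y Y1 Y2; have py := pts_ord y Y1 Y2.
have V : vdm (pts y Y1 Y2) n.+2 = - ((Y1 - Y2) * (\prod_i ((y i - Y1) * (y i - Y2)) *
     \prod_(i < n) \prod_(j < n | (i < j)%N) (y j - y i))).
  rewrite !vdmS big_ord_recr /= p1 p2.
  have -> : \prod_i ((y i - Y1) * (y i - Y2)) =
     (\prod_(i < n) (Y1 - pts y Y1 Y2 i)) * (\prod_(i < n) (Y2 - pts y Y1 Y2 i)).
    by rewrite -big_split; apply: eq_bigr => i _ /=; rewrite py -mulrNN !opprB.
  have -> : vdm (pts y Y1 Y2) n = \prod_(i < n) \prod_(j < n | (i < j)%N) (y j - y i).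
    by apply: eq_bigr => i _; apply: eq_bigr => j _; rewrite !py.
  set a := \prod_(i < n) \prod_(j < n | _) _; set b := \prod_(i < n) _; set d := \prod_(i < n) _.
  by ring.
apply: oppr_inj; rewrite -V vandermonde_laplace big_ord_recl big_ord0 add0r -sumrN.
rewrite big_nat_rev /= add0n big_mkord; apply: eq_bigr => l _.
rewrite [bump 0 l]/bump leq0n add1n -sumrN.
have ln := ltn_ord l.
have -> : (n.+1 - (n.+1 - l.+1) = l.+1)%N by lia.
have -> : (n - (n.+1 - l.+1) = l)%N by lia.
rewrite [in RHS]big_nat_rev /= add0n big_mkord; apply: eq_bigr => k _.
have kl := ltn_ord k.
have -> : (l - (l.+1 - k.+1) = k)%N by lia.
have -> : (-1) ^+ (l.+1 + k) = - (-1) ^+ (l.+1 - k.+1) :> C.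
  have -> : (l.+1 + k = (l.+1 - k.+1) + k.*2.+1)%N by lia.
  by rewrite exprD -[(-1) ^+ k.*2.+1]signr_odd /= odd_double expr1 mulrN1.
by ring.
Qed.

End DualCauchy.

(** * The coefficients psi *)

Local Arguments Sseq : simpl never.

(** [f] stands for [Rpsh] below, [u] and [v] for the values of [cheb] at [Y1] and [Y2], the
    [p_i] for the coefficients [Sp]. With abstract sequences, rewriting by the recurrences
    never unfolds a definition. *)
Lemma initial_values (C : numClosedFieldType) (a Y1 Y2 : C) (f u v : nat -> C) (p0 p1 p2 p3 p4 p5 : C) :
  let a1 := - a * (Y1 + Y2) in let a0 := a * (Y1 * Y2 + 2) in
  (forall i, (i < 5)%N -> f i = 0) -> f 5 = 1 ->
  (forall i, f i.+4.+2 = (a0 - a) * f i.+4.+1 + (a0 * a - a1 ^+ 2) * f i.+4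
    + (a1 ^+ 2 * a - a0 * a ^+ 2) * f i.+3 + (a ^+ 4 - a0 * a ^+ 3) * f i.+2 + a ^+ 5 * f i.+1) ->
  p0 = a -> p1 = a0 * a - a1 ^+ 2 -> p2 = a1 ^+ 2 * a - 2 * a ^+ 3 ->
  p3 = - a0 * a ^+ 3 - a ^+ 4 -> p4 = a ^+ 5 ->
  u 0%N = 1 -> u 1%N = Y1 -> u 2%N = Y1 * Y1 - 2 -> (forall k, u k.+3 = Y1 * u k.+2 - u k.+1) ->
  v 0%N = 1 -> v 1%N = Y2 -> v 2%N = Y2 * Y2 - 2 -> (forall k, v k.+3 = Y2 * v k.+2 - v k.+1) ->
  forall k, (k < 6)%N -> (Y1 - Y2) * (f k.+4.+1 + (f k.+4 * p0 + (f k.+3 * p1 + (f k.+2 * p2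
    + (f k.+1 * p3 + f k * p4))))) = a ^+ k * (u k.+1 * v k - u k * v k.+1).
Proof.
move=> a1 a0 f0 f5 fS -> -> -> -> -> u0 u1 u2 uS v0 v1 v2 vS.
have E0 := f0 0%N isT; have E1 := f0 1%N isT; have E2 := f0 2%N isT.
have E3 := f0 3%N isT; have E4 := f0 4%N isT.
have E6 : f 6 = a * (Y1 * Y2 + 1).
  by rewrite fS f5 E4 E3 E2 E1 /a0 /a1; ring.
have E7 : f 7 = a ^+ 2 * (Y1 ^+ 2 * Y2 ^+ 2 + Y1 * Y2 - Y1 ^+ 2 - Y2 ^+ 2 + 3).
  by rewrite fS E6 f5 E4 E3 E2 /a0 /a1; ring.
have E8 := fS 2%N; have E9 := fS 3%N; have E10 := fS 4%N.
rewrite E7 E6 f5 E4 E3 in E8; rewrite E8 E7 E6 f5 E4 in E9; rewrite E9 E8 E7 E6 f5 in E10.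
case=> [|[|[|[|[|[|//]]]]]] _; rewrite ?uS ?vS ?u2 ?v2 ?u1 ?v1 ?u0 ?v0.
- by rewrite f5 E4 E3 E2 E1 E0; ring.
- by rewrite E6 f5 E4 E3 E2 E1 /a0 /a1; ring.
- by rewrite E7 E6 f5 E4 E3 E2 /a0 /a1; ring.
- by rewrite E8 E7 E6 f5 E4 E3 /a0 /a1; ring.
- by rewrite E9 E8 E7 E6 f5 E4 /a0 /a1; ring.
- by rewrite E10 E9 E8 E7 E6 f5 /a0 /a1; ring.
Qed.

(** The products [(- a) ^+ q * e1 q] and [(- a) ^+ q * e2 q] satisfy recurrences of order two
    with characteristic polynomials t^2 + a Y_i t + a^2; the product of the two is the
    characteristic polynomial of [Qseq]. So both sides satisfy the recurrence of [f],
    and four initial values are compared. *)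
Lemma Q_combination (C : numClosedFieldType) (a Y1 Y2 A1 A2 P1 P2 w1 w2 : C) (e1 e2 f : nat -> C) :
  let a1 := - a * (Y1 + Y2) in let a0 := a * (Y1 * Y2 + 2) in
  P1 * w2 = P2 * w1 ->
  e1 0%N = A1 -> e1 1%N = Y1 * A1 - P1 -> (forall k, e1 k.+2 = Y1 * e1 k.+1 - e1 k) ->
  e2 0%N = A2 -> e2 1%N = Y2 * A2 - P2 -> (forall k, e2 k.+2 = Y2 * e2 k.+1 - e2 k) ->
  f 0%N = 0 -> f 1%N = 0 -> f 2%N = 0 -> f 3%N = 1 ->
  (forall i, f i.+4 = a1 * f i.+3 - a0 * a * f i.+2 + a1 * a ^+ 2 * f i.+1 - a ^+ 4 * f i) ->
  forall q, (- a) ^+ q * (e1 q * w2 - e2 q * w1) = (A1 * w2 - A2 * w1) * f q.+3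
    + a * (Y2 * A1 * w2 - Y1 * A2 * w1) * f q.+2
    + a ^+ 2 * (A1 * w2 - A2 * w1 - (Y1 - Y2) * (P1 * w2)) * f q.+1.
Proof.
move=> a1 a0 Pw e10 e11 e1S e20 e21 e2S f0 f1 f2 f3 fS.
have f4 : f 4 = a1 by rewrite fS f0 f1 f2 f3; ring.
have f5 : f 5 = a1 ^+ 2 - a0 * a by rewrite fS f4 f1 f2 f3; ring.
have f6 : f 6 = a1 ^+ 3 - 2 * a0 * a1 * a + a1 * a ^+ 2 by rewrite fS f5 f4 f2 f3; ring.
have base : forall q, (q < 4)%N -> (- a) ^+ q * (e1 q * w2 - e2 q * w1) = (A1 * w2 - A2 * w1) * f q.+3
    + a * (Y2 * A1 * w2 - Y1 * A2 * w1) * f q.+2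
    + a ^+ 2 * (A1 * w2 - A2 * w1 - (Y1 - Y2) * (P1 * w2)) * f q.+1.
  have Pw' : P2 * w1 = P1 * w2 by [].
  have split (x y u v : C) : (x - P1 * u) * w2 - (y - P2 * v) * w1 = x * w2 - y * w1 - P1 * w2 * (u - v).
    have -> : (y - P2 * v) * w1 = y * w1 - P2 * w1 * v by ring.
    by rewrite Pw'; ring.
  case=> [|[|[|[|//]]]] _; rewrite ?e1S ?e2S ?e11 ?e21 ?e10 ?e20 ?f6 ?f5 ?f4 ?f3 ?f2 ?f1.
  - by ring.
  - have -> : (Y1 * A1 - P1) * w2 - (Y2 * A2 - P2) * w1 = Y1 * A1 * w2 - Y2 * A2 * w1.
      by rewrite -[P1]mulr1 -[P2]mulr1 split subrr mulr0 subr0.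
    by rewrite /a1; ring.
  - have -> : (Y1 * (Y1 * A1 - P1) - A1) * w2 - (Y2 * (Y2 * A2 - P2) - A2) * w1 =
       (Y1 * Y1 * A1 - A1) * w2 - (Y2 * Y2 * A2 - A2) * w1 - P1 * w2 * (Y1 - Y2).
      by rewrite -split; ring.
    by rewrite /a1 /a0; ring.
  - have -> : (Y1 * (Y1 * (Y1 * A1 - P1) - A1) - (Y1 * A1 - P1)) * w2 -
        (Y2 * (Y2 * (Y2 * A2 - P2) - A2) - (Y2 * A2 - P2)) * w1 =
       (Y1 * (Y1 * Y1 * A1 - A1) - Y1 * A1) * w2 - (Y2 * (Y2 * Y2 * A2 - A2) - Y2 * A2) * w1
         - P1 * w2 * ((Y1 * Y1 - 1) - (Y2 * Y2 - 1)).
      by rewrite -split; ring.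
    by rewrite /a1 /a0; ring.
elim/ltn_ind=> q IH; case: (ltnP q 4) => [|q4]; first exact: base.
have -> : q = (q - 4).+4 by lia.
have I0 := IH (q - 4)%N; have I1 := IH (q - 4).+1; have I2 := IH (q - 4).+2; have I3 := IH (q - 4).+3.
have {I0}I0 := I0 (ltac:(lia)); have {I1}I1 := I1 (ltac:(lia)).
have {I2}I2 := I2 (ltac:(lia)); have {I3}I3 := I3 (ltac:(lia)).
move: (q - 4)%N I0 I1 I2 I3 => k I0 I1 I2 I3.
transitivity (a1 * ((- a) ^+ k.+3 * (e1 k.+3 * w2 - e2 k.+3 * w1))
   - a0 * a * ((- a) ^+ k.+2 * (e1 k.+2 * w2 - e2 k.+2 * w1))
   + a1 * a ^+ 2 * ((- a) ^+ k.+1 * (e1 k.+1 * w2 - e2 k.+1 * w1))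
   - a ^+ 4 * ((- a) ^+ k * (e1 k * w2 - e2 k * w1))).
  rewrite !e1S !e2S !(exprS _ k.+3) !(exprS _ k.+2) !(exprS _ k.+1) !(exprS _ k) /a1 /a0.
  by move: ((- a) ^+ k) => b; ring.
rewrite I0 I1 I2 I3 (fS k.+3) (fS k.+2) (fS k.+1).
by move: (a1) (a0) => b1 b0; ring.
Qed.

Definition chebv (C : numClosedFieldType) (Y : C) k := (cheb C k).[Y].

Lemma chebv_rec (C : numClosedFieldType) (Y : C) k :
  chebv Y k.+2 = Y * chebv Y k.+1 - (1 + (k == 0%N)%:R) * chebv Y k.
Proof. by rewrite /chebv cheb_rec !(hornerD, hornerN, hornerM, hornerX, hornerZ). Qed.

Lemma chebv_0 (C : numClosedFieldType) (Y : C) : chebv Y 0 = 1. Proof. exact: hornerC. Qed.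
Lemma chebv_1 (C : numClosedFieldType) (Y : C) : chebv Y 1 = Y. Proof. exact: hornerX. Qed.

Lemma chebv_recS (C : numClosedFieldType) (Y : C) k :
  chebv Y k.+3 = Y * chebv Y k.+2 - chebv Y k.+1.
Proof. by rewrite chebv_rec addr0 mul1r. Qed.

Section Psi.
Variables (C : numClosedFieldType) (a Y1 Y2 : C).
(* [Y1] and [Y2] are the roots of the quadratic a Y^2 + a1 Y + (a0 - 2 a). *)
Let a1 : C := - a * (Y1 + Y2).
Let a0 : C := a * (Y1 * Y2 + 2).

Notation Q := (Qseq a0 a1 a).
Notation R := (Rseq a0 a1 a).
Notation S := (Sseq a0 a1 a).

(** The sums of [Rseq] in the definition of [chi] and in the recurrence of [Rseq] are tails of
    this one. It amounts to division of the generating function by 1 + a u, which turns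
    the recurrence of [Rseq], of unbounded length, into one of order five. *)
Definition Rp (k : nat) : C := \sum_(0 <= s < k.+1) (- a) ^+ s * R (k%:Z - s%:Z).

Definition Rpz (j : int) : C := if j is Posz k then Rp k else 0.

Lemma R_Rpz (j : int) : R j = Rpz j + a * Rpz (j - 1).
Proof.
case: j => [[|k]|k]; last by rewrite /= mulr0 addr0.
  have -> : Rpz (0%:Z - 1) = 0 by [].
  by rewrite /= /Rp big_nat1 expr0 mul1r subr0 mulr0 addr0.
have -> : k.+1%:Z - 1 = k by lia.
rewrite /= /Rp big_nat_recl // expr0 mul1r subr0 mulr_sumr.
rewrite -addrA -big_split big1 /= ?addr0 // => s _.
have -> : k.+1%:Z - s.+1%:Z = k%:Z - s%:Z by lia.
by rewrite exprS; ring.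
Qed.

Lemma R_tail (k : nat) : \sum_(1 <= s < k.+1) (- a) ^+ s * R (k%:Z - s%:Z) = Rp k - R k.
Proof. by rewrite [in RHS]/Rp [in RHS]big_ltn // expr0 mul1r subr0 addrAC subrr add0r. Qed.

Definition Trec (f : int -> C) (j : int) := (a0 - a) * f (j - 1) + (a0 * a - a1 ^+ 2) * f (j - 2)
  + (a1 ^+ 2 * a - a0 * a ^+ 2) * f (j - 3) + (a ^+ 4 - a0 * a ^+ 3) * f (j - 4) + a ^+ 5 * f (j - 5).

Lemma Rpz_rec (j : int) : 1 <= j -> Rpz j = Trec Rpz j.
Proof.
case: j => [[|r]|] // _.
have tail : \sum_(1 <= s < r.+1.-1) (- a) ^+ s * R (r.+1%:Z - s%:Z - 2) =
    Rpz (r.+1%:Z - 2) - R (r.+1%:Z - 2).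
  case: r => [|k]; first by rewrite big_geq // subrr.
  have -> : k.+2%:Z - 2 = k by lia.
  rewrite /= -R_tail; apply: eq_bigr => s _.
  by congr (_ * R _); lia.
have := R_rec a0 a1 a (ltn0Sn r); rewrite tail.
move: (r.+1%:Z) => j; rewrite !R_Rpz /Trec.
have -> : j - 1 - 1 = j - 2 by lia.
have -> : j - 2 - 1 = j - 3 by lia.
have -> : j - 3 - 1 = j - 4 by lia.
have -> : j - 4 - 1 = j - 5 by lia.
move: (Rpz j) (Rpz (j - 1)) (Rpz (j - 2)) (Rpz (j - 3)) (Rpz (j - 4)) (Rpz (j - 5)) => x0 x1 x2 x3 x4 x5.
by move/eqP; rewrite -subr_eq0 => /eqP H; apply/eqP; rewrite -subr_eq0 -H; apply/eqP; ring.
Qed.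

(** [psi] is a combination of [Q q], [Q (q - 1)] and [Q (q - 2)] with coefficients [psi0],
    [psi1] and [psi2] that depend on [r] only, see [psi_split]. *)
Definition psi0 (r : nat) : C := \sum_(0 <= t < r.+1) R (r%:Z - t%:Z) * S t.

(** The sums of [Rseq] in [chi] contribute to [psi1] through this convolution. *)
Definition Wp (r : nat) : C := \sum_(0 <= t < r.+1) Rp (r - t) * S t.

Lemma psi0_0 : psi0 0 = 1.
Proof. by rewrite /psi0 big_nat1 subr0 /= mulr1. Qed.

Lemma Wp0 : Wp 0 = 1.
Proof. by rewrite /Wp big_nat1 /Rp big_nat1 expr0 mul1r subr0 mulr1. Qed.

Lemma psi0_Wp r : psi0 r.+1 = Wp r.+1 + a * Wp r.
Proof.
rewrite /psi0 /Wp big_nat_recr // [in RHS]big_nat_recr //=.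
rewrite subrr subnn [in RHS]addrAC; congr (_ + _); last first.
  by congr (_ * _); rewrite R_Rpz /= mulr0 addr0.
rewrite mulr_sumr -big_split; apply: eq_big_nat => t /andP[_ tr] /=.
rewrite [a * _]mulrA -mulrDl R_Rpz; congr ((_ + _ * _) * _).
  by rewrite subzn; last exact: ltnW.
have -> : r.+1%:Z - t%:Z - 1 = (r - t)%N by lia.
by [].
Qed.

(** Up to its constant term and a shift, (1 + a u) times the generating function of
    [Sseq]; it is a polynomial because S_t is geometric for t >= 5. *)
Definition Sp (t : nat) : C := match t with
  | 0 => a | 1 => a0 * a - a1 ^+ 2 | 2 => a1 ^+ 2 * a - 2 * a ^+ 3
  | 3 => - a0 * a ^+ 3 - a ^+ 4 | 4 => a ^+ 5 | _ => 0 end.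

Lemma Sp_S t : S t.+1 + a * S t = Sp t.
Proof.
case: t => [|[|[|[|[|t]]]]]; rewrite /Sseq /Sp ?subSS ?subn0; try ring.
by rewrite [(- a) ^+ t.+4]exprS; ring.
Qed.

Lemma sum5 (f : nat -> C) : \sum_(0 <= t < 5) f t = f 0%N + (f 1%N + (f 2%N + (f 3%N + f 4%N))).
Proof. by do 5!rewrite big_ltn //; rewrite big_geq // addr0. Qed.

(** As [Rpz] vanishes at negative indices, the convolution that defines [psi0] becomes a sum
    with the same number of terms for all [r]. *)
Definition psi0z (j : int) : C := Rpz j + \sum_(0 <= t < 5) Rpz (j - 1 - t%:Z) * Sp t.

Lemma psi0_psi0z (r : nat) : psi0 r = psi0z r.
Proof.
case: r => [|r].
  rewrite psi0_0 /psi0z big1_seq => [|t _].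
    by rewrite addr0 /= /Rp big_nat1 expr0 mul1r subr0.
  have -> : 0%:Z - 1 - t%:Z = Negz t by lia.
  by rewrite /= mul0r.
rewrite psi0_Wp /Wp big_nat_recl // subn0 mulr1 mulr_sumr -addrA -big_split /= /psi0z; congr (_ + _).
have -> : \sum_(0 <= t < 5) Rpz (r.+1%:Z - 1 - t%:Z) * Sp t =
   \sum_(0 <= t < r + 6) Rpz (r%:Z - t%:Z) * Sp t.
  rewrite [RHS](@big_cat_nat _ _ _ 5) //=; last by lia.
  rewrite [X in _ = _ + X]big_nat_cond [X in _ = _ + X]big1 ?addr0 => [|t /andP[/andP[t5 _] _]].
    by apply: eq_bigr => t _; congr (Rpz _ * _); lia.
  by do 5![case: t t5 => [|t] t5 //]; rewrite mulr0.
rewrite [RHS](@big_cat_nat _ _ _ r.+1) //=; last by lia.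
rewrite [X in _ = _ + X]big_nat_cond [X in _ = _ + X]big1 ?addr0 => [|t /andP[/andP[tr _] _]].
  apply: eq_big_nat => t /andP[_ tr].
  rewrite subSS -Sp_S mulrDr mulrCA; congr (_ + _ * _); by rewrite subzn.
have : r%:Z - t%:Z < 0 by lia.
by case: (_ - _) => // k _; rewrite mul0r.
Qed.

Lemma recurrence_combination (t1 t2 t3 t4 t5 c0 c1 c2 c3 c4 x0 x1 x2 x3 x4 x5 x6 x7 x8 x9 x10 : C) :
  x0 = t1 * x1 + t2 * x2 + t3 * x3 + t4 * x4 + t5 * x5 ->
  x1 = t1 * x2 + t2 * x3 + t3 * x4 + t4 * x5 + t5 * x6 ->
  x2 = t1 * x3 + t2 * x4 + t3 * x5 + t4 * x6 + t5 * x7 ->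
  x3 = t1 * x4 + t2 * x5 + t3 * x6 + t4 * x7 + t5 * x8 ->
  x4 = t1 * x5 + t2 * x6 + t3 * x7 + t4 * x8 + t5 * x9 ->
  x5 = t1 * x6 + t2 * x7 + t3 * x8 + t4 * x9 + t5 * x10 ->
  x0 + (x1 * c0 + (x2 * c1 + (x3 * c2 + (x4 * c3 + x5 * c4)))) =
  t1 * (x1 + (x2 * c0 + (x3 * c1 + (x4 * c2 + (x5 * c3 + x6 * c4)))))
  + t2 * (x2 + (x3 * c0 + (x4 * c1 + (x5 * c2 + (x6 * c3 + x7 * c4)))))
  + t3 * (x3 + (x4 * c0 + (x5 * c1 + (x6 * c2 + (x7 * c3 + x8 * c4)))))
  + t4 * (x4 + (x5 * c0 + (x6 * c1 + (x7 * c2 + (x8 * c3 + x9 * c4)))))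
  + t5 * (x5 + (x6 * c0 + (x7 * c1 + (x8 * c2 + (x9 * c3 + x10 * c4))))).
Proof.
move=> H0 H1 H2 H3 H4 H5; apply/eqP; rewrite -subr_eq0; apply/eqP.
transitivity ((x0 - (t1 * x1 + t2 * x2 + t3 * x3 + t4 * x4 + t5 * x5))
  + (x1 - (t1 * x2 + t2 * x3 + t3 * x4 + t4 * x5 + t5 * x6)) * c0
  + (x2 - (t1 * x3 + t2 * x4 + t3 * x5 + t4 * x6 + t5 * x7)) * c1
  + (x3 - (t1 * x4 + t2 * x5 + t3 * x6 + t4 * x7 + t5 * x8)) * c2
  + (x4 - (t1 * x5 + t2 * x6 + t3 * x7 + t4 * x8 + t5 * x9)) * c3
  + (x5 - (t1 * x6 + t2 * x7 + t3 * x8 + t4 * x9 + t5 * x10)) * c4); first by ring.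
by rewrite -H0 -H1 -H2 -H3 -H4 -H5 !subrr !mul0r !addr0.
Qed.

Lemma psi0z_rec (j : int) : 6 <= j -> psi0z j = Trec psi0z j.
Proof.
move=> j6; pose x (k : nat) := Rpz (j - k%:Z).
have A (i : nat) : psi0z (j - i%:Z) = x i + (x i.+1 * Sp 0 + (x i.+2 * Sp 1 +
   (x i.+3 * Sp 2 + (x i.+4 * Sp 3 + x i.+4.+1 * Sp 4)))).
  rewrite /psi0z sum5 /x.
  by congr (_ + (Rpz _ * _ + (Rpz _ * _ + (Rpz _ * _ + (Rpz _ * _ + Rpz _ * _))))); lia.
have H (k : nat) : (k < 6)%N -> x k = (a0 - a) * x k.+1 + (a0 * a - a1 ^+ 2) * x k.+2
  + (a1 ^+ 2 * a - a0 * a ^+ 2) * x k.+3 + (a ^+ 4 - a0 * a ^+ 3) * x k.+4 + a ^+ 5 * x k.+4.+1.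
  move=> k6; rewrite {1}/x Rpz_rec; last by lia.
  rewrite /Trec /x; congr (_ * Rpz _ + _ * Rpz _ + _ * Rpz _ + _ * Rpz _ + _ * Rpz _); lia.
have A0 := A 0%N; rewrite subr0 in A0; rewrite A0.
rewrite /Trec (A 1%N : psi0z (j - 1) = _) (A 2%N : psi0z (j - 2) = _) (A 3%N : psi0z (j - 3) = _)
  (A 4%N : psi0z (j - 4) = _) (A 5%N : psi0z (j - 5) = _).
by apply: recurrence_combination; apply: H.
Qed.


Local Notation z1 := (chebv Y1).
Local Notation z2 := (chebv Y2).

(** A discrete Wronskian. With Y_i = l_i + 1/l_i, its recurrence has the roots
    l_1 l_2, l_1 / l_2, l_2 / l_1 and 1 / (l_1 l_2); multiplied by [a], these are roots of the
    characteristic polynomial of [psi0]. *)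
Definition Dz r := z1 r.+1 * z2 r - z1 r * z2 r.+1.

(** Shifted so that the five vanishing terms of negative index have an index in [nat]. *)
Definition Rpsh (i : nat) : C := Rpz (i%:Z - 5).

Lemma Rpsh_neg i : (i < 5)%N -> Rpsh i = 0.
Proof.
move=> i5; rewrite /Rpsh; have : i%:Z - 5 < 0 by lia.
by case: (_ - _). Qed.

Lemma Rpsh5 : Rpsh 5 = 1.
Proof. by rewrite /Rpsh subrr /= /Rp big_nat1 expr0 mul1r subr0. Qed.

Lemma Rpsh_rec i : Rpsh i.+4.+2 = (a0 - a) * Rpsh i.+4.+1 + (a0 * a - a1 ^+ 2) * Rpsh i.+4
  + (a1 ^+ 2 * a - a0 * a ^+ 2) * Rpsh i.+3 + (a ^+ 4 - a0 * a ^+ 3) * Rpsh i.+2 + a ^+ 5 * Rpsh i.+1.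
Proof.
rewrite {1}/Rpsh Rpz_rec; last by lia.
by rewrite /Trec /Rpsh; congr (_ * Rpz _ + _ * Rpz _ + _ * Rpz _ + _ * Rpz _ + _ * Rpz _); lia.
Qed.

Lemma psi0_Rpsh r : psi0 r = Rpsh r.+4.+1 + (Rpsh r.+4 * Sp 0 + (Rpsh r.+3 * Sp 1 + (Rpsh r.+2 * Sp 2
  + (Rpsh r.+1 * Sp 3 + Rpsh r * Sp 4)))).
Proof.
rewrite psi0_psi0z /psi0z sum5 /Rpsh.
by congr (Rpz _ + (Rpz _ * _ + (Rpz _ * _ + (Rpz _ * _ + (Rpz _ * _ + Rpz _ * _))))); lia.
Qed.

(** The values before [psi0_rec] applies: that recurrence needs all the shifts of [Rpz] in
    [psi0z] to satisfy theirs. *)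
Lemma psi0_closed_small k : (k < 6)%N -> (Y1 - Y2) * psi0 k = a ^+ k * Dz k.
Proof.
move=> k6; rewrite psi0_Rpsh; apply: initial_values => //.
- exact: Rpsh_neg.
- exact: Rpsh5.
- exact: Rpsh_rec.
- exact: chebv_0.
- exact: chebv_1.
- by rewrite chebv_rec chebv_1 chebv_0 mulr1.
- exact: chebv_recS.
- exact: chebv_0.
- exact: chebv_1.
- by rewrite chebv_rec chebv_1 chebv_0 mulr1.
- exact: chebv_recS.
Qed.

Lemma psi0_rec k : psi0 k.+4.+2 = (a0 - a) * psi0 k.+4.+1 + (a0 * a - a1 ^+ 2) * psi0 k.+4
  + (a1 ^+ 2 * a - a0 * a ^+ 2) * psi0 k.+3 + (a ^+ 4 - a0 * a ^+ 3) * psi0 k.+2 + a ^+ 5 * psi0 k.+1.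
Proof.
rewrite !psi0_psi0z psi0z_rec; last by lia.
by rewrite /Trec; congr (_ * psi0z _ + _ * psi0z _ + _ * psi0z _ + _ * psi0z _ + _ * psi0z _); lia.
Qed.

Lemma psi0_closed r : (Y1 - Y2) * psi0 r = a ^+ r * Dz r.
Proof.
elim/ltn_ind: r => r IH; case: (ltnP r 6) => [|r6]; first exact: psi0_closed_small.
have rE : r = (r - 6).+4.+2 by lia.
move: (r - 6)%N rE => k rE; rewrite {}rE in IH *.
have I (i : nat) : (i < k.+4.+2)%N -> (Y1 - Y2) * psi0 i = a ^+ i * Dz i by apply: IH.
rewrite psi0_rec !mulrDr ![(Y1 - Y2) * (_ * psi0 _)]mulrCA !I //; try lia.
rewrite /Dz !chebv_recS /a1 /a0.
rewrite !(exprS a k.+4.+1) !(exprS a k.+4) !(exprS a k.+3) !(exprS a k.+2) !(exprS a k.+1) !(exprS a k).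
move: (a ^+ k) (z1 k.+1) (z1 k.+2) (z2 k.+1) (z2 k.+2) => b u1 u2 v1 v2.
by ring.
Qed.

Definition psi1 (r : nat) : C := a1 * (Wp r - psi0 r + (1 - (r == 0%N)%:R) * (- a) ^+ r).

Definition psi2 (r : nat) : C := a ^+ 3 * (if r is k.+1 then psi0 k else 0)
  + (- (r == 0%N)%:R * a ^+ 2 + (r == 1%N)%:R * a ^+ 3).

(** Induction with [psi1 r.+1 = - a psi1 r - a a1 psi0 r], up to a factor 2 for [r = 0]. *)
Lemma psi1_closed r : (Y1 - Y2) * psi1 r = a ^+ r.+1 * (Y2 * z1 r.+1 * z2 r - Y1 * z2 r.+1 * z1 r).
Proof.
elim: r => [|r IH].
  by rewrite /psi1 Wp0 psi0_0 !chebv_0 !chebv_1 /=; ring.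
have H : psi1 r.+1 = - a * psi1 r - a * a1 * (1 + (r == 0%N)%:R) * psi0 r.
  rewrite /psi1 psi0_Wp; case: r {IH} => [|r] /=; first by rewrite Wp0 psi0_0; ring.
  rewrite [(- a) ^+ r.+2]exprS psi0_Wp; ring.
rewrite H mulrDr mulrCA IH mulrN [(Y1 - Y2) * (_ * psi0 r)]mulrCA psi0_closed /Dz.
rewrite !chebv_rec !(exprS a r.+1) (exprS a r) /a1.
case: r {IH H} => [|r] /=; first by rewrite !chebv_0 !chebv_1; ring.
by move: (a ^+ r.+1) => b; ring.
Qed.

Lemma psi2_closed r : (Y1 - Y2) * psi2 r =
  a ^+ r.+2 * (Dz r - (Y1 - Y2) * ((1 + (r == 0%N)%:R) * z1 r * z2 r)).
Proof.
case: r => [|[|r]]; rewrite /psi2 /Dz /=.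
- by rewrite !chebv_0 !chebv_1; ring.
- by rewrite psi0_0 !chebv_rec /= !chebv_0 !chebv_1; ring.
rewrite !mulr0n mulrDr mulrCA psi0_closed /Dz !chebv_recS.
rewrite (exprS a r.+3) (exprS a r.+2) (exprS a r.+1).
by move: (a ^+ r.+1) => b; ring.
Qed.

Lemma psi_split q r : psi a0 a1 a q r =
  Q q%:Z * psi0 r + Q (q%:Z - 1) * psi1 r + Q (q%:Z - 2) * psi2 r.
Proof.
have chi0 j : chi a0 a1 a j 0 = Q j.
  by rewrite /chi big_geq // sub0r mulr0 !addr0 /= mulr0 mulr1 addr0.
rewrite /psi !chi0.
have -> : \sum_(0 <= t < r.+1) chi a0 a1 a q (r - t) * S t =
    Q q * psi0 r + Q (q%:Z - 2) * (a ^+ 3 * (if r is k.+1 then psi0 k else 0))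
    + Q (q%:Z - 1) * (a1 * (Wp r - psi0 r)).
  have -> : (if r is k.+1 then psi0 k else 0) = \sum_(0 <= t < r.+1) R (r%:Z - t%:Z - 1) * S t.
    case: r => [|k].
      by rewrite big_nat1 /= mul0r.
    rewrite big_nat_recr // subrr /= mul0r addr0; apply: eq_bigr => t _.
    by congr (R _ * _); lia.
  rewrite /Wp /psi0 -sumrB !mulr_sumr -!big_split; apply: eq_big_nat => t /andP[_ tr].
  rewrite /chi R_tail subzn //; cbv beta.
  move: (Q q) (Q (q%:Z - 1)) (Q (q%:Z - 2)) (R (r - t)%N) (R ((r - t)%N%:Z - 1)) (Rp (r - t)) => u0 u1 u2 v0 v1 v2.
  by rewrite /=; ring.
by rewrite /psi1 /psi2; ring.
Qed.

(** [psi_split] and the closed forms of its three coefficients are recognized as the right-hand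
    side of [Q_combination], where [f] is [Q] shifted so as to include three zeros. *)
Theorem psi_closed q r : (Y1 - Y2) * psi a0 a1 a q r =
  a ^+ r * ((- a) ^+ q * (z1 (q + r).+1 * z2 r - z1 r * z2 (q + r).+1)).
Proof.
pose f (i : nat) := Q (i%:Z - 3).
have H := @Q_combination C a Y1 Y2 (z1 r.+1) (z2 r.+1) ((1 + (r == 0%N)%:R) * z1 r)
  ((1 + (r == 0%N)%:R) * z2 r) (z1 r) (z2 r) (fun i => z1 (i + r).+1) (fun i => z2 (i + r).+1) f.
rewrite [z1 r * _]mulrC H ?add0n ?add1n ?chebv_rec ?chebv_rec //.
- rewrite psi_split /f.
  have -> : q.+3%:Z - 3 = q by lia.
  have -> : q.+2%:Z - 3 = q%:Z - 1 by lia.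
  have -> : q.+1%:Z - 3 = q%:Z - 2 by lia.
  transitivity (Q q * ((Y1 - Y2) * psi0 r) + Q (q%:Z - 1) * ((Y1 - Y2) * psi1 r)
    + Q (q%:Z - 2) * ((Y1 - Y2) * psi2 r)).
    by move: (Q _) (Q _) (Q _) => u0 u1 u2; ring.
  rewrite psi0_closed psi1_closed psi2_closed /Dz.
  rewrite (exprS a r.+1) (exprS a r).
  by move: (a ^+ r) => b; ring.
- by ring.
- by move=> k; rewrite !addSn chebv_recS.
- by move=> k; rewrite !addSn chebv_recS.
move=> i; rewrite {1}/f Q_rec; last by lia.
by rewrite /f; congr (_ * Q _ - _ * Q _ + _ * Q _ - _ * Q _); lia.
Qed.

End Psi.

(** * The identity *)

Section Naturality.
Variables (A B : comPzRingType) (f : {rmorphism A -> B}).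

Lemma rmorph_nth0 (l : seq A) i : f l`_i = (map f l)`_i.
Proof. by elim: l i => [|x l IH] [|i] //=; rewrite rmorph0. Qed.

Lemma rmorph_rec_seq stepA stepB k : (forall l, f (stepA l) = stepB (map f l)) ->
  f (rec_seq stepA k) = rec_seq stepB k.
Proof.
move=> H; case: k => [k|k]; last by rewrite /= rmorph0.
rewrite /= rmorph_nth0; congr (_`_0).
by elim: k => [|k IH] /=; rewrite ?rmorph1 // H IH.
Qed.

Variables (a0 a1 a2 : A).

Lemma rmorph_Q k : f (Qseq a0 a1 a2 k) = Qseq (f a0) (f a1) (f a2) k.
Proof.
apply: rmorph_rec_seq => l.
by rewrite /Qstep !(rmorph_nat, rmorphXn, rmorphB, rmorphD, rmorphN, rmorphM, rmorph0, rmorph1) /= !rmorph_nth0.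
Qed.

Lemma rmorph_R k : f (Rseq a0 a1 a2 k) = Rseq (f a0) (f a1) (f a2) k.
Proof.
apply: rmorph_rec_seq => l.
rewrite /Rstep !(rmorph_nat, rmorphXn, rmorphB, rmorphD, rmorphN, rmorphM, rmorph0, rmorph1) /= !rmorph_nth0 size_map.
congr (_ - _ * _); rewrite rmorph_sum; apply: eq_bigr => s _.
by rewrite rmorphM rmorphXn rmorphN rmorph_nth0.
Qed.

Lemma rmorph_S t : f (Sseq a0 a1 a2 t) = Sseq (f a0) (f a1) (f a2) t.
Proof.
by case: t => [|[|[|[|[|t]]]]]; rewrite /Sseq ?subSS ?subn0;
  rewrite ?(rmorph_nat, rmorphXn, rmorphB, rmorphD, rmorphN, rmorphM, rmorph0, rmorph1).
Qed.

Lemma rmorph_chi q r : f (chi a0 a1 a2 q r) = chi (f a0) (f a1) (f a2) q r.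
Proof.
rewrite /chi !(rmorph_nat, rmorphXn, rmorphB, rmorphD, rmorphN, rmorphM, rmorph0, rmorph1) !rmorph_Q !rmorph_R.
congr (_ + _ * _); rewrite rmorph_sum; apply: eq_bigr => s _.
by rewrite rmorphM rmorphXn rmorphN rmorph_R.
Qed.

(** Used for evaluation of polynomials in [a_2], to remove the conditions on the
    parameters. *)
Lemma rmorph_psi q r : f (psi a0 a1 a2 q r) = psi (f a0) (f a1) (f a2) q r.
Proof.
have := rmorph_chi; rewrite /psi; move: (chi a0 a1 a2) (chi _ _ _) => c c' H.
rewrite !(rmorph_nat, rmorphXn, rmorphB, rmorphD, rmorphN, rmorphM, rmorph0, rmorph1) !H.
congr (_ + _ + _); rewrite rmorph_sum; apply: eq_bigr => s _.
by rewrite rmorphM H rmorph_S.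
Qed.

End Naturality.

Section Assembly.
Variables (C : numClosedFieldType) (n : nat).
Implicit Types x : 'rV[C]_n.

Lemma character_formula (lam : n.-tuple nat) (ch : 'rV[C]_n -> C) : (0 < n)%N ->
  (forall i j : 'I_n, (i <= j)%N -> (tnth lam j <= tnth lam i)%N) -> is_chO2n lam ch ->
  regular ch /\ forall x, nz x ->
    ch x * zdet (@deltaz n) x = zdet (fun i => tnth lam i + deltaz i)%N x.
Proof.
move=> n0 mono Hch.
have [m [wt [j0 [c [chE inv wt0 wtb rad]]]]] := chO2n_weights n0 Hch.
split; last by move=> x x0; rewrite chE //; apply: (weyl_character mono inv wt0 wtb rad).
apply: (@regular_ext C n (fun x => \sum_j xpow x (wt j))); first by move=> x /chE.
by apply: regular_sum => j _; apply: regular_xpow.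
Qed.

Lemma part21_mono p q (i j : 'I_n) : (i <= j)%N ->
  (tnth (part21 n p q) j <= tnth (part21 n p q) i)%N.
Proof.
by rewrite !tnth_mktuple => ij; do !case: ifP => ?; lia.
Qed.

Let revp : 'S_n := perm (@rev_ord_inj n).

(** With the rows in reverse order, the exponents [lam_i + n - 1 - i] are [0, ..., n + 1] with
    a gap after the [r] zero parts and another after the [q] parts 1. *)
Lemma zdet_part21 p q x : (p + q <= n)%N ->
  zdet (fun i => tnth (part21 n p q) i + deltaz i)%N x =
  (-1) ^+ revp * gapdet (ycoord x) (n.+1 - p) (n - p - q).
Proof.
move=> pq; rewrite /gapdet -det_perm -det_mulmx -row_permE; congr (\det _).
apply/matrixP=> i j; rewrite !mxE permE /=; congr (cheb C _).[_].
by rewrite tnth_mktuple /deltaz /bump; have := ltn_ord i; do !case: ifP => ?; lia.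
Qed.

Let vandermonde x : C := \prod_(i < n) \prod_(j < n | (i < j)%N) (ycoord x j - ycoord x i).

Lemma part21_character (ch : n.-tuple nat -> 'rV[C]_n -> C) p q x : (0 < n)%N -> (p + q <= n)%N ->
  is_chO2n (part21 n p q) (ch (part21 n p q)) -> nz x ->
  ch (part21 n p q) x * vandermonde x = gapdet (ycoord x) (n.+1 - p) (n - p - q).
Proof.
move=> n0 pq Hch x0; have [_ /(_ x x0)] := character_formula n0 (part21_mono p q) Hch.
rewrite zdet_deltaz zdet_part21 // mulrCA; apply: mulfI.
by rewrite signr_eq0.
Qed.

Variable ch : n.-tuple nat -> 'rV[C]_n -> C.
Hypothesis n0 : (0 < n)%N.
Hypothesis Hch : forall p q : nat, (p + q <= n)%N -> is_chO2n (part21 n p q) (ch (part21 n p q)).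

Let lhs (a0 a1 a2 : C) x := \prod_(i < n) (a0 + a1 * (x 0 i + (x 0 i)^-1)
                 + a2 * (x 0 i ^+ 2 + (x 0 i)^-1 ^+ 2)).
Let rhs (a0 a1 a2 : C) x := \sum_(0 <= p < n.+1) \sum_(0 <= q < (n - p).+1)
     a2 ^+ p * psi a0 a1 a2 q (n - p - q) * ch (part21 n p q) x.

(** Compare [dual_cauchy] term by term, using [part21_character] and [psi_closed]. *)
Lemma factored_vandermonde a Y1 Y2 x : nz x ->
  (Y1 - Y2) * (lhs (a * (Y1 * Y2 + 2)) (- a * (Y1 + Y2)) a x * vandermonde x) =
  (Y1 - Y2) * (rhs (a * (Y1 * Y2 + 2)) (- a * (Y1 + Y2)) a x * vandermonde x).
Proof.
move=> x0.
have -> : lhs (a * (Y1 * Y2 + 2)) (- a * (Y1 + Y2)) a x =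
    a ^+ n * \prod_i ((ycoord x i - Y1) * (ycoord x i - Y2)).
  rewrite /lhs -[in a ^+ n](card_ord n) -prodr_const -big_split; apply: eq_bigr => i _ /=.
  have -> : x 0 i ^+ 2 + (x 0 i)^-1 ^+ 2 = ycoord x i ^+ 2 - 2.
    by rewrite /ycoord sqrrD mulfV // mulr2n; ring.
  by rewrite -/(ycoord x i); ring.
rewrite -mulrA mulrCA dual_cauchy mulr_sumr mulr_suml mulr_sumr.
apply: eq_big_nat => p /andP[_ pn]; rewrite mulr_sumr mulr_suml mulr_sumr.
apply: eq_big_nat => q /andP[_ qn].
have pq : (p + q <= n)%N by lia.
rewrite -[_ * _ * vandermonde x]mulrA (part21_character n0 pq (Hch pq) x0).
rewrite !mulrA; congr (_ * _).
rewrite -[in RHS]mulrA [in RHS]mulrCA psi_closed /chebv.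
have -> : (q + (n - p - q)).+1 = (n.+1 - p)%N by lia.
rewrite (exprNn a q).
have -> : a ^+ n = a ^+ p * a ^+ (n - p - q) * a ^+ q.
  by rewrite -!exprD; congr (_ ^+ _); lia.
by ring.
Qed.

Lemma regular_coord (i : 'I_n) k : regular (fun x => x 0 i ^ k).
Proof.
apply: (regular_ext (f := fun x => xpow x (fun j => if j == i then k else 0))); last exact: regular_xpow.
move=> x x0; rewrite /xpow (bigD1 i) //= eqxx big1 ?mulr1 // => j /negPf ->.
exact: expr0z.
Qed.

Lemma regular_lhs a0 a1 a2 : regular (lhs a0 a1 a2).
Proof.
apply: regular_prod => i _.
apply: (regular_ext (f := fun x => a0 + a1 * (x 0 i ^ 1 + x 0 i ^ (-1))
   + a2 * (x 0 i ^ 2 + x 0 i ^ (-2)))) => [x x0|].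
  by rewrite exprVn.
have rc c k : regular (fun x => c * (x 0 i ^ k + x 0 i ^ (- k))).
  apply: regularM; first exact: regular_cst.
  by apply: regularD; apply: regular_coord.
apply: regularD; last exact: (rc a2 2).
by apply: regularD; [apply: regular_cst | apply: (rc a1 1)].
Qed.

Lemma regular_rhs a0 a1 a2 : regular (rhs a0 a1 a2).
Proof.
rewrite /rhs; apply: (regular_ext (f := fun x => \sum_(0 <= p < n.+1 | (p <= n)%N)
   \sum_(0 <= q < (n - p).+1 | (p + q <= n)%N)
     a2 ^+ p * psi a0 a1 a2 q (n - p - q) * ch (part21 n p q) x)) => [x _|].
  rewrite big_nat_cond [RHS]big_nat_cond; apply: eq_big => [p|p /andP[/andP[_ pn] _]]; first by lia.
  by rewrite big_nat_cond [RHS]big_nat_cond; apply: eq_bigl => q; lia.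
apply: regular_sum => p _; apply: regular_sum => q pq; apply: regularM.
  exact: regular_cst.
exact: (character_formula n0 (part21_mono p q) (Hch pq)).1.
Qed.

(** The Vandermonde product is cancelled off its zeros, and both sides are regular in [x]. *)
Lemma identity_distinct_roots a Y1 Y2 x : Y1 != Y2 -> nz x ->
  lhs (a * (Y1 * Y2 + 2)) (- a * (Y1 + Y2)) a x = rhs (a * (Y1 * Y2 + 2)) (- a * (Y1 + Y2)) a x.
Proof.
move=> Y12 x0; apply/eqP; rewrite -subr_eq0 -[rhs _ _ _ x]mul1r -mulNr; apply/eqP.
move: x x0; apply: regular_density.
  apply: regularD; first exact: regular_lhs.
  by apply: regularM; [apply: regular_cst | apply: regular_rhs].
move=> x x0 gx; rewrite mulN1r; apply/eqP; rewrite subr_eq0; apply/eqP.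
have := factored_vandermonde a Y1 Y2 x0 => /(mulfI _) H.
apply/mulIf/H; last by rewrite subr_eq0.
apply/prodf_neq0 => i _; apply/prodf_neq0 => j ij; rewrite subr_eq0 gx //.
by apply: contraTneq ij => ->; rewrite ltnn.
Qed.

(** [a1 ^+ 2 - 4 * a0 * a2 + 8 * a2 ^+ 2] is the discriminant of the quadratic
    a_2 y^2 + a_1 y + (a_0 - 2 a_2). *)
Lemma identity_discriminant a0 a1 a2 x :
  a2 * (a1 ^+ 2 - 4 * a0 * a2 + 8 * a2 ^+ 2) != 0 -> nz x -> lhs a0 a1 a2 x = rhs a0 a1 a2 x.
Proof.
rewrite mulf_eq0 negb_or => /andP[a2n dn] x0.
set d := _ + _ in dn; pose s := sqrtC d.
have ss : s * s = d by rewrite -expr2 sqrtCK.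
pose Y1 := (- a1 + s) / (2 * a2); pose Y2 := (- a1 - s) / (2 * a2).
have two : 2 != 0 :> C by rewrite pnatr_eq0.
have e1 : a1 = - a2 * (Y1 + Y2) by rewrite /Y1 /Y2; field; rewrite ?a2n ?two.
have e0 : a0 = a2 * (Y1 * Y2 + 2).
  have -> : Y1 * Y2 = (a1 ^+ 2 - s * s) / (4 * a2 ^+ 2) by rewrite /Y1 /Y2; field; rewrite ?a2n ?two.
  by rewrite ss /d; field.
rewrite e0 e1; apply: identity_distinct_roots => //.
rewrite -subr_eq0 (_ : Y1 - Y2 = s / a2); last by rewrite /Y1 /Y2; field; rewrite ?a2n ?two.
by rewrite mulf_neq0 ?invr_eq0 ?sqrtC_eq0.
Qed.

(** As polynomials in [a2], the two sides agree off the zeros of [p], which is nonzero with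
    leading coefficient 8. *)
Lemma identity_all a0 a1 a2 x : nz x -> lhs a0 a1 a2 x = rhs a0 a1 a2 x.
Proof.
move=> x0.
pose q : {poly C} := \prod_(i < n) (a0%:P + a1%:P * (x 0 i + (x 0 i)^-1)%:P
                 + 'X * (x 0 i ^+ 2 + (x 0 i)^-1 ^+ 2)%:P)
   - \sum_(0 <= p < n.+1) \sum_(0 <= q < (n - p).+1)
     'X ^+ p * psi a0%:P a1%:P 'X q (n - p - q) * (ch (part21 n p q) x)%:P.
have qE z : q.[z] = lhs a0 a1 z x - rhs a0 a1 z x.
  rewrite /q hornerD hornerN horner_prod horner_sum; congr (_ - _).
    by apply: eq_bigr => i _; rewrite !(hornerD, hornerM, hornerC, hornerX).
  apply: eq_bigr => p _; rewrite horner_sum; apply: eq_bigr => r _.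
  rewrite !hornerM hornerC hornerXn; congr (_ * _ * _).
  have H := rmorph_psi (horner_eval z) a0%:P a1%:P 'X r (n - p - r).
  change ((psi a0%:P a1%:P 'X r (n - p - r)).[z] =
    psi (a0%:P).[z] (a1%:P).[z] ('X).[z] r (n - p - r)) in H.
  by rewrite H !hornerC hornerX.
pose p : {poly C} := 'X * ((a1 ^+ 2)%:P - (4 * a0) *: 'X + 8 *: 'X^2).
have pn : p != 0.
  apply/eqP => /(congr1 (fun r : {poly C} => r`_3)).
  rewrite /p coefXM coef0 !(coefD, coefB, coefN, coefZ, coefC, coefX, coefXn) /=.
  by rewrite mulr0 oppr0 !add0r mulr1 => /eqP; rewrite pnatr_eq0.
have q0 : q = 0.
  apply: (poly_vanish_nz pn) => z; rewrite qE => pz; apply/eqP; rewrite subr_eq0; apply/eqP.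
  apply: identity_discriminant => //; apply: contraNneq pz => pz.
  by rewrite /p !(hornerM, hornerX, hornerD, hornerN, hornerZ, hornerC, hornerXn) pz.
by have := qE a2; rewrite q0 horner0 => /esym/eqP; rewrite subr_eq0 => /eqP.
Qed.

End Assembly.

Theorem theorem6p1 (C : numClosedFieldType) (n : nat) (hn : (1 <= n)%N)
  (ch : n.-tuple nat -> 'rV[C]_n -> C)
  (hch : forall p q : nat, (p + q <= n)%N ->
     is_chO2n (part21 n p q) (ch (part21 n p q)))
  (a0 a1 a2 : C) (x : 'rV[C]_n) (hx : forall i, x 0 i != 0) :
  \prod_(i < n) (a0 + a1 * (x 0 i + (x 0 i)^-1)
                 + a2 * (x 0 i ^+ 2 + (x 0 i)^-1 ^+ 2)) =
  \sum_(0 <= p < n.+1) \sum_(0 <= q < (n - p).+1)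
     a2 ^+ p * psi a0 a1 a2 q (n - p - q) * ch (part21 n p q) x.
Proof. exact: identity_all. Qed.
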